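(* Let $R=\mathbf C[a_0,\dots,a_6]=\mathrm{Sym}^\bullet(S_6)$ be the homogeneous coordinate ring of $\mathbf P S_6\simeq\mathbf P^6$, let $\Omega\subseteq\mathbf P^6$ be the Zariski closure of the set of tri-involutive sextuples, and let $J\subseteq R$ be its homogeneous defining ideal. Then $\Omega$ is an arithmetically Cohen-Macaulay subvariety of $\mathbf P^6$ of codimension two, and the $SL_2$-equivariant minimal free resolution of $R/J$ is $$0\leftarrow R/J\leftarrow R\leftarrow R(-5)\otimes S_4\leftarrow \bigl(R(-6)\otimes S_2\bigr)\oplus R(-7)\leftarrow 0 .$$
   Context: The base field is $\mathbf C$. $S_d$ denotes the $SL_2$-representation of homogeneous polynomials of degree $d$ in the variables $x_1,x_2$ (so $\dim S_d=d+1$). A set of six points $\{z_1,\dots,z_6\}\subseteq\mathbf C\cup\{\infty\}=\mathbf P^1$ is identified with the point of $\mathbf P S_6\simeq\mathbf P^6$ represented by the binary sextic $\prod_{i=1}^6(x_1-z_i x_2)$ (a factor with $z_i=\infty$ is interpreted as $x_2$). The $a_i$ are the coefficients of the generic binary sextic $\sum_{i=0}^6 a_i\binom{6}{i}x_1^{6-i}x_2^i$, viewed as homogeneous coordinates on $\mathbf P^6$. A set of six distinct points of $\mathbf P^1$ is tri-involutive if it is projectively equivalent (under an automorphism of $\mathbf P^1$) to $\{0,1,\infty,p,\frac{p-1}{p},\frac{1}{1-p}\}$ for some $p\in\mathbf P^1$. *)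

(* Defs.v *)
From HB Require Import structures.
From mathcomp Require Import all_boot all_order all_algebra finmap.
From mathcomp Require Import complex classical_sets reals.
From mathcomp Require Import mpoly.

Set Implicit Arguments.
Unset Strict Implicit.
Unset Printing Implicit Defensive.

Import GRing.Theory.
Local Open Scope ring_scope.
Local Open Scope classical_set_scope.

(* Depth, height and the Cohen-Macaulay property of a quotient A/J, for A
   Noetherian.  Ideals of A/J are identified with ideals of A containing J. *)
Section CohenMacaulay.
Variable A : comNzRingType.
Implicit Types (I J P : set A) (s : seq A).

Definition ideal_set I : Prop :=
  [/\ I 0, forall x y, I x -> I y -> I (x + y) & forall a x, I x -> I (a * x)].

Definition prime_set P : Prop :=
  [/\ ideal_set P, ~ P 1 & forall x y, P (x * y) -> P x \/ P y].

Definition maximal_set P : Prop :=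
  [/\ ideal_set P, ~ P 1 &
      forall I, ideal_set I -> P `<=` I -> ~ I 1 -> I = P].

(* The ideal J + (s_0, ..., s_(n-1)). *)
Definition ideal_add J s : set A :=
  [set x | exists j, J j /\ exists c : 'I_(size s) -> A,
     x = j + \sum_(i < size s) c i * s`_i].

(* s is a regular sequence on the A-module A/J. *)
Definition regular_seq_mod J s : Prop :=
  ~ ideal_add J s 1 /\
  forall i, (i < size s)%N -> forall x,
    ideal_add J (take i s) (s`_i * x) -> ideal_add J (take i s) x.

Definition depth_mod J P (n : nat) : Prop :=
  (exists s, [/\ size s = n, {in s, forall x, P x} & regular_seq_mod J s]) /\
  (forall s, {in s, forall x, P x} -> regular_seq_mod J s -> (size s <= n)%N).

Definition prime_chain_mod J P (n : nat) (c : nat -> set A) : Prop :=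
  [/\ forall i, (i <= n)%N -> prime_set (c i) /\ J `<=` c i,
      forall i, (i < n)%N -> c i `<` c i.+1 & c n = P].

(* n is the height of P/J in A/J. *)
Definition height_mod J P (n : nat) : Prop :=
  (exists c, prime_chain_mod J P n c) /\
  (forall m c, prime_chain_mod J P m c -> (m <= n)%N).

(* A/J is a Cohen-Macaulay ring: depth and height agree at every maximal
   ideal. *)
Definition cohen_macaulay_mod J : Prop :=
  forall P, maximal_set P -> J `<=` P ->
    exists n, depth_mod J P n /\ height_mod J P n.

End CohenMacaulay.

Section Geometry.
Variable K : fieldType.

Local Notation S := {mpoly K[7]}.

(* A point of P^6 is given by a nonzero vector of homogeneous coordinates;
   subsets of P^6 are sets of such vectors. *)
Local Notation coords := {ffun 'I_7 -> K}.

Definition proj_zeros (E : set S) : set coords :=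
  [set v : coords | v != 0 /\ forall f, E f -> f.@[v] = 0].

Definition proj_closed (Z : set coords) : Prop :=
  exists E : set S,
    (forall f, E f -> exists d : nat, f \is d.-homog) /\ Z = proj_zeros E.

Definition zariski_closure (T : set coords) : set coords :=
  [set v : coords | forall Z, proj_closed Z -> T `<=` Z -> Z v].

Definition proj_irreducible (Z : set coords) : Prop :=
  (exists v, Z v) /\
  forall Z1 Z2, proj_closed Z1 -> proj_closed Z2 ->
    Z `<=` Z1 `|` Z2 -> Z `<=` Z1 \/ Z `<=` Z2.

Definition proj_variety (Z : set coords) : Prop :=
  proj_closed Z /\ proj_irreducible Z.

Definition variety_chain (Z : set coords) (n : nat)
    (c : nat -> set coords) : Prop :=
  [/\ c 0%N = Z, forall i, (i <= n)%N -> proj_variety (c i) &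
      forall i, (i < n)%N -> c i `<` c i.+1].

(* n is the codimension in P^6 of the irreducible closed set Z. *)
Definition proj_codim (Z : set coords) (n : nat) : Prop :=
  (exists c, variety_chain Z n c) /\
  (forall m c, variety_chain Z m c -> (m <= n)%N).

(* f belongs to the homogeneous ideal of Z iff all its homogeneous components
   vanish on Z. *)
Definition proj_ideal (Z : set coords) : set S :=
  [set f | forall (d : nat) v, Z v -> (pihomog mdeg d f).@[v] = 0].

Definition arith_cohen_macaulay (Z : set coords) : Prop :=
  cohen_macaulay_mod (proj_ideal Z).

(* P^1 = K u {oo}, with oo = None. *)
Definition mobius (M : 'M[K]_2) (z : option K) : option K :=
  match z with
  | Some z =>
      let d := M ord_max ord0 * z + M ord_max ord_max in
      if d == 0 then None else Some ((M ord0 ord0 * z + M ord0 ord_max) / d)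
  | None =>
      if M ord_max ord0 == 0 then None
      else Some (M ord0 ord0 / M ord_max ord0)
  end.

(* (p - 1) / p *)
Definition orbit_pt1 (p : option K) : option K :=
  match p with
  | Some x => if x == 0 then None else Some ((x - 1) / x)
  | None => Some 1
  end.

(* 1 / (1 - p) *)
Definition orbit_pt2 (p : option K) : option K :=
  match p with
  | Some x => if x == 1 then None else Some (1 / (1 - x))
  | None => Some 0
  end.

Definition tri_involutive (Z : {fset option K}) : Prop :=
  #|` Z|%fset = 6%N /\
  exists2 M : 'M[K]_2, M \in unitmx &
  exists p : option K,
    Z = [fset mobius M z |
          z in [fset Some 0%R; Some 1%R; None;
                     p; orbit_pt1 p; orbit_pt2 p]]%fset.

Definition linear_factor (z : option K) : {mpoly K[2]} :=
  if z is Some z then 'X_ord0 - z *: 'X_ord_max else 'X_ord_max.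

Definition sextic_of (Z : {fset option K}) : {mpoly K[2]} :=
  \prod_(z <- Z) linear_factor z.

(* The exponent of x_1^(6-i) x_2^i. *)
Definition mon6 (i : 'I_7) : 'X_{1..2} :=
  (U_(ord0) *+ (6 - i) + U_(ord_max) *+ i)%MM.

(* The a_i with F = \sum_i a_i 'C(6, i) x_1^(6-i) x_2^i. *)
Definition sextic_coords (F : {mpoly K[2]}) : coords :=
  [ffun i => F@_(mon6 i) / 'C(6, i)%:R].

Definition tri_involutive_locus : set coords :=
  [set v : coords | exists Z, tri_involutive Z /\
     exists2 c : K, c != 0 & v = [ffun i => c * sextic_coords (sextic_of Z) i]].

Definition Omega : set coords := zariski_closure tri_involutive_locus.

End Geometry.

Arguments Omega : clear implicits.

Section Resolution.
Variable K : fieldType.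

Local Notation S := {mpoly K[7]}.

(* F(x) |-> F(x g), where x = (x_1, x_2) is a row vector. *)
Definition subst_form (g : 'M[K]_2) (F : {mpoly S[2]}) : {mpoly S[2]} :=
  F \mPo [tuple \sum_(j < 2) (g j i)%:MP *: 'X_j | i < 2].

Definition generic_sextic : {mpoly S[2]} :=
  \sum_(i < 7) ('X_i *+ 'C(6, i)) *: 'X_[mon6 i].

(* The action of SL_2 on the coordinate ring, (g . f)(F) = f (g^-1 . F):
   a_i is sent to the i-th coefficient of g^-1 . generic_sextic, so that
   generic_sextic is invariant under the diagonal action. *)
Definition act_ring (g : 'M[K]_2) (f : S) : S :=
  f \mPo [tuple ('C(6, i)%:R^-1 : K) *:
            (subst_form (invmx g) generic_sextic)@_(mon6 i) | i < 7].

(* The diagonal action on S (x) K[x_1, x_2] = S[x_1, x_2]. *)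
Definition act_form (g : 'M[K]_2) (F : {mpoly S[2]}) : {mpoly S[2]} :=
  subst_form g (map_mpoly (act_ring g) F).

Lemma act_form_homog d g (F : {mpoly S[2]}) :
  F \is d.-homog -> act_form g F \is d.-homog.
Proof.
have substX m : mdeg m = d -> subst_form g 'X_[m] \is d.-homog.
  move=> <-; rewrite /subst_form comp_mpolyX big_ord_recr big_ord1 /=.
  rewrite mdegE big_ord_recr big_ord1 /=.
  have lin i : \sum_(j < 2) (g j i)%:MP *: ('X_j : {mpoly S[2]}) \is 1.-homog.
    by apply: rpred_sum => j _; apply: rpredZ; rewrite dhomogX /= mdeg1.
  by rewrite !tnth_mktuple; apply: dhomogM;
    rewrite -[X in X.-homog]mul1n; apply: dhomogMn.
move=> /dhomogP homF; rewrite /act_form /subst_form [map_mpoly _ _]/mmap.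
rewrite raddf_sum big_seq; apply: rpred_sum => m /homF /= degm.
rewrite mul_mpolyC mmap1_id comp_mpolyZ.
by apply: rpredZ; apply: substX.
Qed.

(* The degree n piece of S(-s). *)
Definition twisted_piece (s n : nat) : set S :=
  [set f | if (s <= n)%N then f \is (n - s).-homog else f == 0].

(* A graded S-module with an action of SL_2; gm_act is only meant to be
   applied to matrices of determinant 1. *)
Record gmod := GMod {
  gm_sort :> lmodType S;
  gm_piece : nat -> set gm_sort;
  gm_act : 'M[K]_2 -> gm_sort -> gm_sort }.

(* S(-s) *)
Definition twist (s : nat) : gmod :=
  @GMod S^o (twisted_piece s) act_ring.

Definition act_dhomog (d : nat) (g : 'M[K]_2) (F : dhomog 2 S d) :
    dhomog 2 S d :=
  DHomog (act_form_homog g (dhomog_is_dhomog F)).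

(* S(-s) (x) S_d, as the binary forms of degree d with coefficients in S. *)
Definition twist_forms (s d : nat) : gmod :=
  @GMod (dhomog 2 S d)
    (fun n => [set F | forall m, twisted_piece s n (F : {mpoly S[2]})@_m])
    (@act_dhomog d).

Definition gm_sum (M N : gmod) : gmod :=
  @GMod (M * N)%type
    (fun n => [set x | gm_piece n x.1 /\ gm_piece n x.2])
    (fun g x => (gm_act g x.1, gm_act g x.2)).

(* Homogeneous of degree 0 and SL_2-equivariant. *)
Definition equivariant_map (M N : gmod) (phi : M -> N) : Prop :=
  (forall n x, gm_piece n x -> gm_piece n (phi x)) /\
  (forall (g : 'M[K]_2) x, \det g = 1 -> phi (gm_act g x) = gm_act g (phi x)).

(* m M, for m = (a_0, ..., a_6). *)
Definition irrelevant_mul (M : gmod) : set M :=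
  [set x | exists k, exists (f : 'I_k -> S) (y : 'I_k -> M),
     (forall i, (f i)@_0%MM = 0) /\ x = \sum_(i < k) f i *: y i].

(* M has a finite basis of homogeneous elements. *)
Definition graded_free (M : gmod) : Prop :=
  exists k, exists b : 'I_k -> M,
    (forall i, exists n, gm_piece n (b i)) /\
    forall x : M, exists! c : {ffun 'I_k -> S}, x = \sum_(i < k) c i *: b i.

(* 0 <- S/J <- S <- F1 <- F2 <- 0 is an SL_2-equivariant minimal free
   resolution for suitable maps phi1 : F1 -> S and phi2 : F2 -> F1. *)
Definition equivariant_minimal_free_resolution
    (J : set S) (F1 F2 : gmod) : Prop :=
  [/\ graded_free F1, graded_free F2 &
  exists (phi1 : {linear F1 -> twist 0}) (phi2 : {linear F2 -> F1}),
    [/\ equivariant_map phi1 /\ equivariant_map phi2,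
        range phi1 = J,
        [set x | phi1 x = 0] = range phi2,
        injective phi2 &
        range phi1 `<=` @irrelevant_mul (twist 0) /\
        range phi2 `<=` @irrelevant_mul F1]].

End Resolution.

(* Main.v *)
From HB Require Import structures.
Require Import Defs.
From mathcomp Require Import all_boot all_order all_algebra finmap.
From mathcomp Require Import complex classical_sets reals boolp.
From mathcomp Require Import mpoly ring lra zify.

Set Implicit Arguments.
Unset Strict Implicit.
Unset Printing Implicit Defensive.

Import Order.TTheory GRing.Theory Num.Theory.

(** The resolution is a Hilbert-Burch complex.  For a sextic [F], the quartics
[(F, q)_2], with [q] a quadric, and [(F, F)_4] are the columns of a [5 * 4] matrix
([syz_mx]) with entries of degrees [1, 1, 1, 2] in the coefficients of [F].  Its
construction by transvectants makes it equivariant ([syz_mx_action]), and its maximal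
minors are five quintics, which transform like the coordinates on the space of
quartics because [SL_2] acts unimodularly on quadrics and quartics
([bordered_det_action]).

Geometrically, six points are tri-involutive when [F] is, for suitable linear forms
[u] and [v], a general combination of [u ^ 6], [u ^ 3 v ^ 3] and [v ^ 6]: the six
points form two orbits of a transformation of order three with fixed points [u = 0] and [v = 0]
([locusP], [generic_sext]).  For such an [F] both [(F, u v)_2] and [(F, F)_4] are
multiples of [(u v) ^ 2], hence the minors vanish ([minors_vanish]).

Three facts come from one computation: on the sextics with
[a_2 = a_3 = a_4 = a_5 - a_0 = a_6 - a_1 = 0] the ideal of minors contains [a_0 ^ 6]
and [a_1 ^ 6] ([lead0_monic], [lead1_monic]).  The minors then contain a regular
sequence of length two, and the complex is exact ([syz_mx_exact]); the quotient by the
minors is finite over the ring of the five parameters [a_2], [a_3], [a_4],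
[a_5 - a_0], [a_6 - a_1]; and these parameters, shifted by arbitrary constants, form a
regular sequence on it ([fibre_seq_regular]), while nonzero polynomials in them are
nonzerodivisors ([minors_torsion_free]).

The ideal of minors [I] is the full vanishing ideal ([vanishing_minors]).  Modulo [I],
and where one minor [hankel3] of the first three columns is invertible, [(F, F)_4] is
[(F, h)_2] for a quadric [h] given by Cramer's rule.  The identity
[((F, F)_4, F)_3 = 0] says that the Jacobian of this quartic and [h] vanishes, so the
quartic is a multiple of [h ^ 2], and the equation [(F, h)_2 = l h ^ 2] can be solved
for the coefficients of [F] ([param_of_minors]); the solutions are tri-involutive
([sextic_param_sext]).  Thus a form [f] that vanishes on the locus satisfies
[D ^ n f \in I] for an explicit [D] ([vanishing_power]).  As [D] is invertible modulo [I] on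
one fibre over the space of parameters, Nakayama's lemma turns [D ^ n] into a nonzero
polynomial in the parameters, which is a nonzerodivisor; hence [f \in I].

For the dimension, chains of primes in a polynomial ring in seven variables have
length at most [7] ([prime_chain_dim]).  Regular sequences of length [5] give chains of
length [5] above [I] ([regular_seq_chain]), at every maximal ideal by the
Nullstellensatz; below [I] lie the ideal of the join of [Omega] with a point, a
hypersurface, and the zero ideal.  So depth and height are both [5] and the
codimension is [2]. *)

(** * Prime ideals and regular sequences *)

Section Primes.
Local Open Scope ring_scope.
Local Open Scope classical_set_scope.
Variable A : comNzRingType.
Implicit Types (I J P T : set A) (s : seq A).

Lemma ideal_sub I x y : ideal_set I -> I x -> I y -> I (x - y).
Proof. by case=> _ hD hM hx hy; apply: hD => //; rewrite -mulN1r; apply: hM. Qed.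

Lemma ideal_sum I n (f : 'I_n -> A) :
  ideal_set I -> (forall i, I (f i)) -> I (\sum_i f i).
Proof. by case=> h0 hD _ hf; elim/big_ind: _ => // x y; apply: hD. Qed.

Lemma ideal_mulr I x a : ideal_set I -> I x -> I (x * a).
Proof. by case=> _ _ hM hx; rewrite mulrC; apply: hM. Qed.

Lemma zero_ideal : ideal_set [set (0 : A)].
Proof. by split=> [//|x y -> ->|a x ->]; rewrite /= ?addr0 ?mulr0. Qed.

Lemma prime_exp P x n : prime_set P -> P (x ^+ n) -> P x.
Proof.
case=> _ h1 hp; elim: n => [|n IH]; first by rewrite expr0 => /h1.
by rewrite exprS => /hp[].
Qed.

(** Krull: an ideal that is maximal among those containing [I] and disjoint from
the multiplicative set [T] is prime. *)
Lemma prime_avoiding I T : ideal_set I -> T 1 ->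
    (forall x y, T x -> T y -> T (x * y)) -> (forall x, I x -> ~ T x) ->
  exists P, [/\ prime_set P, I `<=` P & forall x, P x -> ~ T x].
Proof.
move=> hI T1 TM IT.
(* The union with [I] makes the empty chain harmless. *)
have [|X [[hX XT] Xmax]] :=
  @Zorn_bigcup A [set X | ideal_set (X `|` I) /\ forall x, X x -> ~ T x].
  move=> F FP Ftot; split; last by move=> x [X FX Xx]; apply: (FP _ FX).2.
  have sub X : F X -> X `|` I `<=` (\bigcup_(X in F) X) `|` I.
    by move=> FX x [Xx|Ix]; [left; exists X|right].
  case: (hI) => I0 ID IM; split; first by right.
  - have key X x y : F X -> X x -> (X `|` I) y ->
        ((\bigcup_(X in F) X) `|` I) (x + y).
      move=> FX Xx XIy; apply: (sub _ FX); have [[_ hD _] _] := FP _ FX.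
      by apply: hD => //; left.
    move=> x y [[X FX Xx]|Ix] [[Y FY Yy]|Iy].
    + have [XY|YX] := Ftot _ _ FX FY.
        by apply: (key Y) => //; [apply: XY|left].
      by apply: (key X) => //; left; apply: YX.
    + by apply: (key X) => //; right.
    + by rewrite addrC; apply: (key Y) => //; right.
    + by right; apply: ID.
  - move=> a x [[X FX Xx]|Ix]; last by right; apply: IM.
    by apply: (sub _ FX); have [[_ _ hM] _] := FP _ FX; apply: hM; left.
pose P := X `|` I; have PT x : P x -> ~ T x by case=> [/XT|/IT].
have meet x : ~ P x -> exists p a, P p /\ T (p + a * x).
  move=> nPx; apply: contrapT => nT.
  pose Y := [set y | exists p a, P p /\ y = p + a * x].
  have XY : X `<` Y.
    split=> [y Xy|YX].
      by exists y, 0; rewrite mul0r addr0; split=> //; left.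
    apply: nPx; left; apply: YX; exists 0, 1; rewrite mul1r add0r; split=> //.
    by case: hX.
  apply: (Xmax _ XY); split; last first.
    by move=> y [p [a [Pp ->]]] Ty; apply: nT; exists p, a.
  have -> : Y `|` I = Y.
    apply/seteqP; split=> [y []//Iy|y Yy]; last by left.
    by exists y, 0; rewrite mul0r addr0; split=> //; right.
  case: (hX) => h0 hD hM; split.
  - by exists 0, 0; rewrite mul0r addr0.
  - move=> _ _ [p [a [Pp ->]]] [q [b [Pq ->]]].
    by exists (p + q), (a + b); split; [apply: hD|rewrite mulrDl addrACA].
  - move=> c _ [p [a [Pp ->]]]; exists (c * p), (c * a).
    by split; [apply: hM|rewrite mulrDr mulrA].
exists P; split=> //; last by move=> x Ix; right.
split=> //; first by move/PT.
move=> x y Pxy; apply: contrapT => /not_orP[nx ny].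
have [p [a [Pp Tp]]] := meet _ nx; have [q [b [Pq Tq]]] := meet _ ny.
apply: (PT _ _ (TM _ _ Tp Tq)); case: (hX) => h0 hD hM.
rewrite mulrDl; apply: (hD); first by rewrite mulrC; apply: hM.
rewrite mulrDr; apply: (hD); first by apply: hM.
by rewrite mulrACA; apply: hM.
Qed.

Lemma maximal_is_prime P : maximal_set P -> prime_set P.
Proof.
case=> hP P1 Pmax.
have [||Q [hQ PQ Q1]] := @prime_avoiding P [set 1] hP erefl.
- by move=> x y -> ->; rewrite mulr1.
- by move=> x Px xE; apply: P1; rewrite -xE.
suff <- : Q = P by [].
by apply: Pmax => //; [case: hQ|move/Q1; apply].
Qed.

Lemma ideal_add_ideal J s : ideal_set J -> ideal_set (ideal_add J s).
Proof.
case=> h0 hD hM; split.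
- exists 0; split=> //; exists (fun=> 0); rewrite big1 ?addr0// => i _.
  by rewrite mul0r.
- move=> _ _ [j [Jj [c ->]]] [k [Jk [d ->]]]; exists (j + k); split.
    exact: hD.
  exists (fun i => c i + d i); rewrite addrACA -big_split /=; congr (_ + _).
  by apply: eq_bigr => i _; rewrite mulrDl.
- move=> a _ [j [Jj [c ->]]]; exists (a * j); split; first exact: hM.
  exists (fun i => a * c i); rewrite mulrDr mulr_sumr; congr (_ + _).
  by apply: eq_bigr => i _; rewrite mulrA.
Qed.

Lemma ideal_add_sub J s P : ideal_set P -> J `<=` P -> {in s, forall x, P x} ->
  ideal_add J s `<=` P.
Proof.
move=> hP JP sP _ [j [/JP Pj [c ->]]]; case: (hP) => _ hD hM; apply: hD => //.
by apply: ideal_sum => // i; apply: hM; apply: sP; apply: mem_nth.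
Qed.

Lemma ideal_add_base J s : ideal_set J -> J `<=` ideal_add J s.
Proof.
move=> hJ x Jx; exists x; split=> //; exists (fun=> 0).
by rewrite big1 ?addr0// => i _; rewrite mul0r.
Qed.

Lemma ideal_add_mem J s : ideal_set J -> {in s, forall x, ideal_add J s x}.
Proof.
move=> hJ x xs; exists 0; split; first by case: hJ.
have lt := xs; rewrite -index_mem in lt.
exists (fun i : 'I_(size s) => (i == Ordinal lt)%:R).
rewrite add0r (bigD1 (Ordinal lt))//= eqxx mul1r nth_index// big1 ?addr0//.
by move=> i /negPf ->; rewrite mul0r.
Qed.

(** Localising at [P] and then inverting the nonzerodivisor [x] leaves a nonzero
ring modulo [I]. *)
Lemma prime_below I P x : ideal_set I -> prime_set P -> I `<=` P ->
    (forall y, I (x * y) -> I y) ->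
  exists Q, [/\ prime_set Q, I `<=` Q, Q `<=` P & ~ Q x].
Proof.
move=> hI [hP P1 Pp] IP nzd.
have nzdX n y : I (x ^+ n * y) -> I y.
  by elim: n => [|n IH]; rewrite ?expr0 ?mul1r// exprS -mulrA => /nzd/IH.
pose T := [set y | exists n u, ~ P u /\ y = x ^+ n * u].
have [|||Q [hQ IQ QT]] := @prime_avoiding I T hI.
- by exists 0%N, 1; rewrite mulr1.
- move=> _ _ [n [u [nu ->]]] [m [v [nv ->]]]; exists (n + m)%N, (u * v).
  by rewrite exprD mulrACA; split=> // /Pp[].
- by move=> y Iy [n [u [nu yE]]]; apply: nu; apply: IP; apply: (nzdX n); rewrite -yE.
exists Q; split=> //.
  move=> y Qy; apply: contrapT => nPy; apply: (QT _ Qy).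
  by exists 0%N, y; rewrite mul1r.
by move=> Qx; apply: (QT _ Qx); exists 1%N, 1; rewrite mulr1.
Qed.

(** Depth is at most height: the last element of the sequence is avoided by a
prime below [P] that still contains the other ones, and this repeats. *)
Lemma regular_seq_chain J P s : ideal_set J -> prime_set P -> J `<=` P ->
    {in s, forall x, P x} ->
    (forall i, (i < size s)%N -> forall x,
      ideal_add J (take i s) (s`_i * x) -> ideal_add J (take i s) x) ->
  exists c, prime_chain_mod J P (size s) c.
Proof.
move=> hJ; elim/last_ind: s P => [|s x IH] P hP JP sP reg.
  by exists (fun=> P).
have sxP : ideal_add J s `<=` P.
  apply: ideal_add_sub => //; first by case: hP.
  by move=> y ys; apply: sP; rewrite mem_rcons inE ys orbT.
have nzd y : ideal_add J s (x * y) -> ideal_add J s y.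
  have := reg (size s); rewrite size_rcons nth_rcons ltnn eqxx => /(_ (ltnSn _)).
  by rewrite -cats1 take_size_cat//; apply.
have [Q [hQ sQ QP nQx]] := prime_below (ideal_add_ideal s hJ) hP sxP nzd.
have JQ : J `<=` Q by apply: subset_trans sQ; apply: ideal_add_base.
have [||c [c1 c2 c3]] := IH Q hQ JQ.
- by move=> y ys; apply: sQ; apply: ideal_add_mem.
- move=> i lt y; have := reg i; rewrite size_rcons => /(_ (ltnW lt)) /(_ y).
  by rewrite nth_rcons lt -cats1 takel_cat 1?ltnW.
exists (fun i => if (i <= size s)%N then c i else P); rewrite size_rcons; split.
- by move=> i _; case: ifP => [/c1//|_]; split.
- move=> i; rewrite ltnS => le; move: (le); rewrite {1}leq_eqVlt => /predU1P[->|lt].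
    rewrite /= leqnn ltnn c3; split=> // PQ; apply/nQx/PQ/sP.
    by rewrite mem_rcons mem_head.
  by rewrite /= (ltnW lt) lt; apply: c2.
- by rewrite ltnn.
Qed.

End Primes.

(** * The dimension of a polynomial ring *)

Section Degree.
Local Open Scope ring_scope.
Variable R : comNzRingType.

Lemma msize_leP n (p : {mpoly R[n]}) k :
  reflect (forall m, p@_m != 0 -> (mdeg m < k)%N) (msize p <= k)%N.
Proof.
apply: (iffP idP) => [le m|h]; first by rewrite -mcoeff_msupp => /msize_mdeg_lt/leq_trans; apply.
rewrite mmeasureE big_seq_cond; elim/big_ind: _ => // [a b|m].
  by rewrite geq_max => -> ->.
by rewrite andbT mcoeff_msupp => /h.
Qed.

Lemma msizeM_leR n (p p' : {mpoly R[n]}) a b :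
  (msize p <= a.+1)%N -> (msize p' <= b.+1)%N ->
  (msize (p * p')%R <= (a + b).+1)%N.
Proof.
move=> pa pb; apply/msize_leP => m; rewrite -mcoeff_msupp => /msuppM_le.
case/allpairsP=> -[m1 m2] /= [m1p m2p ->]; rewrite mdegD.
have := leq_trans (msize_mdeg_lt m1p) pa; have := leq_trans (msize_mdeg_lt m2p) pb.
lia.
Qed.

End Degree.

Section Dimension.
Local Open Scope ring_scope.
Local Open Scope classical_set_scope.
Variable K : fieldType.

Lemma mpoly_lin_dep n m (s : seq 'X_{1..n}) (f : 'I_m -> {mpoly K[n]}) :
    (forall j, {subset msupp (f j) <= s}) -> (size s < m)%N ->
  exists2 c : 'I_m -> K, exists j, c j != 0 & \sum_j c j *: f j = 0.
Proof.
move=> fs lt; pose M := \matrix_(j < m, k < size s) (f j)@_(nth 0%MM s k).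
have : kermx M != 0.
  rewrite kermx_eq0 /row_free neq_ltn (leq_ltn_trans _ lt)//.
  exact: rank_leq_col.
case/rowV0Pn=> v /sub_kermxP vM0 v0.
exists (v 0); first by apply/existsP; apply: contra_neqT v0 => /existsPn v0;
  apply/rowP=> j; rewrite mxE; apply/eqP; rewrite -[_ == _]negbK; apply: v0.
apply/mpolyP=> x; rewrite raddf_sum mcoeff0 /=.
case: (boolP (x \in s)) => [xs|xs].
  have lt' := xs; rewrite -index_mem in lt'.
  have := congr1 (fun A : 'rV_ _ => A 0 (Ordinal lt')) vM0; rewrite !mxE => vM.
  by rewrite -[RHS]vM; apply: eq_bigr => j _; rewrite mcoeffZ mxE /= nth_index.
apply: big1 => j _; rewrite mcoeffZ memN_msupp_eq0 ?mulr0//.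
by apply: contra xs; apply: fs.
Qed.

Lemma msize_prod n (I : Type) (r : seq I) (P : pred I)
    (F : I -> {mpoly K[n]}) (d : I -> nat) :
    (forall i, msize (F i) <= (d i).+1)%N ->
  (msize (\prod_(i <- r | P i) F i) <= (\sum_(i <- r | P i) d i).+1)%N.
Proof.
move=> Fd; elim/big_rec2: _ => [|i x y _ IH]; first by rewrite msize1.
exact: msizeM_leR.
Qed.

Lemma msize_exp n (p : {mpoly K[n]}) d k :
  (msize p <= d.+1)%N -> (msize (p ^+ k) <= (d * k).+1)%N.
Proof.
move=> pd; elim: k => [|k IH]; first by rewrite expr0 msize1.
by rewrite exprS mulnS; apply: msizeM_leR.
Qed.

(** Counting: the monomials of bounded exponents in [n.+1] given polynomials
outnumber the monomials in [n] variables that can occur in them. *)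
Lemma alg_dep n (y : 'I_n.+1 -> {mpoly K[n]}) :
  exists2 Q : {mpoly K[n.+1]}, Q != 0 & Q \mPo [tuple y i | i < n.+1] = 0.
Proof.
(* The exponents below [N] give [N ^ n.+1] products of the [y i]; their monomials
have exponents below [N * C], and [N] exceeds [C ^ n]. *)
pose D := (\max_i msize (y i))%N; pose C := (n.+1 * D).+1; pose N := (C ^ n).+1.
pose E := {ffun 'I_n.+1 -> 'I_N}.
pose mon (e : E) : 'X_{1..n.+1} := [multinom (e i : nat) | i < n.+1].
pose f (j : 'I_#|E|) : {mpoly K[n]} :=
  'X_[mon (enum_val j)] \mPo [tuple y i | i < n.+1].
pose L := (N * C)%N.
pose s := [seq [multinom (e i : nat) | i < n] | e : {ffun 'I_n -> 'I_L}].
have fs j : {subset msupp (f j) <= s}.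
  move=> m mf.
  have mL (i : 'I_n) : (m i < L)%N.
    have : (m i < msize (f j))%N.
      apply: leq_trans (msize_mdeg_lt mf); rewrite ltnS mdegE (bigD1 i)//=.
      exact: leq_addr.
    move/leq_trans; apply.
    rewrite /f comp_mpolyX.
    apply: leq_trans (@msize_prod _ _ _ _ _ (fun=> D * N)%N _) _.
      move=> i'; rewrite tnth_mktuple.
      apply: leq_trans (msize_exp (d := D) _ _) _.
        by rewrite leqW// /D; apply: (leq_bigmax i').
      by rewrite ltnS leq_mul// mnmE ltnW.
    rewrite sum_nat_const card_ord /L /C mulnS; rewrite [(N * _)%N]mulnC mulnA.
    by rewrite -addn1 addnC leq_add.
  apply/mapP; exists [ffun i => Ordinal (mL i)]; rewrite ?mem_enum//.
  by apply/mnmP=> i; rewrite mnmE ffunE.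
have sz : (size s < #|E|)%N.
  rewrite size_map -cardE !card_ffun !card_ord /L expnMn expnS mulnC.
  by rewrite ltn_pmul2r ?expn_gt0.
have [c [j cj] c0] := mpoly_lin_dep fs sz.
have mon_inj : injective mon.
  move=> e e' /mnmP ee; apply/ffunP=> i; apply: val_inj.
  by have := ee i; rewrite !mnmE.
exists (\sum_j c j *: 'X_[mon (enum_val j)]).
  apply: contra_neq cj => /mpolyP /(_ (mon (enum_val j))).
  rewrite raddf_sum /= mcoeff0 (bigD1 j)//= mcoeffZ mcoeffX eqxx mulr1.
  rewrite big1 ?addr0// => i ij; rewrite mcoeffZ mcoeffX.
  case: (mon _ =P _) => [/mon_inj/enum_val_inj/eqP|_]; last by rewrite mulr0.
  by rewrite (negPf ij).
by rewrite raddf_sum /= -[RHS]c0; apply: eq_bigr => i _; rewrite comp_mpolyZ.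
Qed.

(** Chains of primes in a polynomial ring are no longer than the number of
variables.  Choose an element of each prime of the chain outside the previous
one; an algebraic relation between these elements, sorted by its
lexicographically smallest exponent, can be divided by one of them at each step
of the chain and ends as a nonzero constant in the last prime. *)
Lemma prime_chain_dim n m (P : nat -> set {mpoly K[n]}) :
    (forall i, (i <= m)%N -> prime_set (P i)) ->
    (forall i, (i < m)%N -> P i `<` P i.+1) -> (m <= n)%N.
Proof.
move=> Pp Plt; rewrite leqNgt; apply/negP => nm.
have /choice[y yP] (i : 'I_n.+1) : exists y, P i.+1 y /\ ~ P i y.
  have [_ /existsNP[y /not_implyP[y1 y2]]] := Plt i (leq_trans (ltn_ord i) nm).
  by exists y.
have [Q Q0 Qy] := alg_dep y.
pose T k (S : seq 'X_{1..n.+1}) : {mpoly K[n]} :=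
  \sum_(m <- S) Q@_m *: \prod_(i < n.+1 | (k <= i)%N) y i ^+ m i.
have key k : (k <= n.+1)%N -> exists e : 'X_{1..n.+1}, exists S : seq 'X_{1..n.+1},
    [/\ e \in S, uniq S, {subset S <= msupp Q},
        forall m', m' \in S -> forall i : 'I_n.+1, (i < k)%N -> m' i = e i &
        P k (T k S)].
  elim: k => [_|k IH kn].
    exists (mlead Q), (msupp Q); split=> //; first exact: mlead_supp.
    rewrite (_ : T _ _ = 0); first by case: (Pp 0%N isT) => -[].
    by rewrite -[RHS]Qy comp_mpolyEX; apply: eq_bigr => x _;
      congr (_ *: _); rewrite comp_mpolyX; apply: eq_bigr => i _;
      rewrite tnth_mktuple.
  have {IH}[e [S [eS uS SQ Se PT]]] := IH (ltnW kn).
  pose j : 'I_n.+1 := Ordinal kn.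
  have exa : exists a, has (fun m' : 'X_{1..n.+1} => m' j == a) S.
    by exists (e j); apply/hasP; exists e.
  have [a /hasP[e' e'S /eqP e'a] amin] := ex_minnP exa.
  have le m' : m' \in S -> (a <= m' j)%N.
    by move=> mS; apply: amin; apply/hasP; exists m'.
  exists e', [seq m' : 'X_{1..n.+1} <- S | m' j == a]; split.
  - by rewrite mem_filter e'a eqxx.
  - exact: filter_uniq.
  - by move=> x; rewrite mem_filter => /andP[_ /SQ].
  - move=> m'; rewrite mem_filter => /andP[/eqP m'a m'S] i.
    rewrite ltnS leq_eqVlt => /predU1P[ij|ik].
      by rewrite (_ : i = j) ?m'a ?e'a//; apply: val_inj.
    by rewrite (Se _ m'S)// (Se _ e'S).
  have kin : (k <= m)%N by apply: leq_trans nm; apply: ltnW.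
  have [_ _ pk] := Pp k kin; have [hI1 _ _] := Pp k.+1 (leq_trans kn nm).
  have sub x : P k x -> P k.+1 x by apply: (Plt k (leq_trans kn nm)).1.
  have [yj nyj] := yP j.
  have TE : T k S = y j ^+ a * (T k.+1 [seq m' : 'X_{1..n.+1} <- S | m' j == a] + y j *
      \sum_(m' <- S | m' j != a) Q@_m' *: (y j ^+ (m' j - a).-1 *
        \prod_(i < n.+1 | (k < i)%N) y i ^+ m' i)).
    rewrite /T (bigID (fun m' : 'X_{1..n.+1} => m' j == a)) /= mulrDr.
    have split (m' : 'X_{1..n.+1}) : \prod_(i < n.+1 | (k <= i)%N) y i ^+ m' i =
        y j ^+ m' j * \prod_(i < n.+1 | (k < i)%N) y i ^+ m' i.
      rewrite (bigD1 j)//=; congr (_ * _); apply: eq_bigl => i.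
      by rewrite ltn_neqAle andbC eq_sym.
    congr (_ + _).
      rewrite big_filter mulr_sumr; apply: eq_bigr => x /eqP xa.
      by rewrite split xa scalerAr.
    rewrite mulrA mulr_sumr [LHS]big_seq_cond [RHS]big_seq_cond.
    apply: eq_bigr => x /andP[xS xa]; rewrite split -scalerAr mulrA.
    rewrite -exprSr -exprD; congr (_ *: (_ ^+ _ * _)).
    by have := le _ xS; move: xa; lia.
  have PX : ~ P k (y j ^+ a) by move/prime_exp => /(_ (Pp k kin)).
  have := PT; rewrite TE => /pk[//|/sub H].
  rewrite -[T _ _](addrK (y j * \sum_(m' <- S | m' j != a) Q@_m' *:
    (y j ^+ (m' j - a).-1 * \prod_(i < n.+1 | (k < i)%N) y i ^+ m' i))).
  by apply: ideal_sub => //; apply: ideal_mulr.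
have [e [S [eS uS SQ Se PT]]] := key _ (leqnn _).
have SE : perm_eq S [:: e].
  apply: uniq_perm => // x; rewrite inE; apply/idP/eqP => [xS|->//].
  by apply/mnmP => i; apply: Se.
move: PT; rewrite /T (perm_big _ SE) /= big_seq1 big1 => [|i]; last first.
  by rewrite leqNgt ltn_ord.
have [[_ _ hM] P1 _] := Pp n.+1 nm.
have e0 : Q@_e != 0 by rewrite -mcoeff_msupp SQ.
move=> /(hM (Q@_e)^-1%:MP); rewrite mul_mpolyC scalerA mulVf// scale1r.
exact: P1.
Qed.

End Dimension.

(** * The Nullstellensatz over an uncountable field *)

Section Nullstellensatz.
Local Open Scope ring_scope.
Local Open Scope classical_set_scope.

(** Cantor: each term is avoided by one of the outer thirds of the interval
found so far. *)
Lemma real_uncountable (R : realType) (u : nat -> R) :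
  exists x, forall n, u n <> x.
Proof.
pose step (I : R * R) (a : R) : R * R :=
  let d := (I.2 - I.1) / 3 in
  if a < I.1 + 2 * d then (I.1 + 2 * d, I.2) else (I.1, I.1 + d).
pose I := fix I n := if n is n'.+1 then step (I n') (u n') else (0 : R, 1 : R).
have I12 n : (I n).1 < (I n).2.
  elim: n => [|n IH] /=; first exact: ltr01.
  by rewrite /step; case: ifP => _ /=; lra.
have sub n : (I n).1 <= (I n.+1).1 /\ (I n.+1).2 <= (I n).2.
  have := I12 n; rewrite /= /step; case: ifP => _ /= h; split; lra.
have mono n k : (I n).1 <= (I (n + k)%N).1 /\ (I (n + k)%N).2 <= (I n).2.
  elim: k => [|k [h1 h2]]; first by rewrite addn0.
  rewrite addnS; have [h3 h4] := sub (n + k)%N.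
  by split; [apply: le_trans h3|apply: le_trans h2].
have cross n m : (I n).1 < (I m).2.
  have [h1 _] := mono n m; have [_ h2] := mono m n; rewrite addnC in h2.
  by apply: le_lt_trans h1 (lt_le_trans (I12 _) h2).
pose E := [set (I n).1 | n in [set: nat]].
have supE : has_sup E.
  split; first by exists (I 0%N).1, 0%N.
  by exists (I 0%N).2 => _ [n _ <-]; apply/ltW/cross.
have xl n : (I n).1 <= sup E.
  by apply: sup_upper_bound => //; exists n.
have xr n : sup E <= (I n).2.
  by apply: ge_sup; [case: supE|move=> _ [m _ <-]; apply/ltW/cross].
exists (sup E) => n uE.
have := xl n.+1; have := xr n.+1; have := I12 n.
by rewrite /= /step uE; case: ifP => /= h; lra.
Qed.

Lemma complex_uncountable (R : realType) (u : nat -> R[i]) :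
  exists x, forall n, u n <> x.
Proof.
have [x xP] := real_uncountable (fun n => complex.Re (u n)).
by exists (Complex x x) => n E; apply: (xP n); rewrite E.
Qed.

Variable K : closedFieldType.
Hypothesis K_uncountable : forall u : nat -> K, exists x, forall n, u n <> x.

(** Otherwise [K] would be a countable union of finite sets. *)
Lemma uncountable_fibre (D : K -> nat) :
  exists d, forall s : seq K, exists2 c, c \notin s & (D c <= d)%N.
Proof.
apply: contrapT => /forallNP H.
have /choice[s sP] d : exists s : seq K, forall c, (D c <= d)%N -> c \in s.
  have /existsNP[s sP] := H d; exists s => c Dc.
  by apply: contrapT => /negP cs; apply: sP; exists c.
pose u n := let (d, i) := odflt (0, 0)%N (@choice.unpickle (nat * nat)%type n) in nth 0 (s d) i.
have [x xP] := K_uncountable u.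
have xs := sP (D x) x (leqnn _).
apply: (xP (choice.pickle (D x, index x (s (D x))))).
by rewrite /u choice.pickleK /= nth_index.
Qed.

(** If no [X_i - c] lies in the maximal ideal, all of them are invertible modulo
it; uncountably many of the inverses have bounded degree, hence are linearly
dependent, which is an algebraic equation for [X_i]. *)
Lemma maximal_coord n (P : set {mpoly K[n]}) (i : 'I_n) :
  maximal_set P -> exists c, P ('X_i - c%:MP).
Proof.
move=> mP; have pP := maximal_is_prime mP.
have [hP P1 Pmax] := mP; have [_ _ Pp] := pP; have [P0 PD PM] := hP.
apply: contrapT => /forallNP nP.
have /choice[g gP] c : exists g, P (('X_i - c%:MP) * g - 1).
  apply: contrapT => nE; pose I := ideal_add P [:: 'X_i - c%:MP].
  have hI : ideal_set I by apply: ideal_add_ideal.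
  have IP : I = P.
    apply: Pmax => //; first exact: ideal_add_base.
    move=> [p [Pp' [a]]]; rewrite big_ord1 /= => E; apply: nE; exists (a 0).
    by rewrite E mulrC opprD addrCA subrr addr0 -mulN1r; apply: PM.
  by apply: (nP c); rewrite -IP; apply: ideal_add_mem => //; apply: mem_head.
have [d dP] := uncountable_fibre (fun c => msize (g c)).
pose s := [seq val m | m : 'X_{1..n < d}].
have [cs [ucs scs csd]] : exists cs : seq K,
    [/\ uniq cs, size cs = (size s).+1 & {in cs, forall c, (msize (g c) <= d)%N}].
  elim: (size s).+1 => [|k [cs [u sz h]]]; first by exists [::].
  have [c ccs cd] := dP cs; exists (c :: cs); rewrite /= ccs u sz; split=> //.
  by move=> c'; rewrite inE => /predU1P[->|/h].
pose c (j : 'I_(size s).+1) := nth 0 cs j.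
have ccs j : c j \in cs by apply: mem_nth; rewrite scs.
have c_inj j k : c j = c k -> j = k.
  by move/eqP; rewrite nth_uniq ?scs// => /eqP/val_inj.
have gs j : {subset msupp (g (c j)) <= s}.
  move=> m /msize_mdeg_lt md; apply/mapP.
  by exists (BMultinom (leq_trans md (csd _ (ccs j)))); rewrite ?mem_enum.
have [l [j0 lj0] l0] := mpoly_lin_dep gs (leqnn _).
(* The relation [\sum_j l j / (X_i - c j) = 0] without its denominators. *)
pose p : {poly K} := \sum_j l j *: \prod_(k | k != j) ('X - (c k)%:P).
have p0 : p != 0.
  apply: contraNneq lj0 => /(congr1 (fun q : {poly K} => q.[c j0])).
  rewrite horner0 /p horner_sum (bigD1 j0)//= [X in _ + X]big1 => [|j /negPf jj]; last first.
    rewrite hornerZ horner_prod (bigD1 j0) 1?eq_sym ?jj//=.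
    by rewrite hornerXsubC subrr mul0r mulr0.
  rewrite addr0 hornerZ horner_prod => /eqP; rewrite mulf_eq0 => /orP[//|].
  rewrite prodf_seq_eq0 => /hasP[k _ /andP[kj]].
  by rewrite hornerXsubC subr_eq0 => /eqP/c_inj/esym/eqP; rewrite (negPf kj).
pose ev (q : {poly K}) := (map_poly (@mpolyC n K) q).['X_i].
have evP (I : Type) (r : seq I) (Q : pred I) (f : I -> K) :
    ev (\prod_(k <- r | Q k) ('X - (f k)%:P)) =
      \prod_(k <- r | Q k) ('X_i - (f k)%:MP).
  rewrite /ev rmorph_prod horner_prod; apply: eq_bigr => k _.
  by rewrite rmorphB /= map_polyX map_polyC hornerXsubC.
have evZ a q : ev (a *: q) = a *: ev q.
  by rewrite /ev map_polyZ hornerZ mul_mpolyC.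
have Pp0 : P (ev p).
  pose q := \prod_k ('X_i - (c k)%:MP) : {mpoly K[n]}.
  have -> : ev p =
      \sum_j l j *: (\prod_(k | k != j) ('X_i - (c k)%:MP) - q * g (c j)).
    under [RHS]eq_bigr do rewrite scalerBr scalerAr.
    rewrite sumrB -mulr_sumr l0 mulr0 subr0 /ev raddf_sum horner_sum.
    by apply: eq_bigr => j _; rewrite -/(ev _) evZ evP.
  apply: ideal_sum => // j; rewrite -mul_mpolyC.
  apply: (PM); rewrite /q [X in _ - X * _](bigD1 j)//= [X in _ - X * _]mulrC -mulrA.
  rewrite -[X in X - _]mulr1 -mulrBr; apply: (PM).
  by rewrite -opprB -mulN1r; apply: (PM); apply: gP.
have [r pE] := closed_field_poly_normal p.
move: Pp0; rewrite pE evZ => /(PM (lead_coef p)^-1%:MP).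
rewrite mul_mpolyC scalerA mulVf ?lead_coef_eq0// scale1r evP.
by elim: r {pE} => [|z r IH]; rewrite ?big_nil ?big_cons => // /Pp[/nP|].
Qed.

Lemma nullstellensatz n (P : set {mpoly K[n]}) :
  maximal_set P -> exists v : 'I_n -> K, forall i, P ('X_i - (v i)%:MP).
Proof.
move=> mP.
by have /choice[v vP] := fun i : 'I_n => maximal_coord i mP; exists v.
Qed.

End Nullstellensatz.

(** * The Hilbert-Burch complex *)

Section HilbertBurch.
Local Open Scope ring_scope.
Local Open Scope classical_set_scope.
Variables (A : comNzRingType) (n : nat) (N : 'M[A]_(n.+1, n)).
Implicit Types (Q : set A) (e w : 'cV[A]_n.+1).

(** The determinant with a free first column collects the signed maximal minors
of [N] in one linear form. *)
Definition bordered_det w : A := \det (row_mx w N : 'M_(1 + n)).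

Lemma bordered_detE w :
  bordered_det w = \sum_k w k 0 * cofactor (row_mx 0 N : 'M_(1 + n)) k 0.
Proof.
rewrite /bordered_det (expand_det_col _ 0); apply: eq_bigr => k _.
congr (_ * _).
  by rewrite -(row_mxEl w N k 0); congr (row_mx w N k _); apply: val_inj.
rewrite /cofactor; congr (_ * \det _); apply/matrixP => i j; rewrite !mxE.
by case: splitP => //= j'; rewrite ord1.
Qed.

Lemma bordered_detB w w' :
  bordered_det (w - w') = bordered_det w - bordered_det w'.
Proof.
rewrite !bordered_detE -sumrB; apply: eq_bigr => k _.
by rewrite !mxE mulrBl.
Qed.

Lemma bordered_detD w w' :
  bordered_det (w + w') = bordered_det w + bordered_det w'.
Proof.
rewrite !bordered_detE -big_split; apply: eq_bigr => k _.
by rewrite !mxE mulrDl.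
Qed.

Lemma bordered_detZ a w : bordered_det (a *: w) = a * bordered_det w.
Proof.
rewrite !bordered_detE mulr_sumr; apply: eq_bigr => k _.
by rewrite !mxE mulrA.
Qed.

Lemma bordered_det0 : bordered_det 0 = 0.
Proof. by rewrite -[0 in LHS](subrr 0) bordered_detB subrr. Qed.

Lemma bordered_det_mod Q w : ideal_set Q -> (forall k, Q (w k 0)) ->
  Q (bordered_det w).
Proof.
move=> hQ Qw; rewrite bordered_detE; apply: ideal_sum => // k.
exact: ideal_mulr.
Qed.

Lemma bordered_det_range (z : 'cV[A]_n) : bordered_det (N *m z) = 0.
Proof.
have E : row_mx (N *m z) N = row_mx 0 N *m block_mx 1%:M 0 z 1%:M :> 'M_(_, 1 + n).
  by rewrite mul_row_block !mul0mx !add0r mulmx1.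
by rewrite /bordered_det E det_mulmx -/(bordered_det 0) bordered_det0 mul0r.
Qed.

(** Cramer's rule: multiply the bordered matrix by its adjugate. *)
Lemma bordered_cramer e w :
  exists z, bordered_det e *: w = bordered_det w *: e + N *m z.
Proof.
pose P : 'M[A]_(1 + n) := row_mx e N; pose y : 'cV[A]_(1 + n) := \adj P *m w.
exists (dsubmx y).
have : P *m y = bordered_det e *: w.
  by rewrite mulmxA mul_mx_adj mul_scalar_mx.
rewrite -{1}[y]vsubmxK mul_row_col => <-; congr (_ + _).
have -> : usubmx y = (bordered_det w)%:M; last first.
  by rewrite mul_mx_scalar.
apply/matrixP=> i j; rewrite !ord1 !mxE bordered_detE eqxx mulr1n.
apply: eq_bigr => k _; rewrite mxE mulrC; congr (_ * _).
rewrite (_ : lshift n 0 = 0); last exact: val_inj.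
rewrite /cofactor; congr (_ * \det _); apply/matrixP => i' j'; rewrite !mxE.
by case: splitP => //= j''; rewrite ord1.
Qed.

(** Cramer's rule for the square system with matrix [row_mx e N]. *)
Lemma bordered_kernel Q e (z : 'cV[A]_n) : ideal_set Q ->
  (forall k, Q ((N *m z) k 0)) -> forall j, Q (bordered_det e * z j 0).
Proof.
move=> hQ Qz j; pose P : 'M[A]_(1 + n) := row_mx e N.
have PE : P *m col_mx 0 z = N *m z by rewrite mul_row_col mulmx0 add0r.
have : \adj P *m (N *m z) = bordered_det e *: col_mx 0 z.
  by rewrite -PE mulmxA mul_adj_mx mul_scalar_mx.
move/matrixP => /(_ (rshift 1 j) 0); rewrite [RHS]mxE col_mxEd => <-.
rewrite mxE; apply: ideal_sum => // k; case: (hQ) => _ _ hM.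
exact: hM.
Qed.

(** The Hilbert-Burch complex is exact modulo [Q] as soon as the maximal minors
contain a regular sequence of length two modulo [Q]. *)
Lemma hilbert_burch_mod Q e1 e2 : ideal_set Q ->
    (forall x, Q (bordered_det e1 * x) -> Q x) ->
    (forall x y, Q (bordered_det e2 * x - bordered_det e1 * y) ->
      exists z, Q (x - bordered_det e1 * z)) ->
  forall w, Q (bordered_det w) -> exists z, forall k, Q ((w - N *m z) k 0).
Proof.
move=> hQ nzd1 nzd2 w Qw; set f1 := bordered_det e1 in nzd1 nzd2 *.
set f2 := bordered_det e2 in nzd2 *.
have [z1 E1] := bordered_cramer e1 w; have [z2 E2] := bordered_cramer e2 w.
have [_ QD QM] := hQ.
have N12 k : Q ((N *m (f2 *: z1 - f1 *: z2)) k 0).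
  rewrite mulmxBr -!scalemxAr.
  have -> : N *m z1 = f1 *: w - bordered_det w *: e1.
    by rewrite E1 addrC addKr.
  have -> : N *m z2 = f2 *: w - bordered_det w *: e2.
    by rewrite E2 addrC addKr.
  rewrite !mxE (_ : _ - _ = (f1 * e2 k 0 - f2 * e1 k 0) * bordered_det w).
    exact: QM.
  ring.
have z12 j : Q (f2 * z1 j 0 - f1 * z2 j 0).
  by apply: nzd1; have := bordered_kernel e1 hQ N12 j; rewrite !mxE.
have /choice[z' zP] j : exists z', Q (z1 j 0 - f1 * z') by apply: nzd2 (z12 j).
exists (\col_j z' j) => k; apply: nzd1.
have -> : f1 * (w - N *m \col_j z' j) k 0 =
    bordered_det w * e1 k 0 + \sum_j N k j * (z1 j 0 - f1 * z' j).
  have := congr1 (fun x : 'cV_ _ => x k 0) E1; rewrite !mxE => E.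
  rewrite mulrDr E -addrA; congr (_ + _); rewrite mulrN mulr_sumr -sumrB.
  by apply: eq_bigr => j _; rewrite mxE; ring.
apply: QD; first exact: ideal_mulr.
by apply: ideal_sum => // j; apply: QM.
Qed.

(** Exactness modulo [Q + (b)] lifts nonzerodivisors: a relation
[b x = bordered_det w] becomes trivial after subtracting a syzygy of [w]. *)
Lemma nonzerodivisor_mod_minors Q b e1 e2 : ideal_set Q ->
    (forall x, Q (b * x) -> Q x) ->
    let Qb := [set x | exists c, Q (x - b * c)] in
    (forall x, Qb (bordered_det e1 * x) -> Qb x) ->
    (forall x y, Qb (bordered_det e2 * x - bordered_det e1 * y) ->
      exists z, Qb (x - bordered_det e1 * z)) ->
  forall x w, Q (b * x - bordered_det w) -> exists w', Q (x - bordered_det w').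
Proof.
move=> hQ nzdb Qb nzd1 nzd2 x w Qx; have [Q0 QD QM] := hQ.
have hQb : ideal_set Qb.
  split.
  - by exists 0; rewrite mulr0 subr0.
  - move=> y y' [c Qc] [c' Qc']; exists (c + c').
    by rewrite mulrDr opprD addrACA; apply: QD.
  - move=> a y [c Qc]; exists (a * c).
    by rewrite mulrCA -mulrBr; apply: QM.
have Qbw : Qb (bordered_det w).
  by exists x; rewrite -opprB -mulN1r; apply: QM.
have [z zP] := hilbert_burch_mod hQb nzd1 nzd2 Qbw.
have /choice[w' w'P] := zP.
exists (\col_k w' k); apply: nzdb.
have wE : bordered_det w = bordered_det (w - N *m z).
  by rewrite bordered_detB bordered_det_range subr0.
have : Q (bordered_det (w - N *m z - b *: \col_k w' k)).
  by apply: bordered_det_mod => // k; have := w'P k; rewrite !mxE.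
rewrite bordered_detB bordered_detZ -wE => H.
rewrite mulrBr (_ : _ - _ = (b * x - bordered_det w) +
  (bordered_det w - b * bordered_det (\col_k w' k))); last by ring.
exact: QD.
Qed.

End HilbertBurch.

Section TopForms.
Local Open Scope ring_scope.
Local Open Scope classical_set_scope.
Variable R : comNzRingType.
Local Notation A := {mpoly R[2]}.
Implicit Types (q : set R) (f g x y z : A).

Lemma mcoeff_ge n (p : {mpoly R[n]}) k m : (msize p <= k)%N -> (k <= mdeg m)%N ->
  p@_m = 0.
Proof.
move=> pk km; apply/eqP; apply: contraTT km => pm; rewrite -ltnNge.
by move/msize_leP: pk; apply.
Qed.

Lemma msizeM_leR' n (p p' : {mpoly R[n]}) d e :
  (msize p <= d)%N -> (msize p' <= e.+1)%N -> (msize (p * p')%R <= d + e)%N.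
Proof.
case: d => [|d] pd qe; last exact: msizeM_leR.
by move: pd; rewrite leqn0 mmeasure_poly_eq0 => /eqP ->; rewrite mul0r msize0.
Qed.

Lemma msizeB_leR n (p p' : {mpoly R[n]}) k :
  (msize p <= k)%N -> (msize p' <= k)%N -> (msize (p - p')%R <= k)%N.
Proof.
move=> pk p'k; apply: leq_trans (msizeD_le _ _) _.
by rewrite geq_max pk mmeasureN.
Qed.

Lemma mcoeff_MX_lt n (p : {mpoly R[n]}) k m : ~~ (k <= m)%MM ->
  (p * 'X_[k])@_m = 0.
Proof.
move=> km; apply: memN_msupp_eq0; apply: contra km => /msuppM_le.
case/allpairsP=> -[m1 m2] /= [_]; rewrite msuppX inE => /eqP -> ->.
exact: lem_addl.
Qed.

(* The top-degree part of [f] is the power [X_i ^ n]. *)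
Definition monic_in n (i : 'I_2) f := (msize (f - 'X_i ^+ n) <= n)%N.

Lemma monic_msize n i f : monic_in n i f -> (msize f <= n.+1)%N.
Proof.
move=> fi; rewrite -[f](subrK ('X_i ^+ n)).
apply: leq_trans (msizeD_le _ _) _; rewrite geq_max (leqW fi) /=.
by rewrite mpolyXn msizeX mdegMn mdeg1 mul1n.
Qed.

Lemma monic_top n i f x d m : monic_in n i f -> (msize x <= d.+1)%N ->
  mdeg m = (d + n)%N ->
  (f * x)@_m = if (n <= m i)%N then x@_(m - U_(i) *+ n) else 0.
Proof.
move=> fi xd md; rewrite -[f](subrK ('X_i ^+ n)) mulrDl mcoeffD.
rewrite [X in X + _](_ : _ = 0) ?add0r; last first.
  case: n fi md => [|n] fi md.
    by have := fi; rewrite /monic_in leqn0 mmeasure_poly_eq0 => /eqP ->; rewrite mul0r mcoeff0.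
  by apply: (mcoeff_ge (msizeM_leR fi xd)); rewrite md; lia.
rewrite mpolyXn mulrC; case: ifP => nm.
  have km : (U_(i) *+ n <= m)%MM.
    apply/mnm_lepP => j; rewrite mulmnE mnm1E.
    by case: eqP => [<-|]; rewrite ?mul1n ?mul0n.
  by rewrite -[in LHS](submK km) addmC mcoeffMX.
apply: mcoeff_MX_lt; apply/negP => /mnm_lepP /(_ i).
by rewrite mulmnE mnm1E eqxx mul1n nm.
Qed.

(** The extension of the ideal [q] of [R] to [R[X_0, X_1]]. *)
Definition coef_ideal q : set A := [set x | forall m, q x@_m].

Lemma coef_ideal_ideal q : ideal_set q -> ideal_set (coef_ideal q).
Proof.
move=> hq; case: (hq) => q0 qD qM; split.
- by move=> m; rewrite mcoeff0.
- by move=> x y qx qy m; rewrite mcoeffD; apply: qD.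
- move=> a x qx m; rewrite (mcoeffM a x); elim/big_ind: _ => // k _.
  exact: qM.
Qed.

Lemma coef_ideal_lower q d x : ideal_set q -> (msize x <= d.+1)%N ->
    (forall m, mdeg m = d -> q x@_m) ->
  exists2 x', (msize x' <= d)%N & coef_ideal q (x - x').
Proof.
move=> hq xd top; pose t := pihomog mdeg d x.
have tE m : t@_m = if mdeg m == d then x@_m else 0.
  rewrite /t pihomogE raddf_sum /=; case: ifP => md.
    rewrite [in RHS](mpolyE x) raddf_sum /= [RHS](bigID (fun m => mdeg m == d)) /=.
    rewrite [X in _ = _ + X]big1 ?addr0// => k kd; rewrite mcoeffZ mcoeffX.
    by case: eqP => [kE|]; rewrite ?mulr0//; rewrite kE md in kd.
  rewrite big1// => k /eqP kd; rewrite mcoeffZ mcoeffX.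
  by case: eqP => [kE|]; rewrite ?mulr0//; rewrite -kE kd eqxx in md.
exists (x - t).
  apply/msize_leP => m; rewrite mcoeffB tE; case: ifP => [_|md].
    by rewrite subrr eqxx.
  rewrite subr0 => ym; have := xd => /msize_leP /(_ m ym).
  by rewrite ltnS leq_eqVlt md.
move=> m; rewrite opprB addrC subrK tE; case: eqP => [/top//|_].
by case: hq.
Qed.

(** Multiplication by [f] shifts the part of top degree, so this part has its
coefficients in [q] and can be removed. *)
Lemma monic_nonzerodivisor q n i f x : ideal_set q -> monic_in n i f ->
  coef_ideal q (f * x) -> coef_ideal q x.
Proof.
move=> hq fi; have hQ := coef_ideal_ideal hq; have [Q0 QD QM] := hQ.
suff H d y : (msize y <= d)%N -> coef_ideal q (f * y) -> coef_ideal q y.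
  exact: H (leqnn _).
elim: d y => [|d IH] y yd Qfy.
  by move: yd; rewrite leqn0 mmeasure_poly_eq0 => /eqP ->.
have top m : mdeg m = d -> q y@_m.
  move=> md; have := monic_top (m := (m + U_(i) *+ n)%MM) fi yd.
  rewrite mdegD mdegMn mdeg1 mul1n md => /(_ erefl).
  rewrite mnmDE mulmnE mnm1E eqxx mul1n leq_addl addmK => <-; exact: Qfy.
have [y' y'd Qy] := coef_ideal_lower hq yd top.
rewrite -[y](subrK y'); apply: QD => //; apply: IH => //.
rewrite -[f * y'](subKr (f * y)) -mulrBr.
by apply: (ideal_sub hQ Qfy); apply: QM.
Qed.

(** Compare top-degree parts in [g x = f y]: they are [X_j ^ n x_top] and
[X_i ^ n y_top], so that [X_i ^ n] divides [x_top]; subtract and lower the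
degree. *)
Lemma monic_pair_regular q n i j f g : ideal_set q -> i != j ->
    monic_in n i f -> monic_in n j g ->
  forall x y, coef_ideal q (g * x - f * y) -> exists z, coef_ideal q (x - f * z).
Proof.
move=> hq ij fi gj; have hQ := coef_ideal_ideal hq; have [Q0 QD QM] := hQ.
have [q0 _ qM] := hq.
suff H d x y : (msize x <= d)%N -> (msize y <= d)%N ->
    coef_ideal q (g * x - f * y) -> exists z, coef_ideal q (x - f * z).
  by move=> x y; apply: (H (maxn (msize x) (msize y))); rewrite ?leq_maxl ?leq_maxr.
elim: d x y => [|d IH] x y xd yd Qxy.
  move: xd; rewrite leqn0 mmeasure_poly_eq0 => /eqP ->; exists 0.
  by rewrite mulr0 subrr.
have rel m : mdeg m = (d + n)%N ->
    q ((if (n <= m j)%N then x@_(m - U_(j) *+ n) else 0) -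
       (if (n <= m i)%N then y@_(m - U_(i) *+ n) else 0)).
  move=> md; rewrite -(monic_top gj xd md) -(monic_top fi yd md) -mcoeffB.
  exact: Qxy.
pose z : A := \sum_(m <- msupp x | (mdeg m == d) && (n <= m i)%N)
  x@_m *: 'X_[m - U_(i) *+ n].
have leU (k : 'I_2) (m : 'X_{1..2}) : (n <= m k)%N -> (U_(k) *+ n <= m)%MM.
  move=> nm; apply/mnm_lepP => l; rewrite mulmnE mnm1E.
  by case: eqP => [<-|]; rewrite ?mul1n ?mul0n.
have lei (k : 'I_2) (m : 'X_{1..2}) : (m k <= mdeg m)%N.
  by rewrite mdegE (bigD1 k)//= leq_addr.
have zE m : z@_m = if mdeg (m + U_(i) *+ n) == d then x@_(m + U_(i) *+ n) else 0.
  set m' := (m + _)%MM; have m'i : (n <= m' i)%N.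
    by rewrite mnmDE mulmnE mnm1E eqxx mul1n leq_addl.
  rewrite /z raddf_sum /=; under eq_bigr do rewrite mcoeffZ mcoeffX.
  have E (k : 'X_{1..2}) : (n <= k i)%N -> ((k - U_(i) *+ n)%MM == m) = (k == m').
    move=> nk; apply/eqP/eqP => [km|->]; last by rewrite addmK.
    by rewrite /m' -km submK// leU.
  under eq_bigr => k /andP[_ nk] do rewrite E//.
  case: ifP => md.
    rewrite [in RHS](mpolyE x) raddf_sum /=.
    rewrite [RHS](bigID (fun m : 'X_{1..2} => (mdeg m == d) && (n <= m i)%N)) /=.
    rewrite [X in _ = _ + X]big1 ?addr0.
      by apply: eq_bigr => k _; rewrite mcoeffZ mcoeffX.
    move=> k kd; rewrite mcoeffZ mcoeffX.
    by case: eqP => [kE|]; rewrite ?mulr0//; rewrite kE md m'i in kd.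
  rewrite big1// => k /andP[/eqP kd _].
  by case: eqP => [kE|]; rewrite ?mulr0//; rewrite -kE kd eqxx in md.
have z_top k h m : monic_in n k h -> mdeg m = d ->
    (h * z)@_m = if (n <= m k)%N then z@_(m - U_(k) *+ n) else 0.
  move=> hk md; case: (leqP n d) => nd.
    apply: (@monic_top _ _ _ _ (d - n)) => //; last by rewrite subnK.
    apply/msize_leP => l; rewrite zE mdegD mdegMn mdeg1 mul1n.
    by case: ifP => [/eqP ld _|]; rewrite ?eqxx//; lia.
  have -> : z = 0.
    apply/mpolyP => l; rewrite mcoeff0 zE mdegD mdegMn mdeg1 mul1n.
    by case: ifP => // /eqP ld; move: nd; rewrite -ld; lia.
  by rewrite mulr0 !mcoeff0 if_same.
have zd : (msize z <= (d - n).+1)%N.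
  apply/msize_leP => l; rewrite zE mdegD mdegMn mdeg1 mul1n.
  by case: ifP => [/eqP ld _|]; rewrite ?eqxx//; lia.
have hzd k h : monic_in n k h -> (msize (h * z)%R <= d.+1)%N.
  move=> hk; case: (leqP n d) => nd.
    by have := msizeM_leR (monic_msize hk) zd; rewrite subnKC.
  have -> : z = 0.
    apply/mpolyP => l; rewrite mcoeff0 zE mdegD mdegMn mdeg1 mul1n.
    by case: ifP => // /eqP ld; move: nd; rewrite -ld; lia.
  by rewrite mulr0 msize0.
have qN a : q a -> q (- a) by move=> qa; rewrite -mulN1r; apply: qM.
have ji : j != i by rewrite eq_sym.
have topx m : mdeg m = d -> q (x - f * z)@_m.
  move=> md; rewrite mcoeffB (z_top _ _ _ fi md); case: ifP => nm.
    by rewrite zE submK ?leU// md eqxx subrr.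
  have := rel (m + U_(j) *+ n)%MM; rewrite mdegD mdegMn mdeg1 mul1n md.
  move=> /(_ erefl); rewrite !mnmDE !mulmnE !mnm1E eqxx (negPf ji) mul1n mul0n.
  by rewrite addn0 nm leq_addl addmK.
have topy m : mdeg m = d -> q (y - g * z)@_m.
  move=> md; rewrite mcoeffB (z_top _ _ _ gj md).
  have := rel (m + U_(i) *+ n)%MM; rewrite mdegD mdegMn mdeg1 mul1n md.
  move=> /(_ erefl); rewrite !mnmDE !mulmnE !mnm1E eqxx (negPf ij) mul1n mul0n.
  rewrite addn0 leq_addl addmK => H.
  rewrite -opprB; apply: qN; case: ifP H => nm // H.
  rewrite zE ifT; last first.
    have := congr1 (@mdeg 2) (submK (leU _ _ nm)).
    by rewrite !mdegD !mdegMn !mdeg1 md => ->.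
  have -> // : (m - U_(j) *+ n + U_(i) *+ n = m + U_(i) *+ n - U_(j) *+ n)%MM.
  by rewrite addmC addmBA ?leU// addmC.
have [x' x'd Qx] := coef_ideal_lower hq (msizeB_leR xd (hzd _ _ fi)) topx.
have [y' y'd Qy] := coef_ideal_lower hq (msizeB_leR yd (hzd _ _ gj)) topy.
have [|z' Qz'] := IH x' y' x'd y'd.
  rewrite (_ : _ - _ = (g * x - f * y) - g * (x - f * z - x') +
    f * (y - g * z - y')); last by ring.
  have QM1 := QM g _ Qx; have QM2 := QM f _ Qy.
  exact: QD (ideal_sub hQ Qxy QM1) QM2.
exists (z + z'); rewrite (_ : _ - _ = (x - f * z - x') + (x' - f * z')).
  exact: (QD _ _ Qx Qz').
by ring.
Qed.

End TopForms.

(** * The syzygy matrix of a sextic *)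

Section Explicit.
Local Open Scope ring_scope.
Variable A : comNzRingType.
Implicit Types (m : nat -> nat -> A) (a : nat -> A).

(** Laplace expansions of small determinants, as explicit polynomial expressions. *)
Definition det2 m : A := m 0%N 0%N * m 1%N 1%N - m 0%N 1%N * m 1%N 0%N.
Definition jump (j k : nat) : nat := if (k < j)%N then k else k.+1.
Definition skip m j : nat -> nat -> A := fun i k => m i.+1 (jump j k).
Lemma jumpE j k : jump j k = bump j k.
Proof. by rewrite /jump /bump; case: (ltnP k j). Qed.

Definition det3 m : A :=
  m 0%N 0%N * det2 (skip m 0%N) - m 0%N 1%N * det2 (skip m 1%N) + m 0%N 2%N * det2 (skip m 2%N).
Definition det4 m : A :=
  m 0%N 0%N * det3 (skip m 0%N) - m 0%N 1%N * det3 (skip m 1%N) + m 0%N 2%N * det3 (skip m 2%N)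
  - m 0%N 3%N * det3 (skip m 3%N).

Lemma det_skip n m :
  \det (\matrix_(i < n.+1, j < n.+1) m i j) =
  \sum_(j < n.+1) (-1) ^+ j * m 0 j * \det (\matrix_(i < n, k < n) skip m j i k).
Proof.
rewrite (expand_det_row _ 0); apply: eq_bigr => j _; rewrite mxE /cofactor.
rewrite add0n -mulrA mulrCA; congr (_ * (_ * \det _)).
by apply/matrixP => i k; rewrite !mxE /skip jumpE.
Qed.

Lemma det2E m : \det (\matrix_(i < 2, j < 2) m i j) = det2 m.
Proof.
rewrite det_skip !big_ord_recl big_ord0 !det_mx11 !mxE /det2 /skip /=.
rewrite /jump /=; ring.
Qed.

Lemma det3E m : \det (\matrix_(i < 3, j < 3) m i j) = det3 m.
Proof.
rewrite det_skip !big_ord_recl big_ord0 !det2E /det3 /=.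
rewrite /jump /=; ring.
Qed.

Lemma det4E m : \det (\matrix_(i < 4, j < 4) m i j) = det4 m.
Proof.
rewrite det_skip !big_ord_recl big_ord0 !det3E /det4 /=.
rewrite /jump /=; ring.
Qed.

(** The coefficients of the quartic covariant [(F, F)_4] of the sextic [F] with
coefficients ['C(6, i) a_i], up to a constant. *)
Definition quartic_cov a (k : nat) : A :=
  match k with
  | 0 => a 0%N * a 4%N - 4 * a 1%N * a 3%N + 3 * a 2%N ^+ 2
  | 1 => 2 * (a 0%N * a 5%N - 3 * a 1%N * a 4%N + 2 * a 2%N * a 3%N)
  | 2 => a 0%N * a 6%N - 9 * a 2%N * a 4%N + 8 * a 3%N ^+ 2
  | 3 => 2 * (a 1%N * a 6%N - 3 * a 2%N * a 5%N + 2 * a 3%N * a 4%N)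
  | _ => a 2%N * a 6%N - 4 * a 3%N * a 5%N + 3 * a 4%N ^+ 2
  end.

Definition bin4 (k : nat) : A :=
  match k with 0 => 1 | 1 => 4 | 2 => 6 | 3 => 4 | _ => 1 end.

(** Row [k] of this matrix holds the coefficients of [x_1 ^ (4 - k) x_2 ^ k] in
the quartics [(F, x_1 ^ 2)_2], [(F, x_1 x_2)_2], [(F, x_2 ^ 2)_2], [(F, F)_4]. *)
Definition syz_entry a (k j : nat) : A :=
  match j with
  | 0 => bin4 k * a k.+2
  | 1 => - (bin4 k * a k.+1)
  | 2 => bin4 k * a k
  | _ => quartic_cov a k
  end.

Definition syz_mx a : 'M[A]_(5, 4) := \matrix_(k, j) syz_entry a k j.

Definition minor a (k : nat) : A :=
  (-1) ^+ k * det4 (fun i j => syz_entry a (jump k i) j).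

Lemma bordered_det_minor a (w : 'cV[A]_5) :
  bordered_det (syz_mx a) w = \sum_(k < 5) w k 0 * minor a k.
Proof.
rewrite bordered_detE; apply: eq_bigr => k _; congr (_ * _).
rewrite /cofactor /minor addn0 -det4E; congr (_ * \det _).
apply/matrixP => i j; rewrite !mxE; case: splitP => [j' /=|j' jE].
  by rewrite ord1.
by rewrite mxE; move: jE; rewrite lift0 add1n jumpE => -[->].
Qed.

Lemma bordered_det_delta a (k : 'I_5) :
  bordered_det (syz_mx a) (delta_mx k 0) = minor a k.
Proof.
rewrite bordered_det_minor (bigD1 k)//= mxE !eqxx mul1r big1 ?addr0// => i ik.
by rewrite mxE (negPf ik) mul0r.
Qed.

(** The quartic covariant in binomial coordinates, times [12]. *)
Definition quartic_cov12 a (k : nat) : A :=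
  match k with
  | 0 => 12 * quartic_cov a 0%N | 1 => 3 * quartic_cov a 1%N
  | 2 => 2 * quartic_cov a 2%N | 3 => 3 * quartic_cov a 3%N
  | _ => 12 * quartic_cov a 4%N
  end.

Definition rows3 (r0 r1 r2 : nat -> A) : A :=
  det3 (fun i => match i with 0 => r0 | 1 => r1 | _ => r2 end).

(** The minor of the first three columns of [syz_mx a] in its first three rows, up
to a numerical factor. *)
Definition hankel3 a := rows3 a (fun k => a k.+1) (fun k => a k.+2).

(* Cramer numerators for the quartic covariant as a combination of the three
shifts of [a]. *)
Definition cramer0 a := rows3 a (fun k => a k.+1) (quartic_cov12 a).
Definition cramer1 a := rows3 a (quartic_cov12 a) (fun k => a k.+2).
Definition cramer2 a := rows3 (quartic_cov12 a) (fun k => a k.+1) (fun k => a k.+2).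

Definition transvect2 (b : nat -> A) h0 h1 h2 (k : nat) : A :=
  h0 * b k.+2 + h1 * b k.+1 + h2 * b k.

(* Six times the binomial coordinates of [(h_0 x_1 ^ 2 - h_1 x_1 x_2 + h_2 x_2 ^ 2) ^ 2]. *)
Definition quad_sq h0 h1 h2 (k : nat) : A :=
  match k with
  | 0 => 6 * h0 ^+ 2 | 1 => - (3 * h0 * h1) | 2 => 2 * h0 * h2 + h1 ^+ 2
  | 3 => - (3 * h1 * h2) | _ => 6 * h2 ^+ 2
  end.

Definition sexticQ2 e0 e1 l h0 h1 h2 : A :=
  - h1 * e1 - h2 * e0 + l * quad_sq h0 h1 h2 0%N.
Definition sexticQ3 e0 e1 l h0 h1 h2 : A :=
  - h1 * sexticQ2 e0 e1 l h0 h1 h2 - h0 * h2 * e1 + h0 * l * quad_sq h0 h1 h2 1%N.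
Definition sexticQ4 e0 e1 l h0 h1 h2 : A :=
  - h1 * sexticQ3 e0 e1 l h0 h1 h2 - h0 * h2 * sexticQ2 e0 e1 l h0 h1 h2
  + h0 ^+ 2 * l * quad_sq h0 h1 h2 2%N.
Definition sexticQ5 e0 e1 l h0 h1 h2 : A :=
  - h1 * sexticQ4 e0 e1 l h0 h1 h2 - h0 * h2 * sexticQ3 e0 e1 l h0 h1 h2
  + h0 ^+ 3 * l * quad_sq h0 h1 h2 3%N.
Definition sexticQ6 e0 e1 l h0 h1 h2 : A :=
  - h1 * sexticQ5 e0 e1 l h0 h1 h2 - h0 * h2 * sexticQ4 e0 e1 l h0 h1 h2
  + h0 ^+ 4 * l * quad_sq h0 h1 h2 4%N.

(** The solution [a] of [transvect2 a h0 h1 h2 k = l * quad_sq h0 h1 h2 k] with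
given first two terms, multiplied by [h0 ^ 5] to clear denominators. *)
Definition sextic_param e0 e1 l h0 h1 h2 (k : nat) : A :=
  match k with
  | 0 => h0 ^+ 5 * e0 | 1 => h0 ^+ 5 * e1
  | 2 => h0 ^+ 4 * sexticQ2 e0 e1 l h0 h1 h2
  | 3 => h0 ^+ 3 * sexticQ3 e0 e1 l h0 h1 h2
  | 4 => h0 ^+ 2 * sexticQ4 e0 e1 l h0 h1 h2
  | 5 => h0 * sexticQ5 e0 e1 l h0 h1 h2
  | _ => sexticQ6 e0 e1 l h0 h1 h2
  end.

End Explicit.

Section Congruences.
Local Open Scope ring_scope.
Local Open Scope classical_set_scope.
Variables (A : comNzRingType) (I : set A).
Hypothesis hI : ideal_set I.

Lemma ideal_lin1 x a y : I x -> y = a * x -> I y.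
Proof. by case: hI => _ _ hM hx ->; apply: hM. Qed.

Lemma ideal_lin2 x1 x2 a1 a2 y : I x1 -> I x2 -> y = a1 * x1 + a2 * x2 -> I y.
Proof. by case: hI => _ hD hM h1 h2 ->; apply: hD; apply: hM. Qed.

Lemma ideal_lin3 x1 x2 x3 a1 a2 a3 y : I x1 -> I x2 -> I x3 ->
  y = a1 * x1 + a2 * x2 + a3 * x3 -> I y.
Proof.
by case: hI => _ hD hM h1 h2 h3 ->; apply: (hD); [apply: (hD)|]; apply: hM.
Qed.

(** The maximal minors through the first three columns express the quartic
covariant by the shifts of [a]. *)
Lemma cramer_mod a : (forall x, I (2 * x) -> I x) -> I (minor a 3%N) ->
  I (minor a 4%N) -> forall k, (k < 5)%N ->
  I (hankel3 a * quartic_cov12 a k -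
     transvect2 a (cramer0 a) (cramer1 a) (cramer2 a) k).
Proof.
move=> h2 m3 m4 [|[|[|[|[|//]]]]] _.
- rewrite (_ : _ - _ = 0); first by case: hI.
  rewrite /transvect2 /cramer0 /cramer1 /cramer2 /hankel3 /rows3 /det3 /det2
    /skip /jump /=. ring.
- rewrite (_ : _ - _ = 0); first by case: hI.
  rewrite /transvect2 /cramer0 /cramer1 /cramer2 /hankel3 /rows3 /det3 /det2
    /skip /jump /=; ring.
- rewrite (_ : _ - _ = 0); first by case: hI.
  rewrite /transvect2 /cramer0 /cramer1 /cramer2 /hankel3 /rows3 /det3 /det2
    /skip /jump /=; ring.
- do 3!apply: (h2); apply: (ideal_lin1 (a := 1) m4).
  rewrite /transvect2 /cramer0 /cramer1 /cramer2 /hankel3 /rows3 /minor /det4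
    /det3 /det2 /skip /jump /syz_entry /bin4 /quartic_cov12 /quartic_cov /=; ring.
- apply: h2; apply: (ideal_lin1 (a := -1) m3).
  rewrite /transvect2 /cramer0 /cramer1 /cramer2 /hankel3 /rows3 /minor /det4
    /det3 /det2 /skip /jump /syz_entry /bin4 /quartic_cov12 /quartic_cov /=; ring.
Qed.

(** If the quartic covariant of [b] equals the transvectant [(b, h)_2], then the
Jacobian of this transvectant and of [h] vanishes: up to a constant the Jacobian
of [(F, F)_4] and [h] is [((F, h)_2, F)_3], while [((F, F)_4, F)_3 = 0]. *)
Lemma jacobian_mod b h0 h1 h2 : let g := transvect2 b h0 h1 h2 in
    (forall k, (k < 5)%N -> I (quartic_cov12 b k - g k)) ->
  [/\ I (g 0%N * h1 + 2 * g 1%N * h0),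
      I (g 0%N * h2 - g 1%N * h1 - 3 * g 2%N * h0),
      I (g 1%N * h2 - g 3%N * h0) &
      I (3 * g 2%N * h2 + g 3%N * h1 - g 4%N * h0)].
Proof.
move=> g gb; pose E k := quartic_cov12 b k - g k.
have E0 : I (E 0%N) by apply: gb. have E1 : I (E 1%N) by apply: gb.
have E2 : I (E 2%N) by apply: gb. have E3 : I (E 3%N) by apply: gb.
have E4 : I (E 4%N) by apply: gb.
have lin c0 c1 c2 c3 c4 y : y = c0 * E 0%N + c1 * E 1%N + c2 * E 2%N +
    c3 * E 3%N + c4 * E 4%N -> I y.
  by case: (hI) => _ hD hM ->; do 4?[apply: (hD)]; apply: hM.
split.
- apply: (lin (12 * b 3%N - h1) (- 36 * b 2%N - 2 * h0) (36 * b 1%N) (- 12 * b 0%N) 0).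
  rewrite /E /g /transvect2 /quartic_cov12 /quartic_cov; ring.
- apply: (lin (- 18 * b 4%N - h2) (48 * b 3%N + h1) (- 36 * b 2%N + 3 * h0) 0 (6 * b 0%N)).
  rewrite /E /g /transvect2 /quartic_cov12 /quartic_cov; ring.
- apply: (lin (- 6 * b 5%N) (12 * b 4%N - h2) 0 (- 12 * b 2%N + h0) (6 * b 1%N)).
  rewrite /E /g /transvect2 /quartic_cov12 /quartic_cov; ring.
- apply: (lin (- 6 * b 6%N) 0 (36 * b 4%N - 3 * h2) (- 48 * b 3%N - h1) (18 * b 2%N + h0)).
  rewrite /E /g /transvect2 /quartic_cov12 /quartic_cov; ring.
Qed.

(** A quartic with vanishing Jacobian with the quadric [h] is proportional to
[h ^ 2], up to powers of the leading coefficient of [h]. *)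
Lemma jacobian_proportional (g : nat -> A) h0 h1 h2 :
    I (g 0%N * h1 + 2 * g 1%N * h0) ->
    I (g 0%N * h2 - g 1%N * h1 - 3 * g 2%N * h0) ->
    I (g 1%N * h2 - g 3%N * h0) ->
    I (3 * g 2%N * h2 + g 3%N * h1 - g 4%N * h0) ->
  forall k, (k < 5)%N ->
  I (6 * h0 ^+ 3 * g k - h0 * g 0%N * quad_sq h0 h1 h2 k).
Proof.
move=> j0 j1 j2 j3.
have lin c0 c1 c2 c3 y : y = c0 * (g 0%N * h1 + 2 * g 1%N * h0) +
    c1 * (g 0%N * h2 - g 1%N * h1 - 3 * g 2%N * h0) +
    c2 * (g 1%N * h2 - g 3%N * h0) +
    c3 * (3 * g 2%N * h2 + g 3%N * h1 - g 4%N * h0) -> I y.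
  by case: (hI) => _ hD hM ->; do 3?[apply: (hD)]; apply: hM.
move=> [|[|[|[|[|//]]]]] _; rewrite /quad_sq.
- apply: (lin 0 0 0 0); ring.
- apply: (lin (3 * h0 ^+ 2) 0 0 0); ring.
- apply: (lin (- h0 * h1) (- 2 * h0 ^+ 2) 0 0); ring.
- apply: (lin (3 * h0 * h2) 0 (- 6 * h0 ^+ 2) 0); ring.
- apply: (lin 0 (- 6 * h0 * h2) (- 6 * h0 * h1) (- 6 * h0 ^+ 2)); ring.
Qed.

(** A sextic with the prescribed transvectant is given by the parametrisation. *)
Lemma sextic_param_mod b l h0 h1 h2 :
    (forall k, (k < 5)%N -> I (transvect2 b h0 h1 h2 k - l * quad_sq h0 h1 h2 k)) ->
  forall k, (k < 7)%N ->
  I (h0 ^+ 5 * b k - sextic_param (b 0%N) (b 1%N) l h0 h1 h2 k).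
Proof.
move=> Hb; pose E k := transvect2 b h0 h1 h2 k - l * quad_sq h0 h1 h2 k.
have E0 : I (E 0%N) by apply: Hb. have E1 : I (E 1%N) by apply: Hb.
have E2 : I (E 2%N) by apply: Hb. have E3 : I (E 3%N) by apply: Hb.
have E4 : I (E 4%N) by apply: Hb.
pose Q2 := sexticQ2 (b 0%N) (b 1%N) l h0 h1 h2.
pose Q3 := sexticQ3 (b 0%N) (b 1%N) l h0 h1 h2.
pose Q4 := sexticQ4 (b 0%N) (b 1%N) l h0 h1 h2.
pose Q5 := sexticQ5 (b 0%N) (b 1%N) l h0 h1 h2.
pose Q6 := sexticQ6 (b 0%N) (b 1%N) l h0 h1 h2.
have D2 : I (h0 * b 2%N - Q2).
  apply: (ideal_lin1 (a := 1) E0).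
  rewrite /E /Q2 /sexticQ2 /transvect2; ring.
have D3 : I (h0 ^+ 2 * b 3%N - Q3).
  apply: (ideal_lin2 (a1 := h0) (a2 := - h1) E1 D2).
  rewrite /E /Q3 /sexticQ3 -/Q2 /transvect2; ring.
have D4 : I (h0 ^+ 3 * b 4%N - Q4).
  apply: (ideal_lin3 (a1 := h0 ^+ 2) (a2 := - h1) (a3 := - h0 * h2) E2 D3 D2).
  rewrite /E /Q4 /sexticQ4 -/Q2 -/Q3 /transvect2; ring.
have D5 : I (h0 ^+ 4 * b 5%N - Q5).
  apply: (ideal_lin3 (a1 := h0 ^+ 3) (a2 := - h1) (a3 := - h0 * h2) E3 D4 D3).
  rewrite /E /Q5 /sexticQ5 -/Q3 -/Q4 /transvect2; ring.
have D6 : I (h0 ^+ 5 * b 6%N - Q6).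
  apply: (ideal_lin3 (a1 := h0 ^+ 4) (a2 := - h1) (a3 := - h0 * h2) E4 D5 D4).
  rewrite /E /Q6 /sexticQ6 -/Q4 -/Q5 /transvect2; ring.
move=> [|[|[|[|[|[|[|//]]]]]]] _; rewrite /sextic_param.
- by rewrite subrr; case: hI.
- by rewrite subrr; case: hI.
- apply: (ideal_lin1 (a := h0 ^+ 4) D2); rewrite -/Q2; ring.
- apply: (ideal_lin1 (a := h0 ^+ 3) D3); rewrite -/Q3; ring.
- apply: (ideal_lin1 (a := h0 ^+ 2) D4); rewrite -/Q4; ring.
- apply: (ideal_lin1 (a := h0) D5); rewrite -/Q5; ring.
- apply: (ideal_lin1 (a := 1) D6); rewrite -/Q6; ring.
Qed.

(** Modulo two of the minors and up to denominators, the sextic [F] is recovered from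
the quadric [h] with [(F, h)_2 = (F, F)_4], from the factor [l] of proportionality of
this quartic to [h ^ 2], and from its first two coefficients. *)
Lemma param_of_minors a : (forall x, I (2 * x) -> I x) -> I (minor a 3%N) ->
    I (minor a 4%N) ->
  let h0 := cramer0 a in let h1 := cramer1 a in let h2 := cramer2 a in
  let b := fun k => 6 * h0 ^+ 3 * hankel3 a * a k in
  let l := h0 * hankel3 a * transvect2 a h0 h1 h2 0%N in
  forall k, (k < 7)%N ->
  I (h0 ^+ 5 * b k - sextic_param (b 0%N) (b 1%N) l h0 h1 h2 k).
Proof.
move=> half m3 m4 h0 h1 h2 b l.
have [_ _ hM] := hI.
pose c k := hankel3 a * a k.
have cE k : transvect2 c h0 h1 h2 k = hankel3 a * transvect2 a h0 h1 h2 k.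
  by rewrite /transvect2 /c; ring.
have Hc k : (k < 5)%N -> I (quartic_cov12 c k - transvect2 c h0 h1 h2 k).
  move=> hk; apply: (ideal_lin1 (a := hankel3 a) (cramer_mod half m3 m4 hk)).
  rewrite cE mulrBr; congr (_ - _).
  rewrite /c; move: hk; move: k => [|[|[|[|[|//]]]]] _;
    rewrite /quartic_cov12 /quartic_cov; ring.
have [j0 j1 j2 j3] := jacobian_mod Hc.
apply: sextic_param_mod => k hk.
apply: (ideal_lin1 (a := 1) (jacobian_proportional j0 j1 j2 j3 hk)).
rewrite !cE /b /l /transvect2; ring.
Qed.

End Congruences.

(** * The coordinate ring over five parameters *)

Section Morphisms.
Local Open Scope ring_scope.

Lemma mpoly_rmorph_ext n (R T : comNzRingType)
    (f g : {rmorphism {mpoly R[n]} -> T}) :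
  (forall c, f c%:MP = g c%:MP) -> (forall i, f 'X_i = g 'X_i) -> f =1 g.
Proof.
move=> fC fX p; rewrite [p]mpolyE !rmorph_sum; apply: eq_bigr => m _.
rewrite -mul_mpolyC !rmorphM fC mpolyXE_id !rmorph_prod; congr (_ * _).
by apply: eq_bigr => i _; rewrite !rmorphXn fX.
Qed.

Variables (A A' : comNzRingType) (f : {rmorphism A -> A'}).

Lemma syz_entry_morph a k j : f (syz_entry a k j) = syz_entry (f \o a) k j.
Proof.
have fbin : f (bin4 A k) = bin4 A' k.
  by move: k => [|[|[|[|[|k]]]]]; rewrite /= ?rmorph1 ?rmorph_nat.
move: j => [|[|[|j]]]; rewrite /syz_entry ?rmorphN ?rmorphM /= ?fbin //.
by move: k {fbin} => [|[|[|[|k]]]]; rewrite /quartic_cov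
  ?(rmorph_nat, rmorphXn, rmorphM, rmorphB, rmorphD).
Qed.

Lemma bordered_det_morph a w :
  f (bordered_det (syz_mx a) w) = bordered_det (syz_mx (f \o a)) (map_mx f w).
Proof.
rewrite /bordered_det -det_map_mx map_row_mx; congr (\det (row_mx _ _)).
by apply/matrixP => k j; rewrite !mxE syz_entry_morph.
Qed.

Lemma eq_syz_mx (a b : nat -> A) :
  (forall k, (k < 7)%N -> a k = b k) -> syz_mx a = syz_mx b.
Proof.
move=> ab; apply/matrixP => k j; rewrite !mxE.
move: (nat_of_ord k) (ltn_ord k) => [|[|[|[|[|//]]]]] _;
  by rewrite /syz_entry /quartic_cov !ab.
Qed.

Lemma minor_morph a (b : nat -> A') k : (k < 5)%N ->
  (forall i, (i < 7)%N -> f (a i) = b i) -> f (minor a k) = minor b k.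
Proof.
move=> k5 ab; rewrite -[k]/(nat_of_ord (Ordinal k5)) -!bordered_det_delta.
rewrite bordered_det_morph map_delta_mx; congr bordered_det.
apply/matrixP => i j; rewrite !mxE.
move: (nat_of_ord i) (ltn_ord i) => [|[|[|[|[|//]]]]] _;
  by rewrite /syz_entry /quartic_cov /= !ab.
Qed.

End Morphisms.

Section Coordinates.
Local Open Scope ring_scope.
Local Open Scope classical_set_scope.
Variable K : numFieldType.
Local Notation S := {mpoly K[7]}.
Local Notation B := {mpoly K[5]}.
Local Notation A := {mpoly B[2]}.

Definition coef (k : nat) : S := 'X_(inord k).

(** The ideal of the maximal minors of the syzygy matrix. *)
Definition minors_ideal : set S := [set bordered_det (syz_mx coef) w | w in setT].

Definition param (j : nat) : B := 'X_(inord j).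

(* The sextics whose coordinates a_2, a_3, a_4, a_5 - a_0, a_6 - a_1 vanish form
a pencil on which the maximal minors are primary to the origin. *)
Definition theta_coef (k : nat) : A :=
  match k with
  | 0 => 'X_0 | 1 => 'X_1
  | 2 => (param 0)%:MP | 3 => (param 1)%:MP | 4 => (param 2)%:MP
  | 5 => 'X_0 + (param 3)%:MP | _ => 'X_1 + (param 4)%:MP
  end.

(* Sealed, so that unification never unfolds the substitution. *)
Fact mmap_sig n (R T : comNzRingType) (f : {rmorphism R -> T}) (h : 'I_n -> T) :
  {g : {rmorphism {mpoly R[n]} -> T} |
    (forall c, g c%:MP = f c) & forall i, g 'X_i = h i}.
Proof.
by exists (mmap f h : {rmorphism _ -> _}) => [c|i] /=; rewrite ?mmapC ?mmapX ?mmap1U.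
Qed.

Definition mpoly_subst n (R T : comNzRingType) (f : {rmorphism R -> T})
  (h : 'I_n -> T) : {rmorphism {mpoly R[n]} -> T} := s2val (mmap_sig f h).

Lemma mpoly_substC n (R T : comNzRingType) (f : {rmorphism R -> T})
  (h : 'I_n -> T) c : mpoly_subst f h c%:MP = f c.
Proof. by rewrite /mpoly_subst; case: mmap_sig. Qed.

Lemma mpoly_substX n (R T : comNzRingType) (f : {rmorphism R -> T})
  (h : 'I_n -> T) i : mpoly_subst f h 'X_i = h i.
Proof. by rewrite /mpoly_subst; case: mmap_sig. Qed.

(** [S] as the ring of polynomials in [a_0] and [a_1] over the ring [B] of the five
parameters [a_2], [a_3], [a_4], [a_5 - a_0] and [a_6 - a_1]. *)
Definition theta : {rmorphism S -> A} :=
  mpoly_subst (@mpolyC 2 B \o @mpolyC 5 K) (fun i : 'I_7 => theta_coef i).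

Definition lin_param (j : nat) : S :=
  match j with
  | 0 => coef 2 | 1 => coef 3 | 2 => coef 4
  | 3 => coef 5 - coef 0 | _ => coef 6 - coef 1
  end.

Definition theta_inv : {rmorphism A -> S} :=
  mpoly_subst (mpoly_subst (@mpolyC 7 K) (fun j : 'I_5 => lin_param j))
    (fun i : 'I_2 => coef i).

Lemma theta_coefE k : (k < 7)%N -> theta (coef k) = theta_coef k.
Proof. by move=> k7; rewrite /theta /coef mpoly_substX inordK. Qed.

Lemma theta_const c : theta c%:MP = c%:MP%:MP.
Proof. by rewrite /theta mpoly_substC. Qed.

Lemma theta_inv_param j : (j < 5)%N -> theta_inv (param j)%:MP = lin_param j.
Proof.
by move=> j5; rewrite /theta_inv mpoly_substC /param mpoly_substX inordK.
Qed.

Lemma theta_inv_const c : theta_inv c%:MP%:MP = c%:MP.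
Proof. by rewrite /theta_inv !mpoly_substC. Qed.

Lemma theta_inv_var (i : 'I_2) : theta_inv 'X_i = coef i.
Proof. by rewrite /theta_inv mpoly_substX. Qed.

Lemma thetaK : cancel theta theta_inv.
Proof.
apply: (mpoly_rmorph_ext (f := theta_inv \o theta) (g := idfun)) => [c|i] /=.
  by rewrite theta_const theta_inv_const.
rewrite (_ : 'X_i = coef i) ?theta_coefE//; last by rewrite /coef inord_val.
move: (nat_of_ord i) (ltn_ord i) => [|[|[|[|[|[|[|//]]]]]]] _;
  rewrite /= ?rmorphD ?theta_inv_param ?theta_inv_var //=.
- by rewrite addrC subrK.
- by rewrite addrC subrK.
Qed.

Lemma theta_invK : cancel theta_inv theta.
Proof.
apply: (mpoly_rmorph_ext (f := theta \o theta_inv) (g := idfun)) => [c|i] /=; last first.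
  rewrite theta_inv_var theta_coefE ?(leq_trans (ltn_ord i))//.
  by case: i => -[|[|//]] i2 /=; congr 'X_(_); apply: val_inj.
apply: (mpoly_rmorph_ext (f := theta \o (theta_inv \o @mpolyC 2 B)) (g := @mpolyC 2 B))
  => [{}c|j] /=; first by rewrite theta_inv_const theta_const.
rewrite (_ : 'X_j = param j) ?theta_inv_param//; last by rewrite /param inord_val.
move: (nat_of_ord j) (ltn_ord j) => [|[|[|[|[|//]]]]] _;
  rewrite /= ?rmorphB ?theta_coefE //=.
- by rewrite addrAC subrr add0r.
- by rewrite addrAC subrr add0r.
Qed.

End Coordinates.

Arguments minors_ideal : clear implicits.

(** * Leading forms of the minors *)

Section MinorHomogeneity.
Local Open Scope ring_scope.
Variables (R : comNzRingType) (n : nat).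
Local Notation S := {mpoly R[n]}.

Lemma dhomog_eqdeg d e (p : S) : p \is d.-homog -> d = e -> p \is e.-homog.
Proof. by move=> hp <-. Qed.

Definition graded_cols k (m : nat -> nat -> S) (d : nat -> nat) :=
  forall i j, (i < k)%N -> (j < k)%N -> m i j \is (d j).-homog.

Lemma graded_cols_skip k m d j : graded_cols k.+1 m d ->
  graded_cols k (skip m j) (d \o jump j).
Proof.
by move=> hm i l ik lk; apply: hm => //; rewrite /jump; case: ifP => // _; apply: ltnW.
Qed.

Lemma det2_homog m d : graded_cols 2 m d -> det2 m \is (d 0 + d 1)%N.-homog.
Proof.
move=> hm; rewrite /det2; apply: rpredB; first by apply: dhomogM; apply: hm.
by apply: (dhomog_eqdeg (dhomogM (hm _ _ _ _) (hm _ _ _ _))); rewrite // addnC.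
Qed.

Lemma det3_homog m d : graded_cols 3 m d -> det3 m \is (d 0 + d 1 + d 2)%N.-homog.
Proof.
move=> hm; have h j := det2_homog (graded_cols_skip j hm).
rewrite /det3; apply: rpredD; first apply: rpredB;
  apply: (dhomog_eqdeg (dhomogM (hm _ _ _ _) (h _))); rewrite //= /jump /=; lia.
Qed.

Lemma det4_homog m d : graded_cols 4 m d ->
  det4 m \is (d 0 + d 1 + d 2 + d 3)%N.-homog.
Proof.
move=> hm; have h j := det3_homog (graded_cols_skip j hm).
rewrite /det4; apply: rpredB; first apply: rpredD; first apply: rpredB;
  apply: (dhomog_eqdeg (dhomogM (hm _ _ _ _) (h _))); rewrite //= /jump /=; lia.
Qed.

Variable a : nat -> S.
Hypothesis a1 : forall k, a k \is 1.-homog.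

Lemma nat_dhomog (k : nat) d (p : S) : p \is d.-homog -> (k%:R * p) \is d.-homog.
Proof. by move=> hp; rewrite mulr_natl rpredMn. Qed.

Lemma quartic_cov_homog k : quartic_cov a k \is 2.-homog.
Proof.
have aa i j : a i * a j \is 2.-homog by apply: (dhomogM (a1 i) (a1 j)).
have h (c : nat) i j : c%:R * a i * a j \is 2.-homog.
  by rewrite -mulrA; apply: nat_dhomog.
have h2 (c : nat) i : c%:R * a i ^+ 2 \is 2.-homog by apply: nat_dhomog; apply: aa.
by case: k => [|[|[|[|k]]]]; rewrite /quartic_cov; do ?apply: nat_dhomog;
  do ?[apply: rpredB|apply: rpredD]; do ?apply: nat_dhomog; rewrite ?h ?h2 ?aa.
Qed.

Lemma syz_entry_homog k j : syz_entry a k j \is (if (j < 3)%N then 1 else 2).-homog.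
Proof.
have hb k' l : bin4 S k' * a l \is 1.-homog.
  by case: k' => [|[|[|[|k']]]]; rewrite /bin4 ?mul1r//; apply: nat_dhomog.
case: j => [|[|[|j]]]; rewrite /syz_entry /=; [| |by []|exact: quartic_cov_homog].
- exact: hb.
- by rewrite rpredN.
Qed.

Lemma minor_homog k : minor a k \is 5.-homog.
Proof.
rewrite /minor -signr_odd; case: odd; rewrite ?expr0 ?expr1 ?mulN1r ?mul1r ?rpredN;
by apply: (det4_homog (d := fun j => if (j < 3)%N then 1%N else 2%N)) => i j _ _;
  apply: syz_entry_homog.
Qed.

End MinorHomogeneity.

Section LeadingForms.
Local Open Scope ring_scope.
Local Open Scope classical_set_scope.
Variable K : numFieldType.
Local Notation S := {mpoly K[7]}.
Local Notation B := {mpoly K[5]}.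
Local Notation A := {mpoly B[2]}.

(* The pencil of sextics on which the parameters vanish. *)
Definition pencil_coef (k : nat) : A :=
  match k with 0 => 'X_0 | 1 => 'X_1 | 5 => 'X_0 | 6 => 'X_1 | _ => 0 end.

Definition pencil : {rmorphism S -> A} :=
  mpoly_subst (@mpolyC 2 B \o @mpolyC 5 K) (fun i : 'I_7 => pencil_coef i).

Lemma pencil_coefE k : (k < 7)%N -> pencil (coef K k) = pencil_coef k.
Proof. by move=> k7; rewrite /pencil /coef mpoly_substX inordK. Qed.

Lemma pencil_const c : pencil c%:MP = c%:MP%:MP.
Proof. by rewrite /pencil mpoly_substC. Qed.

(* [p] and [p0] have degree at most [d] and the same part of degree [d]. *)
Definition top_part d (p p0 : A) :=
  [/\ (msize p <= d.+1)%N, (msize p0 <= d.+1)%N & (msize (p - p0)%R <= d)%N].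

Lemma top_partM d e p p0 q q0 : top_part d p p0 -> top_part e q q0 ->
  top_part (d + e) (p * q) (p0 * q0).
Proof.
move=> [p1 p2 p3] [q1 q2 q3]; split; try exact: msizeM_leR.
have -> : p * q - p0 * q0 = (p - p0) * q + (q - q0) * p0 by ring.
apply: leq_trans (msizeD_le _ _) _; rewrite geq_max msizeM_leR'//=.
by rewrite addnC msizeM_leR'.
Qed.

Lemma top_part1 : top_part 0 1 1.
Proof. by rewrite /top_part subrr msize1 msize0. Qed.

Lemma top_partX d p p0 k : top_part d p p0 -> top_part (d * k) (p ^+ k) (p0 ^+ k).
Proof.
move=> h; elim: k => [|k IH]; first by rewrite muln0 !expr0; apply: top_part1.
by rewrite !exprS mulnS; apply: top_partM.
Qed.

Lemma theta_coef_top k : (k < 7)%N -> top_part 1 (theta_coef K k) (pencil_coef k).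
Proof.
have X (i : 'I_2) : (msize ('X_i : A) <= 2)%N by rewrite msizeX mdeg1.
have C (b : B) : (msize (b%:MP : A) <= 1)%N by rewrite msizeC; case: eqP.
have XC (i : 'I_2) (b : B) : (msize ('X_i + b%:MP : A) <= 2)%N.
  by apply: leq_trans (msizeD_le _ _) _; rewrite geq_max X leqW.
have C0 (b : B) : top_part 1 (b%:MP : A) 0.
  by split; rewrite ?subr0 ?msize0 // leqW.
have XX (i : 'I_2) : top_part 1 ('X_i : A) 'X_i by split; rewrite ?subrr ?msize0.
have XB (i : 'I_2) (b : B) : top_part 1 ('X_i + b%:MP : A) 'X_i.
  by split=> //; rewrite addrAC subrr add0r.
move: k => [|[|[|[|[|[|[|//]]]]]]] _ /=.
- exact: XX.
- exact: XX.
- exact: C0.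
- exact: C0.
- exact: C0.
- exact: XB.
- exact: XB.
Qed.

Lemma thetaZ c p : theta K (c *: p) = c%:MP *: theta K p.
Proof. by rewrite -mul_mpolyC (rmorphM (theta K)) theta_const mul_mpolyC. Qed.

Lemma pencilZ c p : pencil (c *: p) = c%:MP *: pencil p.
Proof. by rewrite -mul_mpolyC (rmorphM pencil) pencil_const mul_mpolyC. Qed.

(** A form in the [a_k] has degree [d] in [a_0], [a_1] and the parameters together,
so the parameters only enter its terms of lower degree in [a_0] and [a_1]. *)
Lemma theta_top d f : f \is d.-homog -> (msize (theta K f - pencil f)%R <= d)%N.
Proof.
move=> /dhomogP hf; have -> : theta K f - pencil f =
    \sum_(m <- msupp f) (theta K (f@_m *: 'X_[m]) - pencil (f@_m *: 'X_[m])).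
  rewrite sumrB; congr (_ - _); rewrite -rmorph_sum -mpolyE //.
rewrite big_seq.
apply: (big_ind (fun p : A => (msize p <= d)%N)) => [|p q pd qd|m mf].
- by rewrite msize0.
- by apply: leq_trans (msizeD_le _ _) _; rewrite geq_max pd qd.
have /= md := hf _ mf.
rewrite thetaZ pencilZ -scalerBr.
apply: leq_trans (mmeasureZ_le _ _ _) _.
suff [] : top_part d (theta K 'X_[m]) (pencil 'X_[m]) by [].
rewrite mpolyXE_id !rmorph_prod -md mdegE.
apply: (big_ind3 (fun e p q => top_part e p q)); first exact: top_part1.
  by move=> d1 p1 q1 d2 p2 q2; apply: top_partM.
move=> i _; rewrite !rmorphXn -[X in top_part X]mul1n /=.
have iE : 'X_i = coef K i by rewrite /coef inord_val.
by rewrite iE /= theta_coefE// pencil_coefE//; apply/top_partX/theta_coef_top.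
Qed.

(* On the pencil the two combinations of minors below are a_0^6 and a_1^6. *)
Definition lead0_vec : 'cV[S]_5 := \col_k
  match val k with
  | 2 => - (8^-1)%:MP * coef K 0 | 3 => - (4^-1)%:MP * coef K 1 | _ => 0
  end.

Definition lead1_vec : 'cV[S]_5 := \col_k
  match val k with
  | 1 => (4^-1)%:MP * coef K 0 | 2 => (8^-1)%:MP * coef K 1 | _ => 0
  end.

Lemma coef_homog k : coef K k \is 1.-homog.
Proof. by rewrite dhomogX /= mdeg1. Qed.

Lemma lead_vec_homog (w : 'cV[S]_5) d : (forall k, w k 0 \is d.-homog) ->
  bordered_det (syz_mx (coef K)) w \is (d + 5).-homog.
Proof.
move=> hw; rewrite bordered_det_minor; apply: rpred_sum => k _.
by apply: dhomogM => //; apply: minor_homog; apply: coef_homog.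
Qed.

Lemma invC_mul (c : nat) : c%:R != 0 :> K -> ((c%:R)^-1)%:MP%:MP * c%:R = 1 :> A.
Proof.
by move=> c0; rewrite -[X in _ * X](rmorph_nat (@mpolyC 2 B \o @mpolyC 5 K)) -mpolyCM -mpolyCM mulVf.
Qed.

Lemma pencil_bordered w : pencil (bordered_det (syz_mx (coef K)) w) =
  \sum_(k < 5) pencil (w k 0) * minor pencil_coef k.
Proof.
rewrite bordered_det_morph (eq_syz_mx (b := pencil_coef)); last exact: pencil_coefE.
by rewrite bordered_det_minor; apply: eq_bigr => k _; rewrite mxE.
Qed.

Lemma pencil_minors :
  [/\ minor pencil_coef 1 = 4 * 'X_0 ^+ 4 * 'X_1,
      minor pencil_coef 2 = 8 * ('X_1 ^+ 5 - 'X_0 ^+ 5) &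
      minor pencil_coef 3 = - (4 * 'X_0 * 'X_1 ^+ 4)].
Proof.
rewrite /minor /det4 /det3 /det2 /skip /jump /syz_entry /bin4 /quartic_cov /=.
by split; ring.
Qed.

Lemma inv_nat_eq1 : ((8^-1)%:MP%:MP * 8%:R = 1 :> A) * ((4^-1)%:MP%:MP * 4%:R = 1 :> A).
Proof. by split; apply: invC_mul; rewrite pnatr_eq0. Qed.

(* The expansions of the two bordered determinants on the pencil. *)
Lemma lead0_expand (R : comNzRingType) (c8 c4 s t z0 z1 z4 : R) :
    c8 * 8 = 1 -> c4 * 4 = 1 ->
  0 * z0 + (0 * z1 + (- c8 * s * (8 * (t ^+ 5 - s ^+ 5)) +
    (- c4 * t * (- (4 * s * t ^+ 4)) + (0 * z4 + 0)))) = s ^+ 6.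
Proof.
move=> h8 h4; transitivity ((c8 * 8) * (s ^+ 6 - s * t ^+ 5) +
  (c4 * 4) * (s * t ^+ 5)); first by ring.
by rewrite h8 h4; ring.
Qed.

Lemma lead1_expand (R : comNzRingType) (c8 c4 s t z0 z3 z4 : R) :
    c8 * 8 = 1 -> c4 * 4 = 1 ->
  0 * z0 + (c4 * s * (4 * s ^+ 4 * t) + (c8 * t * (8 * (t ^+ 5 - s ^+ 5)) +
    (0 * z3 + (0 * z4 + 0)))) = t ^+ 6.
Proof.
move=> h8 h4; transitivity ((c8 * 8) * (t ^+ 6 - t * s ^+ 5) +
  (c4 * 4) * (t * s ^+ 5)); first by ring.
by rewrite h8 h4; ring.
Qed.

Lemma lead0_monic :
  monic_in 6 0 (theta K (bordered_det (syz_mx (coef K)) lead0_vec)).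
Proof.
rewrite /monic_in; set f := bordered_det _ _.
have <- : pencil f = 'X_0 ^+ 6; last first.
  apply: theta_top; apply: (@lead_vec_homog _ 1) => k; rewrite mxE.
  by move: (val k) => [|[|[|[|?]]]]; rewrite ?dhomog0 // -mpolyCN mul_mpolyC;
    apply: rpredZ; apply: coef_homog.
rewrite /f pencil_bordered !big_ord_recl big_ord0 !mxE /= !rmorph0.
rewrite !(rmorphM pencil) !rmorphN /= !pencil_const !pencil_coefE//.
have [_ m2 m3] := pencil_minors; rewrite -[bump 0 1]/2%N m2.
rewrite -[bump 0 (bump 0 (bump 0 0))]/3%N m3 /pencil_coef.
by apply: lead0_expand; rewrite inv_nat_eq1.
Qed.

Lemma lead1_monic :
  monic_in 6 1 (theta K (bordered_det (syz_mx (coef K)) lead1_vec)).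
Proof.
rewrite /monic_in; set f := bordered_det _ _.
have <- : pencil f = 'X_1 ^+ 6; last first.
  apply: theta_top; apply: (@lead_vec_homog _ 1) => k; rewrite mxE.
  by move: (val k) => [|[|[|?]]]; rewrite ?dhomog0 // mul_mpolyC;
    apply: rpredZ; apply: coef_homog.
rewrite /f pencil_bordered !big_ord_recl big_ord0 !mxE /= !rmorph0.
rewrite !(rmorphM pencil) /= !pencil_const !pencil_coefE//.
have [m1 m2 _] := pencil_minors; rewrite -[bump 0 1]/2%N m2.
rewrite -[bump 0 0]/1%N m1 /pencil_coef.
by apply: lead1_expand; rewrite inv_nat_eq1.
Qed.

End LeadingForms.

(** * Exactness, and torsion-freeness over the parameters *)

Section CohenMacaulayMinors.
Local Open Scope ring_scope.
Local Open Scope classical_set_scope.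
Variable K : numFieldType.
Local Notation S := {mpoly K[7]}.
Local Notation B := {mpoly K[5]}.
Local Notation A := {mpoly B[2]}.
Local Notation N := (syz_mx (coef K)).
Local Notation N' := (syz_mx (theta_coef K)).

Lemma theta_bordered w : theta K (bordered_det N w) =
  bordered_det N' (map_mx (theta K) w).
Proof.
rewrite bordered_det_morph (eq_syz_mx (b := theta_coef K))//.
exact: theta_coefE.
Qed.

Lemma theta_inv_bordered w : theta_inv K (bordered_det N' w) =
  bordered_det N (map_mx (theta_inv K) w).
Proof.
apply: (can_inj (@thetaK K)); rewrite theta_invK theta_bordered; congr bordered_det.
by apply/matrixP => i j; rewrite !mxE theta_invK.
Qed.

Lemma coef_ideal_add (q : set B) (b : B) (x : A) : ideal_set q ->
  coef_ideal [set y | exists c, q (y - b * c)] x <->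
  exists c, coef_ideal q (x - b%:MP * c).
Proof.
move=> hq; split=> [/choice[c cP]|[c cP] m]; last first.
  by exists c@_m; rewrite -mcoeffCM -mcoeffB.
exists (\sum_(m <- msupp x) c m *: 'X_[m]) => m.
rewrite mcoeffB mcoeffCM raddf_sum /=.
under eq_bigr do rewrite mcoeffZ mcoeffX.
case: (boolP (m \in msupp x)) => mx.
  rewrite (bigD1_seq m)//= ?msupp_uniq// eqxx mulr1 big1 ?addr0// => k /negPf ->.
  by rewrite mulr0.
rewrite memN_msupp_eq0// big_seq big1 ?mulr0 ?subrr; first by case: hq.
by move=> k kx; case: eqP => [km|]; rewrite ?mulr0//; rewrite -km kx in mx.
Qed.

(** A nonzerodivisor modulo an ideal of parameters remains one modulo the
maximal minors: their leading forms do not involve the parameters. *)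
Lemma param_nonzerodivisor (q : set B) (b : B) : ideal_set q ->
    (forall y, q (b * y) -> q y) ->
  forall x w, coef_ideal q (b%:MP * x - bordered_det N' w) ->
    exists w', coef_ideal q (x - bordered_det N' w').
Proof.
move=> hq nzd; have hQ := coef_ideal_ideal hq.
pose qb := [set y | exists c, q (y - b * c)].
have hqb : ideal_set qb.
  case: hq => q0 qD qM; split.
  - by exists 0; rewrite mulr0 subr0.
  - move=> y y' [c Qc] [c' Qc']; exists (c + c').
    by rewrite mulrDr opprD addrACA; apply: qD.
  - move=> a y [c Qc]; exists (a * c).
    by rewrite mulrCA -mulrBr; apply: qM.
have m0 := lead0_monic K; have m1 := lead1_monic K.
rewrite (theta_bordered (lead0_vec K)) in m0.
rewrite (theta_bordered (lead1_vec K)) in m1.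
apply: (nonzerodivisor_mod_minors (e1 := map_mx (theta K) (lead0_vec K))
  (e2 := map_mx (theta K) (lead1_vec K)) hQ).
- by move=> x Qx m; apply: nzd; rewrite -mcoeffCM; apply: Qx.
- move=> x /(coef_ideal_add _ _ hq) Qx; apply/(coef_ideal_add _ _ hq).
  exact: monic_nonzerodivisor hqb m0 Qx.
- move=> x y /(coef_ideal_add _ _ hq) Qxy.
  have [z Qz] := monic_pair_regular (i := 0) (j := 1) hqb isT m0 m1 Qxy.
  by exists z; apply/(coef_ideal_add _ _ hq).
Qed.

Lemma coef_ideal0 (x : A) : coef_ideal [set 0] x -> x = 0.
Proof. by move=> h; apply/mpolyP => m; rewrite mcoeff0; apply: h. Qed.

Lemma lead0_neq0 : bordered_det N (lead0_vec K) != 0.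
Proof.
apply/eqP => E; have := lead0_monic K; rewrite E rmorph0 /monic_in sub0r.
by rewrite mmeasureN mpolyXn msizeX mdegMn mdeg1 mul1n ltnn.
Qed.

Lemma minors_ideal_ideal : ideal_set (minors_ideal K).
Proof.
split.
- by exists 0; rewrite ?bordered_det0.
- by move=> _ _ [w _ <-] [w' _ <-]; exists (w + w'); rewrite ?bordered_detD.
- by move=> a _ [w _ <-]; exists (a *: w); rewrite ?bordered_detZ.
Qed.

(** A nonzero maximal minor makes the matrix injective. *)
Lemma syz_mx_inj (z : 'cV[S]_4) : N *m z = 0 -> z = 0.
Proof.
move=> Nz; apply/colP => j; rewrite mxE.
have := bordered_kernel (lead0_vec K) (@zero_ideal S) (N := N) (z := z).
rewrite Nz => /(_ _ j) H; apply/eqP.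
have : bordered_det N (lead0_vec K) * z j 0 == 0.
  by apply/eqP/H => k; rewrite mxE.
by rewrite mulf_eq0 (negPf lead0_neq0).
Qed.

(** Two of the combinations of minors are monic in [a_0] and in [a_1], hence form a
regular sequence. *)
Lemma syz_mx_exact (w : 'cV[S]_5) : bordered_det N w = 0 -> exists z, w = N *m z.
Proof.
move=> w0.
have [||z zP] := hilbert_burch_mod (e1 := lead0_vec K) (e2 := lead1_vec K)
  (@zero_ideal S) _ _ w0.
- by move=> x /eqP; rewrite mulf_eq0 (negPf lead0_neq0) => /eqP.
- move=> x y /= xy.
  have [|z /coef_ideal0 zE] := monic_pair_regular (i := 0) (j := 1) (@zero_ideal B) isT
      (lead0_monic K) (lead1_monic K) (x := theta K x) (y := theta K y).
    have := congr1 (theta K) xy; rewrite (rmorphB (theta K)) (rmorphM (theta K) _ x).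
    by rewrite (rmorphM (theta K) _ y) (rmorph0 (theta K)) => -> m; rewrite mcoeff0.
  exists (theta_inv K z); apply: (can_inj (@thetaK K)).
  by rewrite rmorph0 -[RHS]zE rmorphB rmorphM theta_invK.
exists z; apply/colP => k; apply/eqP; rewrite -subr_eq0.
by have /eqP := zP k; rewrite !mxE.
Qed.

(** A nonzero polynomial in the parameters is a nonzerodivisor modulo the zero ideal
of [B], and [param_nonzerodivisor] carries this over to the minors. *)
Lemma minors_torsion_free (b : B) (x : S) : b != 0 ->
  minors_ideal K (theta_inv K b%:MP * x) -> minors_ideal K x.
Proof.
move=> b0 [w _ wE].
have [||w' /coef_ideal0/eqP] := @param_nonzerodivisor [set 0] b (@zero_ideal B) _
    (theta K x) (map_mx (theta K) w).
- by move=> y /eqP; rewrite mulf_eq0 (negPf b0) => /eqP.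
- by move=> m; rewrite -theta_bordered wE rmorphM theta_invK subrr mcoeff0.
rewrite subr_eq0 => /eqP xE; exists (map_mx (theta_inv K) w') => //.
by rewrite -theta_inv_bordered -xE thetaK.
Qed.

End CohenMacaulayMinors.

(** * Nakayama's lemma for the fibres over the parameters *)

Section Nakayama.
Local Open Scope ring_scope.
Local Open Scope classical_set_scope.

Lemma ideal_congrM (T : comNzRingType) (L : set T) x x' y y' : ideal_set L ->
  L (x - x') -> L (y - y') -> L (x * y - x' * y').
Proof.
move=> hL Lx Ly; have [_ LD LM] := hL.
have -> : x * y - x' * y' = y * (x - x') + x' * (y - y') by ring.
by apply: LD; apply: LM.
Qed.

Lemma mpoly_rmorph_congr n (R T : comNzRingType) (L : set T)
    (f g : {rmorphism {mpoly R[n]} -> T}) : ideal_set L ->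
    (forall c, L (f c%:MP - g c%:MP)) -> (forall i, L (f 'X_i - g 'X_i)) ->
  forall p, L (f p - g p).
Proof.
move=> hL fC fX p; have [L0 LD LM] := hL.
rewrite [p]mpolyE !rmorph_sum -sumrB; apply: (big_ind L) => [//|u v|m _]; first exact: LD.
rewrite -mul_mpolyC !rmorphM; apply: ideal_congrM => //.
rewrite mpolyXE_id !rmorph_prod.
apply: (big_ind2 (fun x y => L (x - y))); first by rewrite subrr.
  by move=> x1 x2 y1 y2; apply: ideal_congrM.
move=> i _; rewrite !rmorphXn; elim: (m i) => [|k IH].
  by rewrite !expr0 subrr.
by rewrite !exprS; apply: ideal_congrM.
Qed.

Variable R : comNzRingType.
Local Notation A := {mpoly R[2]}.
Implicit Types (I : set A) (f g x : A).

Lemma reduce_monomial I n i f (m : 'X_{1..2}) d : ideal_set I -> I f ->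
    monic_in n i f -> (n <= m i)%N -> (mdeg m <= d)%N ->
  exists2 y, (msize y <= d)%N & I ('X_[m] - y).
Proof.
move=> hI If fi nm md; have [_ _ IM] := hI.
have km : (U_(i) *+ n <= m)%MM.
  apply/mnm_lepP => j; rewrite mulmnE mnm1E.
  by case: eqP => [<-|]; rewrite ?mul1n ?mul0n.
exists (- ((f - 'X_i ^+ n) * 'X_[m - U_(i) *+ n])).
  rewrite mmeasureN; apply: leq_trans md.
  have := congr1 (@mdeg 2) (submK km); rewrite mdegD mdegMn mdeg1 mul1n => <-.
  by rewrite addnC; apply: msizeM_leR'; rewrite ?msizeX.
rewrite opprK mulrBl mpolyXn -mpolyXD addrCA addmC submK// subrr addr0 mulrC.
exact: IM.
Qed.

(** Modulo polynomials with leading forms [X_0 ^ n] and [X_1 ^ n], everything is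
congruent to a polynomial of degree less than [2 n]. *)
Lemma reduce_degree I n f g : ideal_set I -> I f -> I g ->
    monic_in n 0 f -> monic_in n 1 g ->
  forall x, exists2 y, (msize y <= n + n)%N & I (x - y).
Proof.
move=> hI If Ig f0 g1 x; have [I0 ID IM] := hI.
have [d] := ubnP (msize x); elim: d x => // d IH x; rewrite ltnS => xd.
case: (leqP d (n + n)) => dn.
  by exists x; [apply: leq_trans dn|rewrite subrr].
have /choice[r rP] (m : 'X_{1..2}) : exists y : A, (mdeg m < d)%N ->
    (msize y < d)%N /\ I ('X_[m] - y).
  case: (ltnP (mdeg m) d) => md; last by exists 0.
  case: (ltnP (mdeg m).+1 d) => md'.
    by exists 'X_[m]; rewrite msizeX subrr md'.
  have [i [h [hi Ih nm]]] : exists i h, [/\ monic_in n i h, I h & (n <= m i)%N].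
    case: (leqP n (m 0)) => m0; first by exists 0, f.
    exists 1, g; split=> //; move: dn md' m0.
    rewrite mdegE big_ord_recl big_ord1 /= (_ : lift ord0 ord0 = 1); last exact: val_inj.
    move: (m 0) (m 1) => u v; lia.
  have [y yd Iy] := reduce_monomial hI Ih hi nm (leqnn _).
  by exists y => _; split=> //; apply: leq_ltn_trans yd md.
have xm m : m \in msupp x -> (mdeg m < d)%N.
  by move=> mx; apply: leq_trans (msize_mdeg_lt mx) xd.
pose x1 := \sum_(m <- msupp x) x@_m *: r m.
have x1d : (msize x1 < d)%N.
  rewrite /x1 big_seq; apply: (big_ind (fun p : A => (msize p < d)%N)).
  - by rewrite msize0; apply: leq_ltn_trans dn.
  - move=> p q pd qd; apply: leq_ltn_trans (msizeD_le _ _) _.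
    by rewrite gtn_max pd qd.
  - move=> m mx; apply: leq_ltn_trans (msizeZ_le _ _) _.
    by have [] := rP m (xm _ mx).
have [y yd Iy] := IH x1 x1d; exists y => //.
rewrite -(subrK x1 x) -addrA; apply: (ID) => //.
rewrite [X in X - _]mpolyE /x1 -sumrB big_seq.
apply: (big_ind I) => [|u v Iu Iv|m mx]; [exact: I0|exact: ID|]; rewrite -scalerBr -mul_mpolyC; apply: (IM).
by have [] := rP m (xm _ mx).
Qed.

(** Nakayama's lemma for the finite module [A / I] over the ring of parameters:
if the fibre of [A / I] over the point [ev] is empty, then [I] contains a
parameter that does not vanish at this point. *)
Lemma fibre_empty_param (F : comNzRingType) (ev : {rmorphism R -> F}) I n f g x :
    ideal_set I -> I f -> I g -> monic_in n 0 f -> monic_in n 1 g ->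
    I x -> coef_ideal [set y | ev y = 0] (1 - x) ->
  exists2 b, I b%:MP & ev b = 1.
Proof.
move=> hI If Ig f0 g1 Ix evx; have [I0 ID IM] := hI.
have hk : ideal_set [set y | ev y = 0].
  split=> [|y z|a y] /=; first by rewrite rmorph0.
    by rewrite rmorphD => -> ->; rewrite addr0.
  by rewrite rmorphM => ->; rewrite mulr0.
have [_ CD CM] := coef_ideal_ideal hk.
have /choice[r rP] (m : 'X_{1..2}) : exists y : A,
    (msize y <= n + n)%N /\ I ('X_[m] - y).
  by have [y yn Iy] := reduce_degree hI If Ig f0 g1 'X_[m]; exists y.
(* Modulo [I], multiplication by [1 - x] acts as the identity; [nu] is its matrix on
the monomials of bounded degree, and [det (1 - nu)] annihilates [1]. *)
pose T : finType := 'X_{1..2 < (n + n).+1}.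
pose mon (k : 'I_#|T|) : 'X_{1..2} := val (enum_val k).
pose nu : 'M[R]_#|T| := \matrix_(j, k)
  \sum_(m <- msupp ('X_[mon j] * (1 - x))) ('X_[mon j] * (1 - x))@_m * (r m)@_(mon k).
have nu0 j k : ev (nu j k) = 0.
  rewrite mxE; have := CM 'X_[mon j] _ evx => h.
  rewrite rmorph_sum big1// => m _; rewrite rmorphM.
  by have /= -> := h m; rewrite mul0r.
have nuE j : I ('X_[mon j] - \sum_k nu j k *: 'X_[mon k]).
  have rE m : r m = \sum_k (r m)@_(mon k) *: 'X_[mon k].
    have [rn _] := rP m.
    rewrite {1}(mpolywE (k := (n + n).+1) (p := r m)); last exact: leqW.
    by rewrite (reindex_onto (@enum_val T T) enum_rank) => [|i _];
      [apply: eq_big => i; rewrite ?enum_valK ?eqxx//|rewrite enum_rankK].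
  have -> : \sum_k nu j k *: 'X_[mon k] =
      \sum_(m <- msupp ('X_[mon j] * (1 - x))) ('X_[mon j] * (1 - x))@_m *: r m.
    under eq_bigr do rewrite mxE scaler_suml.
    rewrite exchange_big; apply: eq_bigr => m _.
    rewrite [in RHS]rE scaler_sumr; apply: eq_bigr => k _; by rewrite scalerA.
  rewrite [X in I (X - _)](_ : _ = 'X_[mon j] * x + 'X_[mon j] * (1 - x)); last by ring.
  rewrite -addrA; apply: (ID); first exact: (IM).
  rewrite [X in X - _]mpolyE -sumrB.
  apply: (big_ind I) => [|u w Iu Iw|m _]; [exact: I0|exact: ID|]; rewrite -scalerBr -mul_mpolyC; apply: (IM).
  by have [] := rP m.
pose D : 'M[R]_#|T| := 1%:M - nu.
have DE i j : D i j = (i == j)%:R - nu i j.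
  by rewrite [LHS]mxE [X in X + _]mxE [X in _ + X]mxE.
exists (\det D); last first.
  rewrite -det_map_mx (_ : map_mx ev D = 1%:M) ?det1//.
  apply/matrixP => i j; rewrite !mxE rmorphB -[X in _ - X]/(ev _).
  have := nu0 i j; rewrite mxE => ->; rewrite subr0.
  by case: (i == j); rewrite ?rmorph1 ?rmorph0.
pose k0 : 'I_#|T| := enum_rank (@bm0 2 (n + n)).
pose D' := map_mx (@mpolyC 2 R) D; pose v : 'cV[A]_#|T| := \col_k 'X_[mon k].
have Dv k : I ((D' *m v) k 0).
  rewrite mxE (_ : \sum_j _ = 'X_[mon k] - \sum_j nu k j *: 'X_[mon j]) //.
  under eq_bigr do rewrite [v _ _]mxE mxE DE mpolyCB mulrBl mul_mpolyC.
  rewrite sumrB; congr (_ - _); last by under eq_bigr do rewrite mul_mpolyC.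
  rewrite (bigD1 k)//= eqxx scale1r big1 ?addr0// => i ik.
  by rewrite eq_sym (negPf ik) scale0r.
have : \adj D' *m (D' *m v) = (\det D)%:MP *: v.
  by rewrite mulmxA mul_adj_mx mul_scalar_mx det_map_mx.
move/matrixP => /(_ k0 0); rewrite [RHS]mxE [v _ _]mxE.
rewrite {2}/k0 /mon enum_rankK /= mpolyX0 mulr1 => <-.
by rewrite mxE; apply: ideal_sum => // k; apply: IM.
Qed.
End Nakayama.

(** * The regular sequence of shifted parameters *)

Section PreimageIdeal.
Local Open Scope ring_scope.
Local Open Scope classical_set_scope.

Lemma minors_preim_ideal (R1 R2 : comNzRingType) (phi : {rmorphism R1 -> R2}) n
    (M : 'M[R2]_(n.+1, n)) (L : set R2) : ideal_set L ->
  ideal_set [set y | exists w, L (phi y - bordered_det M w)].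
Proof.
case=> L0 LD LM; split.
- by exists 0; rewrite rmorph0 bordered_det0 subr0.
- move=> y z [w Hw] [w' Hw']; exists (w + w').
  by rewrite rmorphD bordered_detD opprD addrACA; apply: LD.
- move=> a y [w Hw]; exists (phi a *: w).
  by rewrite rmorphM bordered_detZ -mulrBr; apply: LM.
Qed.

Lemma ideal_sub_congr (R1 R2 : comNzRingType) (g : {rmorphism R2 -> R1})
    (L : set R1) x u b : ideal_set L -> x = g (u + b) -> L (g b) -> L (g u) -> L x.
Proof. by move=> [_ LD _] -> Lb Lu; rewrite rmorphD; apply: LD. Qed.

Lemma ideal_mpoly_image n (R T : comNzRingType) (g : {rmorphism {mpoly R[n]} -> T})
    (L : set T) u : ideal_set L -> (forall m, L (g (u@_m)%:MP)) -> L (g u).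
Proof.
move=> hL gu; have [L0 LD LM] := hL.
rewrite [u]mpolyE rmorph_sum; apply: (big_ind L) => [|y z Ly Lz|m _].
- exact: L0.
- exact: LD.
- by rewrite -mul_mpolyC rmorphM mulrC; apply: LM.
Qed.

End PreimageIdeal.

Section RegularSequence.
Local Open Scope ring_scope.
Local Open Scope classical_set_scope.
Variable K : numFieldType.
Local Notation S := {mpoly K[7]}.
Local Notation B := {mpoly K[5]}.
Local Notation A := {mpoly B[2]}.
Local Notation N' := (syz_mx (theta_coef K)).
Variable c : nat -> K.

Definition fibre_seq : seq S := [seq lin_param K j - (c j)%:MP | j <- iota 0 5].

Lemma nth_fibre_seq i : (i < 5)%N -> fibre_seq`_i = lin_param K i - (c i)%:MP.
Proof. by move=> i5; rewrite (nth_map 0%N) ?size_iota// nth_iota. Qed.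

Lemma theta_fibre j : (j < 5)%N ->
  theta K (lin_param K j - (c j)%:MP) = (param K j - (c j)%:MP)%:MP.
Proof.
move=> j5; apply: (can_inj (@theta_invK K)).
by rewrite thetaK mpolyCB rmorphB theta_inv_param// theta_inv_const.
Qed.

(* Evaluates the first [i] parameters at [c]. *)
Definition partial_ev (i : nat) : {rmorphism B -> B} :=
  mpoly_subst (@mpolyC 5 K)
    (fun j : 'I_5 => if (j < i)%N then (c j)%:MP else 'X_j).

Lemma partial_ev_param i j : (j < 5)%N ->
  partial_ev i (param K j) = if (j < i)%N then (c j)%:MP else param K j.
Proof. by move=> j5; rewrite /partial_ev /param mpoly_substX inordK. Qed.

Lemma partial_ev_const i a : partial_ev i a%:MP = a%:MP.
Proof. by rewrite /partial_ev mpoly_substC. Qed.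

Definition partial_ker i : set B := [set y | partial_ev i y = 0].

Lemma partial_ker_ideal i : ideal_set (partial_ker i).
Proof.
rewrite /partial_ker; split=> [|y z|a y] /=; first by rewrite rmorph0.
  by rewrite rmorphD => -> ->; rewrite addr0.
by rewrite rmorphM => ->; rewrite mulr0.
Qed.

Lemma take_fibre i j : (i <= 5)%N -> (j < i)%N ->
  lin_param K j - (c j)%:MP \in take i fibre_seq.
Proof.
move=> i5 ji; have j5 := leq_trans ji i5; rewrite -nth_fibre_seq//.
by rewrite -(nth_take _ ji) mem_nth// size_take size_map size_iota; case: ifP.
Qed.

Lemma take_fibreP i x : (i <= 5)%N -> x \in take i fibre_seq ->
  exists2 j, (j < i)%N & x = lin_param K j - (c j)%:MP.
Proof.
move=> i5; rewrite /fibre_seq -map_take take_iota => /mapP[j].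
by rewrite mem_iota /= add0n => ji ->; exists j => //; apply: leq_trans ji (geq_minl _ _).
Qed.

(** Modulo the first [i] shifted parameters these parameters may be replaced by
their values. *)
Lemma fibre_idealE i x : (i <= 5)%N ->
  ideal_add (minors_ideal K) (take i fibre_seq) x <->
  exists w, coef_ideal (partial_ker i) (theta K x - bordered_det N' w).
Proof.
move=> i5; have hI := minors_ideal_ideal K.
have hC := coef_ideal_ideal (partial_ker_ideal i); have [C0 CD CM] := hC.
split.
  pose P := [set y : S | exists w, coef_ideal (partial_ker i)
    (theta K y - bordered_det N' w)].
  have hP : ideal_set P.
    exact: minors_preim_ideal.
  apply: (ideal_add_sub hP) => [_ [w _ <-]|y /(take_fibreP i5)[j ji ->]].
    by exists (map_mx (theta K) w); rewrite theta_bordered subrr.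
  exists 0; rewrite bordered_det0 subr0.
  have j5 := leq_trans ji i5; rewrite theta_fibre// => m.
  rewrite mcoeffC /partial_ker /= rmorphM rmorphB partial_ev_const.
  by rewrite partial_ev_param// ji subrr mul0r.
case=> w Hw; pose L := ideal_add (minors_ideal K) (take i fibre_seq).
have hL : ideal_set L by apply: ideal_add_ideal. have [L0 LD LM] := hL.
have ev_L (p : B) : L (theta_inv K p%:MP - theta_inv K (partial_ev i p)%:MP).
  apply: (mpoly_rmorph_congr (f := theta_inv K \o @mpolyC 2 B)
    (g := theta_inv K \o (@mpolyC 2 B \o partial_ev i)) hL) => [a|j] /=.
    by rewrite partial_ev_const subrr.
  have -> : 'X_j = param K j by rewrite /param inord_val.
  rewrite partial_ev_param//; case: ifP => ji; last by rewrite subrr.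
  rewrite theta_inv_param// theta_inv_const; apply: ideal_add_mem => //.
  exact: take_fibre.
apply: (ideal_sub_congr (g := theta_inv K) (b := bordered_det N' w)
  (u := theta K x - bordered_det N' w) hL).
- by rewrite subrK thetaK.
- rewrite theta_inv_bordered; apply: ideal_add_base => //.
  by exists (map_mx (theta_inv K) w).
apply: ideal_mpoly_image => // m; have := ev_L (theta K x - bordered_det N' w)@_m.
by have /= -> := Hw m; rewrite mpolyC0 (rmorph0 (theta_inv K)) subr0.
Qed.

(** Each shifted parameter is a nonzerodivisor in the ring of parameters modulo the
preceding ones, and [param_nonzerodivisor] carries this over to the minors. *)
Lemma fibre_seq_regular i : (i < size fibre_seq)%N -> forall x,
  ideal_add (minors_ideal K) (take i fibre_seq) (fibre_seq`_i * x) ->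
  ideal_add (minors_ideal K) (take i fibre_seq) x.
Proof.
rewrite size_map size_iota => i5 x.
rewrite nth_fibre_seq// => /(fibre_idealE _ (ltnW i5))[w].
rewrite (rmorphM (theta K)) theta_fibre// => Hw; apply/(fibre_idealE _ (ltnW i5)).
apply: param_nonzerodivisor Hw; first exact: partial_ker_ideal.
move=> y; rewrite /partial_ker /= rmorphM rmorphB partial_ev_param// ltnn.
rewrite partial_ev_const => /eqP.
rewrite mulf_eq0 subr_eq0 => /orP[/eqP E|/eqP//].
have := congr1 (mcoeff U_(inord i)) E; rewrite mcoeffXU mcoeffC eqxx.
by rewrite mnm1_eq0 mulr0 => /eqP; rewrite oner_eq0.
Qed.

End RegularSequence.

(** * Cones and their vanishing ideals *)

Section InfiniteField.
Local Open Scope ring_scope.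
Variable K : numFieldType.

Lemma poly_eval0 (p : {poly K}) : (forall x, x != 0 -> p.[x] = 0) -> p = 0.
Proof.
move=> p0; apply/eqP; apply: contraT => pn0.
have := max_poly_roots (rs := [seq (i.+1)%:R | i <- iota 0 (size p)]) pn0.
rewrite size_map size_iota ltnn; apply.
  by apply/allP => _ /mapP[i _ ->]; apply/eqP/p0; rewrite pnatr_eq0.
rewrite map_inj_uniq ?iota_uniq// => i j /eqP.
by rewrite eqr_nat => /eqP[].
Qed.

Definition split_last n : {rmorphism {mpoly K[n.+1]} -> {poly {mpoly K[n]}}} :=
  mpoly_subst (@polyC _ \o @mpolyC n K)
    (fun i => if unlift ord_max i is Some j then ('X_j)%:P else 'X).

Definition widen_last n : {rmorphism {mpoly K[n]} -> {mpoly K[n.+1]}} :=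
  mpoly_subst (@mpolyC n.+1 K) (fun j => 'X_(lift ord_max j)).

Lemma split_lastK n : injective (@split_last n).
Proof.
apply: (can_inj (g := horner_eval 'X_ord_max \o map_poly (widen_last n))).
apply: (mpoly_rmorph_ext (f := (horner_eval 'X_ord_max \o map_poly (widen_last n))
  \o split_last n) (g := idfun)) => [c|i] /=.
  rewrite /split_last mpoly_substC /= map_polyC /= /horner_eval hornerC.
  by rewrite /widen_last mpoly_substC.
rewrite /split_last mpoly_substX /horner_eval; case: unliftP => [j ->|->].
  by rewrite map_polyC hornerC /= /widen_last mpoly_substX.
by rewrite map_polyX hornerX.
Qed.

Lemma split_last_eval n (p : {mpoly K[n.+1]}) (v : 'I_n.+1 -> K) :
  p.@[v] = (map_poly (meval (fun j => v (lift ord_max j))) (split_last n p)).[v ord_max].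
Proof.
apply: (mpoly_rmorph_ext (f := meval v)
  (g := (horner_eval (v ord_max) \o map_poly (meval (fun j => v (lift ord_max j))))
        \o split_last n)) => [c|i] /=.
  by rewrite /split_last mpoly_substC /= map_polyC /= /horner_eval hornerC !mevalC.
rewrite mevalXU /split_last mpoly_substX /horner_eval; case: unliftP => [j ->|->].
  by rewrite map_polyC hornerC /= mevalXU.
by rewrite map_polyX hornerX.
Qed.

Lemma mpoly_eval0 n (p : {mpoly K[n]}) : (forall v, p.@[v] = 0) -> p = 0.
Proof.
elim: n p => [|n IH] p p0.
  by have := p0 (fun=> 0); rewrite [p]nvar0_mpolyC mevalC => ->; rewrite mpolyC0.
apply: (@split_lastK n); rewrite rmorph0; apply/polyP => i; rewrite coef0.
apply: IH => v.
suff /polyP /(_ i) : map_poly (meval v) (split_last n p) = 0.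
  by rewrite coef_map coef0.
apply: poly_eval0 => x _.
pose w (k : 'I_n.+1) := if unlift ord_max k is Some j then v j else x.
have := p0 w; rewrite split_last_eval.
rewrite (_ : w ord_max = x); last by rewrite /w unlift_none.
rewrite (_ : (fun _ => _) = v) //; apply/funext => j.
by rewrite /w liftK.
Qed.

Lemma mpoly_eval_generic n (p D : {mpoly K[n]}) : D != 0 ->
  (forall v, D.@[v] != 0 -> p.@[v] = 0) -> p = 0.
Proof.
move=> D0 pD; have : D * p = 0.
  apply: mpoly_eval0 => v; rewrite mevalM; have [->|/pD ->] := eqVneq D.@[v] 0.
    by rewrite mul0r.
  by rewrite mulr0.
by move/eqP; rewrite mulf_eq0 (negPf D0) => /eqP.
Qed.

End InfiniteField.

Section ProjectiveVarieties.
Local Open Scope ring_scope.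
Local Open Scope classical_set_scope.
Variable K : numFieldType.
Local Notation S := {mpoly K[7]}.
Local Notation coords := {ffun 'I_7 -> K}.
Implicit Types (Z T : set coords) (f g : S) (v : coords).

Definition vscale (c : K) v : coords := [ffun i => c * v i].

Definition cone Z := forall c v, c != 0 -> Z v -> Z (vscale c v).

Definition vanishing Z : set S := [set f | forall v, Z v -> f.@[v] = 0].

Lemma vanishing_ideal Z : ideal_set (vanishing Z).
Proof.
split=> [v _|f g hf hg v Zv|g f hf v Zv]; first exact: meval0.
  by rewrite mevalD hf// hg// addr0.
by rewrite mevalM hf// mulr0.
Qed.

Lemma dhomog_vscale d f c v : f \is d.-homog -> f.@[vscale c v] = c ^+ d * f.@[v].
Proof.
move=> /dhomogP hf; rewrite !mevalE mulr_sumr big_seq [RHS]big_seq.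
apply: eq_bigr => m /hf /= <-; rewrite mulrCA; congr (_ * _).
rewrite mdegE -prodrXr -big_split; apply: eq_bigr => i _.
by rewrite /vscale ffunE exprMn.
Qed.

(* The restriction of [f] to the line through [v]. *)
Definition line_poly f v : {poly K} :=
  \poly_(d < msize f) (pihomog mdeg d f).@[v].

Lemma line_polyE f v c : (line_poly f v).[c] = f.@[vscale c v].
Proof.
have fE : f = \sum_(d < msize f) pihomog mdeg d f by exact: pihomog_partitionE.
rewrite horner_poly [X in _ = X.@[_]]fE (raddf_sum (meval (vscale c v))).
apply: eq_bigr => d _ /=; rewrite (@dhomog_vscale d) 1?mulrC//.
exact: pihomogP.
Qed.

Lemma pihomog_large f d : (msize f <= d)%N -> pihomog mdeg d f = 0.
Proof.
move=> fd; rewrite pihomogE big_seq_cond big1// => m /andP[mf /eqP md].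
by have := msize_mdeg_lt mf; rewrite ltnNge -md in fd *; rewrite fd.
Qed.

Lemma line_poly_eq0 f v : line_poly f v = 0 <->
  forall d, (pihomog mdeg d f).@[v] = 0.
Proof.
split=> [/polyP h d|h]; last by apply/polyP => d; rewrite coef_poly coef0 h if_same.
have := h d; rewrite coef_poly coef0; case: ltnP => // fd _.
by rewrite pihomog_large// meval0.
Qed.

(** On the line through a point of the cone, [f] is a polynomial whose coefficients
are the values of its homogeneous components. *)
Lemma cone_vanishing Z f v : cone Z -> vanishing Z f -> Z v ->
  forall d, (pihomog mdeg d f).@[v] = 0.
Proof.
move=> cZ hf Zv; apply/line_poly_eq0; apply: poly_eval0 => c c0.
by rewrite line_polyE; apply/hf/cZ.
Qed.

Lemma vscale1 v : vscale 1 v = v.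
Proof. by apply/ffunP => i; rewrite ffunE mul1r. Qed.

Lemma proj_ideal_cone Z : cone Z -> proj_ideal Z = vanishing Z.
Proof.
move=> cZ; apply/seteqP; split=> [f hf v Zv|f hf d v Zv].
  have /line_poly_eq0 f0 d := hf d v Zv.
  by rewrite -[v]vscale1 -line_polyE f0 horner0.
exact: cone_vanishing cZ hf Zv d.
Qed.

Lemma proj_closed_cone Z : proj_closed Z -> cone Z.
Proof.
move=> [E [hE ->]] c v c0 [v0 vE]; split.
  apply: contra_neq v0 => /ffunP v0; apply/ffunP => i.
  have /eqP := v0 i; rewrite !ffunE mulf_eq0 (negPf c0) => /eqP ->.
  by [].
move=> f Ef; have [d fd] := hE _ Ef.
by rewrite (dhomog_vscale _ _ fd) vE// mulr0.
Qed.

Lemma proj_closed_sub Z Z' : proj_closed Z' -> (forall v, Z v -> v != 0) ->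
  vanishing Z' `<=` vanishing Z -> Z `<=` Z'.
Proof.
move=> [E [hE ->]] Z0 sub v Zv; split; first exact: Z0.
by move=> f Ef; apply: (sub f) => // w [_]; apply.
Qed.

Lemma proj_closed_neq0 Z v : proj_closed Z -> Z v -> v != 0.
Proof. by move=> [E [_ ->]] []. Qed.

(** If [f] and [g] do not vanish on [Z], then neither do some homogeneous components
of theirs, whose zero sets are closed and cover [Z] when [f g] vanishes on it. *)
Lemma variety_prime Z : proj_variety Z -> prime_set (vanishing Z).
Proof.
move=> [clZ [[v0 Zv0] irr]]; have cZ := proj_closed_cone clZ.
split; first exact: vanishing_ideal.
  by move/(_ _ Zv0)/eqP; rewrite meval1 oner_eq0.
move=> f g fg; apply: contrapT => /not_orP[nf ng].
have ex h : ~ vanishing Z h ->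
    exists d, ~ vanishing Z (pihomog mdeg d h).
  move=> nh; apply: contrapT => /forallNP nd; apply: nh => v Zv.
  have /line_poly_eq0 h0 d : (pihomog mdeg d h).@[v] = 0.
    by have /contrapT := nd d; apply.
  by rewrite -[v]vscale1 -line_polyE h0 horner0.
have [d nd] := ex _ nf; have [e ne] := ex _ ng.
pose V h := proj_zeros [set h : S].
have clV k h : proj_closed (V (pihomog mdeg k h)).
  by exists [set pihomog mdeg k h]; split=> // _ ->; exists k; apply: pihomogP.
have [|sub|sub] := irr _ _ (clV d f) (clV e g); last first.
- by apply: ne => v /sub[_]; apply.
- by apply: nd => v /sub[_]; apply.
move=> v Zv; have v0' := proj_closed_neq0 clZ Zv.
have : line_poly f v * line_poly g v = 0.
  apply: poly_eval0 => c c0; rewrite hornerM !line_polyE -mevalM.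
  exact/fg/cZ.
move/eqP; rewrite mulf_eq0 => /orP[/eqP/line_poly_eq0 h|/eqP/line_poly_eq0 h].
- by left; split=> // _ ->.
- by right; split=> // _ ->.
Qed.

Section Closure.
Variable T : set coords.
Hypotheses (T0 : forall v, T v -> v != 0) (cT : cone T).

Lemma zariski_closureE v : zariski_closure T v <->
  v != 0 /\ forall f, vanishing T f -> f.@[v] = 0.
Proof.
split=> [h|[v0 vf] Z clZ TZ].
  have [||v0 vf] := h (proj_zeros [set f | vanishing T f /\ exists d, f \is d.-homog]).
  - exists [set f | vanishing T f /\ exists d, f \is d.-homog]; split=> // f [].
    by [].
  - by move=> w Tw; split; [apply: T0|move=> f [fT _]; apply: fT].
  split=> // f fT; have /line_poly_eq0 f0 d : (pihomog mdeg d f).@[v] = 0.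
    apply: vf; split; last by exists d; apply: pihomogP.
    by move=> w Tw; apply: cone_vanishing fT Tw d.
  by rewrite -[v]vscale1 -line_polyE f0 horner0.
case: clZ TZ => E [hE ->] TZ; split=> // f Ef.
by apply: vf => w /TZ[_]; apply.
Qed.

Lemma sub_closure : T `<=` zariski_closure T.
Proof. by move=> v Tv Z _; apply. Qed.

Lemma closure_vanishing : vanishing (zariski_closure T) = vanishing T.
Proof.
apply/seteqP; split=> f hf v; first by move/sub_closure; apply: hf.
by move=> /zariski_closureE[_]; apply.
Qed.

Lemma closure_closed : proj_closed (zariski_closure T).
Proof.
exists [set f | vanishing T f /\ exists d, f \is d.-homog]; split=> [f []//|].
apply/seteqP; split=> v.
  by move=> /zariski_closureE[v0 vf]; split=> // f [/vf].
move=> [v0 vf] Z clZ TZ; case: clZ TZ => E [hE ->] TZ; split=> // f Ef.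
by apply: vf; split; [move=> w /TZ[_]; apply|apply: hE].
Qed.

Variables (n : nat) (psi : 'I_7 -> {mpoly K[n]}) (D : {mpoly K[n]}).
Hypotheses (D0 : D != 0)
  (generic : forall e, D.@[e] != 0 -> T [ffun i => (psi i).@[e]])
  (covered : forall v, T v -> exists e, v = [ffun i => (psi i).@[e]]).

(** Evaluation of [f] on the image is evaluation of the composite, which is
determined by its values where [D] does not vanish. *)
Lemma vanishing_image f : vanishing T f <-> f \mPo [tuple psi i | i < 7] = 0.
Proof.
have fE e : (f \mPo [tuple psi i | i < 7]).@[e] = f.@[[ffun i => (psi i).@[e]]].
  by rewrite comp_mpoly_meval; apply: meval_eq => i; rewrite ffunE tnth_mktuple.
split=> [fT|f0 v /covered[e ->]]; last by rewrite -fE f0 meval0.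
by apply: (mpoly_eval_generic D0) => e De; rewrite fE; apply/fT/generic.
Qed.

(** The polynomials vanishing on the image of a polynomial map form the kernel of a
ring morphism into a domain. *)
Lemma image_closure_variety : proj_variety (zariski_closure T).
Proof.
split; first exact: closure_closed.
have [e De] : exists e, D.@[e] != 0.
  apply: contrapT => /forallNP nD; case/eqP: D0; apply: mpoly_eval0 => e.
  by apply/eqP; rewrite -[_ == _]negbK; apply/negP; apply: nD.
split; first by exists [ffun i => (psi i).@[e]]; apply: sub_closure; apply: generic.
move=> Z1 Z2 [E1 [h1 ->]] [E2 [h2 ->]] sub.
apply: contrapT => /not_orP[n1 n2].
have ex E : ~ (zariski_closure T `<=` proj_zeros E) ->
    exists2 f, E f & ~ vanishing T f.
  move=> nE; apply: contrapT => nf; apply: nE => v /zariski_closureE[v0 vf].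
  by split=> // f Ef; apply: vf; apply: contrapT => nv; apply: nf; exists f.
have [f Ef nf] := ex _ n1; have [g Eg ng] := ex _ n2.
have : vanishing T (f * g).
  move=> v Tv; rewrite mevalM; have [[_ h]|[_ h]] := sub v (sub_closure Tv).
    by rewrite h ?mul0r.
  by rewrite [X in _ * X]h ?mulr0.
move/vanishing_image; rewrite rmorphM => /eqP; rewrite mulf_eq0.
by case/orP => /eqP/vanishing_image.
Qed.

End Closure.

End ProjectiveVarieties.

(** * Binary sextics spanned by u^6, u^3 v^3 and v^6 *)

Section CubePencil.
Local Open Scope ring_scope.
Variable R : comNzRingType.
Implicit Types al be ga u v : R.

(** The binomial coordinates of [al u ^ 6 + 20 be u ^ 3 v ^ 3 + ga v ^ 6] for the
linear forms [u = u1 x_1 + u2 x_2] and [v = v1 x_1 + v2 x_2]. *)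
Definition sext al be ga u1 u2 v1 v2 (k : nat) : R :=
  match k with
  | 0 => al * u1 ^+ 6 + be * (20 * u1 ^+ 3 * v1 ^+ 3) + ga * v1 ^+ 6
  | 1 => al * u1 ^+ 5 * u2 + be * (10 * u1 ^+ 2 * v1 ^+ 2 * (u1 * v2 + u2 * v1))
         + ga * v1 ^+ 5 * v2
  | 2 => al * u1 ^+ 4 * u2 ^+ 2 + be * (4 * (u1 * u2 ^+ 2 * v1 ^+ 3
         + 3 * u1 ^+ 2 * u2 * v1 ^+ 2 * v2 + u1 ^+ 3 * v1 * v2 ^+ 2))
         + ga * v1 ^+ 4 * v2 ^+ 2
  | 3 => al * u1 ^+ 3 * u2 ^+ 3 + be * (u2 ^+ 3 * v1 ^+ 3
         + 9 * u1 * u2 ^+ 2 * v1 ^+ 2 * v2 + 9 * u1 ^+ 2 * u2 * v1 * v2 ^+ 2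
         + u1 ^+ 3 * v2 ^+ 3) + ga * v1 ^+ 3 * v2 ^+ 3
  | 4 => al * u1 ^+ 2 * u2 ^+ 4 + be * (4 * (u1 ^+ 2 * u2 * v2 ^+ 3
         + 3 * u1 * u2 ^+ 2 * v1 * v2 ^+ 2 + u2 ^+ 3 * v1 ^+ 2 * v2))
         + ga * v1 ^+ 2 * v2 ^+ 4
  | 5 => al * u1 * u2 ^+ 5 + be * (10 * u2 ^+ 2 * v2 ^+ 2 * (u1 * v2 + u2 * v1))
         + ga * v1 * v2 ^+ 5
  | _ => al * u2 ^+ 6 + be * (20 * u2 ^+ 3 * v2 ^+ 3) + ga * v2 ^+ 6
  end.

Lemma sext_form al be ga u1 u2 v1 v2 (x y : R) :
  al * (u1 * x + u2 * y) ^+ 6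
  + 20 * be * (u1 * x + u2 * y) ^+ 3 * (v1 * x + v2 * y) ^+ 3
  + ga * (v1 * x + v2 * y) ^+ 6 =
  \sum_(k < 7) 'C(6, k)%:R * sext al be ga u1 u2 v1 v2 k * (x ^+ (6 - k) * y ^+ k).
Proof.
rewrite !big_ord_recl big_ord0 /= /bump /= /sext.
rewrite -[(1 + 0)%N]/1%N -[(1 + 1)%N]/2%N -[(1 + 2)%N]/3%N -[(1 + 3)%N]/4%N
  -[(1 + 4)%N]/5%N -[(1 + 5)%N]/6%N.
rewrite -[('C(6, 0))]/1%N -[('C(6, 1))]/6%N -[('C(6, 2))]/15%N -[('C(6, 3))]/20%N
   -[('C(6, 4))]/15%N -[('C(6, 5))]/6%N -[('C(6, 6))]/1%N.
rewrite -[(6 - 0)%N]/6%N -[(6 - 1)%N]/5%N -[(6 - 2)%N]/4%N -[(6 - 3)%N]/3%N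
  -[(6 - 4)%N]/2%N -[(6 - 5)%N]/1%N -[(6 - 6)%N]/0%N.
ring.
Qed.

(** In the coordinates [u] and [v], the transvectants of the form with [u v] and with
itself retain only the monomial [u ^ 2 v ^ 2]. *)
Lemma sext_transvect al be ga u1 u2 v1 v2 k : (k < 5)%N ->
  let h0 := u1 * v1 in let h1 := - (u1 * v2 + u2 * v1) in let h2 := u2 * v2 in
  transvect2 (sext al be ga u1 u2 v1 v2) h0 h1 h2 k =
  - (be * (u1 * v2 - u2 * v1) ^+ 2) * quad_sq h0 h1 h2 k.
Proof.
by move: k => [|[|[|[|[|//]]]]] _; rewrite /transvect2 /sext /quad_sq /=; ring.
Qed.

Lemma sext_quartic_cov al be ga u1 u2 v1 v2 k : (k < 5)%N ->
  quartic_cov12 (sext al be ga u1 u2 v1 v2) k =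
  2 * (al * ga + 8 * be ^+ 2) * (u1 * v2 - u2 * v1) ^+ 4 *
  quad_sq (u1 * v1) (- (u1 * v2 + u2 * v1)) (u2 * v2) k.
Proof.
by move: k => [|[|[|[|[|//]]]]] _; rewrite /quartic_cov12 /quartic_cov /sext
  /quad_sq /=; ring.
Qed.

End CubePencil.

Section Mobius.
Local Open Scope ring_scope.
Variable K : numClosedFieldType.
Local Notation P2 := {mpoly K[2]}.
Local Notation X := ('X_ord0 : P2).
Local Notation Y := ('X_ord_max : P2).

Definition linform (p q : K) : P2 := p *: X + q *: Y.

Lemma linformZ k p q : k *: linform p q = linform (k * p) (k * q).
Proof. by rewrite /linform scalerDr !scalerA. Qed.

Lemma linformB p q p' q' : linform p q - linform p' q' = linform (p - p') (q - q').
Proof. by rewrite /linform opprD addrACA -!scalerBl. Qed.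

Lemma linear_factorE z :
  linear_factor z = if z is Some z then linform 1 (- z) else linform 0 1.
Proof. by case: z => [z|]; rewrite /linform scale1r ?scaleNr ?scale0r ?add0r. Qed.

Lemma det_mx2 (R : comNzRingType) (M : 'M[R]_2) :
  \det M = M ord0 ord0 * M ord_max ord_max - M ord0 ord_max * M ord_max ord0.
Proof.
have -> : \det M = det2 (fun i j => M (inord i) (inord j)).
  rewrite -det2E; congr (\det _); apply/matrixP => i j.
  by rewrite mxE !inord_val.
rewrite /det2 (_ : inord 0 = ord0); last by apply: val_inj; rewrite /= inordK.
by rewrite (_ : inord 1 = ord_max); last by apply: val_inj; rewrite /= inordK.
Qed.

Section Matrix.
Variable M : 'M[K]_2.
Hypothesis Mu : M \in unitmx.
Local Notation a := (M ord0 ord0).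
Local Notation b := (M ord0 ord_max).
Local Notation c := (M ord_max ord0).
Local Notation d := (M ord_max ord_max).

Lemma det2_neq0 : a * d - b * c != 0.
Proof. by move: Mu; rewrite unitmxE unitfE det_mx2. Qed.

Definition formU : P2 := linform d (- b).
Definition formV : P2 := linform (- c) a.

Definition moved_factor (z : option K) : P2 :=
  if z is Some z then formU - z *: formV else formV.

Lemma linear_factor_mobius z :
  exists2 k, k != 0 & k *: linear_factor (mobius M z) = moved_factor z.
Proof.
have D0 := det2_neq0; rewrite linear_factorE.
case: z => [z|] /=; rewrite /formU /formV ?linformZ ?linformB.
  case: eqP => [E|/eqP E].
    exists (- (a * z + b)); last first.
      by rewrite linformZ; congr linform; [rewrite mulr0 -E|]; ring.
    apply: contraNneq D0 => E'.
    have -> : a * d - b * c = a * (c * z + d) + c * - (a * z + b) by ring.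
    by rewrite E E' !mulr0 addr0.
  exists (c * z + d) => //; rewrite linformZ; congr linform; first by ring.
  by field.
case: eqP => [c0|/eqP c0].
  exists a; last by rewrite linformZ c0 oppr0 mulr0 mulr1.
  by apply: contraNneq D0 => ->; rewrite c0 mul0r mulr0 subrr.
exists (- c); first by rewrite oppr_eq0.
by rewrite linformZ; congr linform; field.
Qed.

Lemma mobius_inj : injective (mobius M).
Proof.
have D0 := det2_neq0.
have dnz z : c * z + d = 0 -> c != 0.
  move=> E; apply: contraNneq D0 => c0.
  by move: E; rewrite c0 mul0r add0r mulr0 => ->; rewrite mulr0 subrr.
have key z : c * z + d != 0 -> c != 0 -> (a * z + b) / (c * z + d) <> a / c.
  move=> E c0 H; case/eqP: D0.
  move/eqP: H; rewrite eqr_div// => /eqP H'.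
  transitivity (a * (c * z + d) - (a * z + b) * c); first by ring.
  by rewrite H' subrr.
case=> [z|] [z'|] //=.
- case: (c * z + d =P 0) => [E|/eqP E]; case: (c * z' + d =P 0) => [E'|/eqP E'] //.
    move=> _; have c0 := dnz _ E; congr Some; apply: (mulfI c0); apply: (addIr d).
    by rewrite E E'.
  move=> [H]; congr Some; apply/eqP; rewrite -subr_eq0.
  have /eqP : (a * d - b * c) * (z - z') = 0.
    transitivity ((a * z + b) * (c * z' + d) - (a * z' + b) * (c * z + d)); first by ring.
    by apply/eqP; rewrite subr_eq0 -eqr_div//; apply/eqP.
  by rewrite mulf_eq0 (negPf D0).
- case: (c * z + d =P 0) => [E|/eqP E]; case: (c =P 0) => [c0|/eqP c0] //.
    by have := dnz _ E; rewrite c0 eqxx.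
  by move=> [/(key _ E c0)].
- case: (c =P 0) => [c0|/eqP c0]; case: (c * z' + d =P 0) => [E|/eqP E] //.
    by have := dnz _ E; rewrite c0 eqxx.
  by move=> [/esym/(key _ E c0)].
Qed.

End Matrix.
Definition base_points (p : option K) : seq (option K) :=
  [:: Some 0; Some 1; None; p; orbit_pt1 p; orbit_pt2 p].

Lemma tri_involutiveE (Z : {fset option K}) M p :
  Z = [fset mobius M z | z in [fset Some 0%R; Some 1%R; None;
                     p; orbit_pt1 p; orbit_pt2 p]]%fset ->
  Z =i map (mobius M) (base_points p).
Proof.
move=> -> y; apply/imfsetP/mapP => -[z zb ->]; exists z => //.
  by move: zb; rewrite /base_points !inE -!orbA.
by move: zb; rewrite /base_points !inE -!orbA.
Qed.

Lemma uniq_base_points x : uniq (base_points (Some x)) =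
  [&& x != 0, x != 1 & x ^+ 2 - x + 1 != 0].
Proof.
rewrite /base_points /=.
have [->|x0] := eqVneq x 0; first by rewrite !inE !eqxx ?orbT /= ?orbT ?andbF.
have [->|x1] := eqVneq x 1; first by rewrite !inE !eqxx ?orbT /= ?orbT ?andbF.
have x1' : 1 - x != 0 by rewrite subr_eq0 eq_sym.
have SE (y z : K) : (Some y == Some z) = (y == z) by [].
have q1 : (x == (x - 1) / x) = (x ^+ 2 - x + 1 == 0).
  rewrite -[LHS](inj_eq (mulIf x0)) /= divfK// -subr_eq0; congr (_ == 0); ring.
have q2 : (x == 1 / (1 - x)) = (x ^+ 2 - x + 1 == 0).
  rewrite -[LHS](inj_eq (mulIf x1')) /= divfK// -subr_eq0 -oppr_eq0.
  congr (_ == 0); ring.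
have q3 : ((x - 1) / x == 1 / (1 - x)) = (x ^+ 2 - x + 1 == 0).
  rewrite eqr_div// -subr_eq0 -oppr_eq0; congr (_ == 0); ring.
have n1 : (0 == (x - 1) / x) = false.
  by rewrite eq_sym mulf_eq0 invr_eq0 (negPf x0) orbF subr_eq0 (negPf x1).
have n2 : (0 == 1 / (1 - x)) = false.
  by rewrite eq_sym mulf_eq0 invr_eq0 (negPf x1') oner_eq0.
have n3 : (1 == (x - 1) / x) = false.
  rewrite -(inj_eq (mulIf x0)) /= divfK// mul1r -subr_eq0 opprB addrC subrK.
  by rewrite oner_eq0.
have n4 : (1 == 1 / (1 - x)) = false.
  rewrite -(inj_eq (mulIf x1')) /= divfK// mul1r -subr_eq0 addrAC subrr add0r oppr_eq0.
  by rewrite (negPf x0).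
rewrite !inE !SE q1 q2 q3 n1 n2 n3 n4 [0 == 1]eq_sym oner_eq0 [0 == x]eq_sym.
by rewrite (negPf x0) [1 == x]eq_sym (negPf x1) /=; case: (_ == 0).
Qed.

Lemma sextic_of_seq (Z : {fset option K}) s : uniq s -> Z =i s ->
  sextic_of Z = \prod_(z <- s) linear_factor z.
Proof.
move=> us Zs; rewrite /sextic_of; apply: perm_big.
by apply: uniq_perm => //; apply: fset_uniq.
Qed.

Lemma card_uniq (Z : {fset option K}) s : Z =i s ->
  (#|` Z|%fset == size s) = uniq s.
Proof.
move=> Zs; have -> : Z = [fset x in s]%fset by apply/fsetP => x; rewrite Zs inE.
rewrite card_fseq; apply/eqP/idP => [E|/undup_id -> //].
by rewrite -[uniq s]negbK -ltn_size_undup E ltnn.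
Qed.

Lemma big_base_points (T : comNzRingType) (F : option K -> T) x :
    x != 0 -> x != 1 -> \prod_(z <- base_points (Some x)) F z =
  F (Some 0) * F (Some 1) * F None * F (Some x) * F (Some ((x - 1) / x)) *
  F (Some (1 / (1 - x))).
Proof.
move=> x0 x1; rewrite /base_points !big_cons big_nil /= (negPf x0) (negPf x1).
by rewrite mulr1 !mulrA.
Qed.

(** The points [0], [1], [oo] and [x], [(x - 1) / x], [1 / (1 - x)] are two orbits of
[z |-> 1 / (1 - z)], a transformation of order three with fixed points [- w] and
[- w ^ 2].  In the coordinates [u], [v] vanishing at these, an orbit is the zero
set of a binomial in [u ^ 3] and [v ^ 3]. *)
Lemma cube_identity (T : comNzRingType) (u v x w : T) : w ^+ 2 = - 1 - w ->
  - 27 * (u * (u - v) * v * (u - x * v) * (x * u - (x - 1) * v) * ((1 - x) * u - v)) =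
  (x + w ^+ 2) ^+ 3 * (u + w * v) ^+ 6
  - ((x + w ^+ 2) ^+ 3 + (x + w) ^+ 3) * (u + w * v) ^+ 3 * (u + w ^+ 2 * v) ^+ 3
  + (x + w) ^+ 3 * (u + w ^+ 2 * v) ^+ 6.
Proof. by move=> hw; rewrite hw; ring: hw. Qed.

Lemma moved_product M x : M \in unitmx -> x != 0 -> x != 1 ->
  exists2 e : K, e != 0 &
  \prod_(z <- map (mobius M) (base_points (Some x))) linear_factor z =
  e%:MP * (formU M * (formU M - formV M) * formV M * (formU M - x%:MP * formV M) *
    (x%:MP * formU M - (x%:MP - 1) * formV M) * ((1 - x%:MP) * formU M - formV M)).
Proof.
move=> Mu x0 x1; have x1' : 1 - x != 0 by rewrite subr_eq0 eq_sym.
have /choice[k kP] z : exists k, k != 0 /\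
    linear_factor (mobius M z) = k%:MP * moved_factor M z.
  have [k k0 <-] := linear_factor_mobius Mu z; exists k^-1; rewrite invr_eq0.
  by rewrite mul_mpolyC scalerA mulVf// scale1r.
exists (k (Some 0) * k (Some 1) * k None * k (Some x) * (k (Some ((x - 1) / x)) / x)
   * (k (Some (1 / (1 - x))) / (1 - x))).
  by rewrite !mulf_neq0 ?invr_eq0// (kP _).1.
rewrite big_map big_base_points// !(kP _).2 /moved_factor -!mul_mpolyC.
have e1 : (formU M - ((x - 1) / x)%:MP * formV M) =
    x^-1%:MP * (x%:MP * formU M - (x%:MP - 1) * formV M).
  have -> : ((x - 1) / x)%:MP = x^-1%:MP * (x%:MP - 1) :> P2.
    by rewrite mulrC mpolyCM mpolyCB mpolyC1.
  have xx : x^-1%:MP * x%:MP = 1 :> P2 by rewrite -mpolyCM mulVf// mpolyC1.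
  by rewrite -[in LHS](mul1r (formU M)) -xx; ring.
have e2 : (formU M - (1 / (1 - x))%:MP * formV M) =
    (1 - x)^-1%:MP * ((1 - x%:MP) * formU M - formV M).
  have xx : (1 - x)^-1%:MP * (1 - x)%:MP = 1 :> P2 by rewrite -mpolyCM mulVf// mpolyC1.
  have <- : (1 - x)%:MP = 1 - x%:MP :> P2 by rewrite mpolyCB mpolyC1.
  by rewrite mul1r mulrBr mulrA xx mul1r.
rewrite e1 e2 !mpolyCM mpolyC0 mpolyC1.
move: (formU M) (formV M) (x%:MP) (x^-1%:MP) ((1 - x)^-1%:MP).
move: ((k (Some 0))%:MP) ((k (Some 1))%:MP) ((k None)%:MP) ((k (Some x))%:MP)
  ((k (Some ((x - 1) / x)))%:MP) ((k (Some (1 / (1 - x))))%:MP).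
move=> *; ring.
Qed.

(* A primitive cube root of unity. *)
Definition omega : K := ('i * sqrtC 3 - 1) / 2.

Lemma omega2 : omega ^+ 2 = - 1 - omega.
Proof.
have h3 : sqrtC (3 : K) ^+ 2 = 3 by apply: sqrtCK.
have hi : ('i : K) ^+ 2 = -1 by apply: sqrCi.
rewrite /omega.
transitivity (('i ^+ 2 * sqrtC 3 ^+ 2 - 2 * 'i * sqrtC 3 + 1) / 4 : K).
  by field.
by rewrite h3 hi; field.
Qed.

(* The coefficients of [u ^ 6] and [v ^ 6] in [cube_identity]; [orbit_be] is that of
[20 u ^ 3 v ^ 3]. *)
Definition orbit_al (x : K) := (x + omega ^+ 2) ^+ 3.
Definition orbit_ga (x : K) := (x + omega) ^+ 3.
Definition orbit_be (x : K) := - (orbit_al x + orbit_ga x) / 20.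

Lemma mon6_inj (i j : 'I_7) : mon6 i = mon6 j -> i = j.
Proof.
move/(congr1 (fun m : 'X_{1..2} => m ord_max)).
rewrite !mnmDE !mulmnE !mnm1E /= !mul0n !mul1n !add0n => h; exact: val_inj.
Qed.

Lemma mon6X (R : comNzRingType) (i : 'I_7) :
  'X_[mon6 i] = 'X_ord0 ^+ (6 - i) * 'X_ord_max ^+ i :> {mpoly R[2]}.
Proof. by rewrite /mon6 mpolyXD !mpolyXn. Qed.

Lemma sextic_coords_sum (b : nat -> K) :
  sextic_coords (\sum_(k < 7) ('C(6, k)%:R * b k) *: 'X_[mon6 k]) =
  [ffun i : 'I_7 => b i].
Proof.
apply/ffunP => i; rewrite !ffunE raddf_sum (bigD1 i)//= mcoeffZ mcoeffX eqxx mulr1.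
rewrite big1 => [|j ji]; last first.
  rewrite mcoeffZ mcoeffX; case: eqP => [/mon6_inj E|]; last by rewrite mulr0.
  by rewrite E eqxx in ji.
rewrite addr0 mulrAC divff ?mul1r// pnatr_eq0 -lt0n bin_gt0.
by rewrite -ltnS.
Qed.

Lemma sext_morph (R R' : comNzRingType) (f : {rmorphism R -> R'})
    al be ga u1 u2 v1 v2 k :
  f (sext al be ga u1 u2 v1 v2 k) =
  sext (f al) (f be) (f ga) (f u1) (f u2) (f v1) (f v2) k.
Proof.
by move: k => [|[|[|[|[|[|k]]]]]];
  rewrite /sext ?(rmorph_nat, rmorphXn, rmorphM, rmorphD).
Qed.

Lemma sextic_coords_cubes al be ga u1 u2 v1 v2 :
  sextic_coords (al%:MP * linform u1 u2 ^+ 6 +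
    20 * be%:MP * linform u1 u2 ^+ 3 * linform v1 v2 ^+ 3 +
    ga%:MP * linform v1 v2 ^+ 6) =
  [ffun i : 'I_7 => sext al be ga u1 u2 v1 v2 i].
Proof.
rewrite -sextic_coords_sum; congr sextic_coords.
rewrite /linform -!mul_mpolyC sext_form; apply: eq_bigr => k _.
rewrite mon6X -mul_mpolyC mpolyCM (sext_morph (@mpolyC 2 K)) /=.
by rewrite mpolyC_nat.
Qed.

End Mobius.

(** * The tri-involutive locus *)

Section Locus.
Local Open Scope ring_scope.
Local Open Scope classical_set_scope.
Variable K : numClosedFieldType.
Local Notation w := (omega K).
Local Notation T := (@tri_involutive_locus K).

Lemma omega_diff : w ^+ 2 - w != 0.
Proof.
have h := omega2 K; apply/eqP => E.
have /eqP : (3 : K) = - (w ^+ 2 - w) ^+ 2.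
  by move: (w) h => o h; rewrite h; ring: h.
by rewrite E expr0n oppr0 pnatr_eq0.
Qed.

Lemma sext_scale (R : comNzRingType) (c al be ga u1 u2 v1 v2 : R) k :
  c * sext al be ga u1 u2 v1 v2 k = sext (c * al) (c * be) (c * ga) u1 u2 v1 v2 k.
Proof. by move: k => [|[|[|[|[|[|k]]]]]]; rewrite /sext; ring. Qed.

Definition orbit_sextic (M : 'M[K]_2) (x c : K) (k : nat) : K :=
  c * sext (orbit_al x) (orbit_be x) (orbit_ga x)
    (M ord_max ord_max - w * M ord_max ord0) (w * M ord0 ord0 - M ord0 ord_max)
    (M ord_max ord_max - w ^+ 2 * M ord_max ord0)
    (w ^+ 2 * M ord0 ord0 - M ord0 ord_max) k.

Lemma sextic_coords_orbits M x : M \in unitmx -> x != 0 -> x != 1 ->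
  exists2 e : K, e != 0 &
  sextic_coords (\prod_(z <- map (mobius M) (base_points (Some x))) linear_factor z) =
  [ffun i : 'I_7 => orbit_sextic M x e i].
Proof.
move=> Mu x0 x1; have [e e0 ->] := moved_product Mu x0 x1.
exists (e / - 27); first by rewrite mulf_neq0// invr_eq0 oppr_eq0 pnatr_eq0.
have wE : (w%:MP : {mpoly K[2]}) ^+ 2 = - 1 - w%:MP.
  by rewrite -[LHS]rmorphXn /= omega2 mpolyCB mpolyCN mpolyC1.
have uE : formU M + w%:MP * formV M = linform (M ord_max ord_max - w * M ord_max ord0)
    (w * M ord0 ord0 - M ord0 ord_max).
  rewrite mul_mpolyC /formU /formV linformZ /linform addrACA -!scalerDl mulrN.
  by rewrite [- _ + _]addrC.
have vE : formU M + w%:MP ^+ 2 * formV M =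
    linform (M ord_max ord_max - w ^+ 2 * M ord_max ord0)
    (w ^+ 2 * M ord0 ord0 - M ord0 ord_max).
  rewrite -[w%:MP ^+ 2]rmorphXn /= mul_mpolyC /formU /formV linformZ /linform.
  by rewrite addrACA -!scalerDl mulrN [- _ + _]addrC.
have := cube_identity (formU M) (formV M) x%:MP wE; rewrite uE vE => cE.
set P := (X in e%:MP * X); rewrite -/P in cE.
have n27 : - 27 != 0 :> K by rewrite oppr_eq0 pnatr_eq0.
have -> : e%:MP * P = (e / - 27)%:MP * (- 27 * P).
  have -> : - 27 = (- 27)%:MP :> {mpoly K[2]} by rewrite mpolyCN mpolyC_nat.
  by rewrite [RHS]mulrA -[X in _ = X * _]mpolyCM divfK.
rewrite cE /orbit_sextic; under [RHS]eq_ffun do rewrite sext_scale.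
rewrite -sextic_coords_cubes; congr sextic_coords.
have AE : (orbit_al x)%:MP = (x%:MP + w%:MP ^+ 2) ^+ 3 :> {mpoly K[2]}.
  by rewrite /orbit_al rmorphXn /= mpolyCD rmorphXn.
have GE : (orbit_ga x)%:MP = (x%:MP + w%:MP) ^+ 3 :> {mpoly K[2]}.
  by rewrite /orbit_ga rmorphXn /= mpolyCD.
have -> : orbit_be x = - (orbit_al x + orbit_ga x) / 20 by [].
move: (orbit_al x) (orbit_ga x) AE GE => A G AE GE.
have -> : 20 * ((e / - 27) * (- (A + G) / 20))%:MP =
    - (e / - 27)%:MP * (A%:MP + G%:MP) :> {mpoly K[2]}.
  rewrite -(mpolyC_nat _ _ 20) -mpolyCD -mpolyCN -!mpolyCM; congr mpolyC.
  by field.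
rewrite -AE -GE !(mpolyCM _ (e / - 27)).
move: (linform _ _) (linform _ _) => u v.
move: (mpolyC _ (e / _)) (A%:MP) (G%:MP) => r a g.
ring.
Qed.

(** The six points are distinct exactly when [x] differs from [0], [1] and the roots
of [x ^ 2 - x + 1]; the orbit of [oo] is that of [0] and [1]. *)
Lemma locusP v : T v <-> exists M x c,
  [/\ M \in unitmx, [&& x != 0, x != 1 & x ^+ 2 - x + 1 != 0], c != 0 &
      v = [ffun i : 'I_7 => orbit_sextic M x c i]].
Proof.
split=> [[Z [[Z6 [M Mu [p ZE]]] [c c0 ->]]]|[M [x [c [Mu hx c0 ->]]]]].
  have Zi := tri_involutiveE ZE.
  have := card_uniq Zi; rewrite Z6 eqxx => /esym us.
  have ub : uniq (base_points p) by rewrite -(map_inj_uniq (mobius_inj Mu)).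
  case: p ZE Zi us ub => [x|] ZE Zi us ub; last first.
    by move: ub; rewrite /base_points /= !inE !eqxx /= !andbF.
  have hx : [&& x != 0, x != 1 & x ^+ 2 - x + 1 != 0] by rewrite -uniq_base_points.
  have /and3P[x0 x1 _] := hx.
  have [e e0 eE] := sextic_coords_orbits Mu x0 x1.
  exists M, x, (c * e); rewrite mulf_neq0//; split=> //.
  by rewrite (sextic_of_seq us Zi) eE; apply/ffunP => i; rewrite !ffunE /orbit_sextic mulrA.
have /and3P[x0 x1 _] := hx; have [e e0 eE] := sextic_coords_orbits Mu x0 x1.
pose Z := [fset mobius M z | z in [fset Some 0%R; Some 1%R; None;
                     Some x; orbit_pt1 (Some x); orbit_pt2 (Some x)]]%fset.
have Zi : Z =i _ := tri_involutiveE (erefl Z).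
have us : uniq (map (mobius M) (base_points (Some x))).
  by rewrite map_inj_uniq ?uniq_base_points//; apply: mobius_inj.
exists Z; split.
  split; last by exists M => //; exists (Some x).
  by have := card_uniq Zi; rewrite us size_map /= => /eqP.
exists (c / e); first by rewrite mulf_neq0// invr_eq0.
rewrite (sextic_of_seq us Zi) eE; apply/ffunP => i; rewrite !ffunE /orbit_sextic.
by rewrite mulrA divfK.
Qed.

Lemma locus_cone : cone T.
Proof.
move=> a v a0 /locusP[M [x [c [Mu hx c0 ->]]]]; apply/locusP.
exists M, x, (a * c); rewrite mulf_neq0//; split=> //.
by apply/ffunP => i; rewrite !ffunE /orbit_sextic mulrA.
Qed.



Lemma orbit_form_neq0 (M : 'M[K]_2) : M \in unitmx ->
  (M ord_max ord_max - w * M ord_max ord0) * (w ^+ 2 * M ord0 ord0 - M ord0 ord_max) -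
  (w * M ord0 ord0 - M ord0 ord_max) * (M ord_max ord_max - w ^+ 2 * M ord_max ord0)
  != 0.
Proof.
move=> /det2_neq0.
set a := M ord0 ord0; set b := M ord0 ord_max; set c := M ord_max ord0.
set d := M ord_max ord_max => D0.
rewrite (_ : _ - _ = (w ^+ 2 - w) * (a * d - b * c)); last by ring.
by rewrite mulf_neq0// omega_diff.
Qed.

Lemma sext_neq0 (al be ga u1 u2 v1 v2 : K) : al != 0 -> u1 * v2 - u2 * v1 != 0 ->
  exists k : 'I_7, sext al be ga u1 u2 v1 v2 k != 0.
Proof.
move=> al0 D0; have [/existsP //|/existsPn E] :=
  boolP [exists k : 'I_7, sext al be ga u1 u2 v1 v2 k != 0].
have := sext_form al be ga u1 u2 v1 v2 v2 (- v1).
rewrite big1 => [|k _]; last by rewrite (eqP (negPn (E k))) mulr0 mul0r.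
rewrite (_ : _ + _ = al * (u1 * v2 - u2 * v1) ^+ 6); last by ring.
by move/eqP; rewrite mulf_eq0 (negPf al0) expf_eq0 (negPf D0).
Qed.

Lemma orbit_norm x : (x + w) * (x + w ^+ 2) = x ^+ 2 - x + 1.
Proof. by rewrite omega2; have := omega2 K; move: (w) => o ho; ring: ho. Qed.

Lemma locus_neq0 v : T v -> v != 0.
Proof.
move=> /locusP[M [x [c [Mu /and3P[x0 x1]]]]].
rewrite -orbit_norm mulf_eq0 negb_or => /andP[_ x2] c0 ->.
have [k kP] := sext_neq0 (orbit_be x) (orbit_ga x) (expf_neq0 3 x2)
  (orbit_form_neq0 Mu).
apply: contraNneq kP => /ffunP/(_ k); rewrite !ffunE /orbit_sextic => /eqP.
by rewrite mulf_eq0 (negPf c0).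
Qed.

Lemma sext_dilate (R : comNzRingType) (p al be ga u1 u2 v1 v2 : R) k :
  sext al be ga u1 u2 (p * v1) (p * v2) k =
  sext al (be * p ^+ 3) (ga * p ^+ 6) u1 u2 v1 v2 k.
Proof. by move: k => [|[|[|[|[|[|k]]]]]]; rewrite /sext; ring. Qed.

(** Over an algebraically closed field, [al u ^ 6 + 20 be u ^ 3 v ^ 3 + ga v ^ 6] is a
product [al (u ^ 3 - r1 v ^ 3) (u ^ 3 - r2 v ^ 3)]; scaling [v] turns the first factor
into [u ^ 3 - v ^ 3], the form of an orbit equivalent to [0], [1], [oo]. *)
Lemma generic_sext al be ga u1 u2 v1 v2 : al != 0 -> ga != 0 ->
    100 * be ^+ 2 - al * ga != 0 -> u1 * v2 - u2 * v1 != 0 ->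
  T [ffun i : 'I_7 => sext al be ga u1 u2 v1 v2 i].
Proof.
move=> al0 ga0 disc0 D0.
have w2 := omega2 K.
pose s := sqrtC (100 * be ^+ 2 - al * ga).
have s2 : s ^+ 2 = 100 * be ^+ 2 - al * ga by apply: sqrtCK.
have s0 : s != 0 by rewrite -sqrf_eq0 s2.
pose r1 := (- 10 * be + s) / al; pose r2 := (- 10 * be - s) / al.
have r12 : al * r1 * r2 = ga.
  rewrite /r1 /r2; transitivity ((100 * be ^+ 2 - s ^+ 2) / al); first by field.
  by rewrite s2; field.
have r1p2 : - al * (r1 + r2) = 20 * be by rewrite /r1 /r2; field.
have r10 : r1 != 0 by apply: contraNneq ga0 => E; rewrite -r12 E mulr0 mul0r.
have r20 : r2 != 0 by apply: contraNneq ga0 => E; rewrite -r12 E mulr0.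
have rD : r1 != r2.
  rewrite -subr_eq0 (_ : r1 - r2 = 2 * s / al); last by rewrite /r1 /r2; field.
  by rewrite !mulf_neq0 ?invr_eq0// pnatr_eq0.
clearbody r1 r2; clear s s2 s0.
pose p1 := 3.-root r1; pose p2 := 3.-root r2.
have p13 : p1 ^+ 3 = r1 by rewrite rootCK.
have p23 : p2 ^+ 3 = r2 by rewrite rootCK.
have p10 : p1 != 0 by apply: contraNneq r10 => E; rewrite -p13 E expr0n.
have p20 : p2 != 0 by apply: contraNneq r20 => E; rewrite -p23 E expr0n.
clearbody p1 p2.
pose rho := p2 / p1.
have rho0 : rho != 0 by rewrite mulf_neq0 ?invr_eq0.
have rho3 : rho ^+ 3 != 1.
  rewrite /rho expr_div_n p13 p23; apply: contra_neq rD => E.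
  by rewrite -[r2](divfK r10) E mul1r.
have rho31 : rho ^+ 3 * r1 = r2 by rewrite /rho expr_div_n p13 p23 divfK.
clearbody rho.
have := omega_diff; rewrite /=; move Eo : (w) => o wd; rewrite Eo in w2.
have rho1 : rho - 1 != 0.
  by rewrite subr_eq0; apply: contraNneq rho3 => ->; rewrite expr1n.
have o3 : o ^+ 3 = 1 by ring: w2.
have rhow : rho != o by apply: contraNneq rho3 => ->; rewrite o3.
have rhow2 : rho != o ^+ 2.
  by apply: contraNneq rho3 => ->; rewrite -exprM mulnC exprM o3 expr1n.
have o0 : o != 0.
  by apply/eqP => E; move: o3; rewrite E expr0n => /eqP; rewrite eq_sym oner_eq0.
(* The solution of (x + o) / (x + o^2) = rho. *)
pose x := (o - rho * o ^+ 2) / (rho - 1).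
have xw2 : x + o ^+ 2 = (o - o ^+ 2) / (rho - 1) by rewrite /x; field.
have xw : x + o = rho * (x + o ^+ 2) by rewrite /x; field.
have xw20 : x + o ^+ 2 != 0.
  by rewrite xw2 mulf_neq0 ?invr_eq0// -oppr_eq0 opprB.
have x0 : x != 0.
  rewrite mulf_neq0 ?invr_eq0// subr_eq0; apply: contra_neq rhow2 => E.
  apply: (mulfI (expf_neq0 2 o0)); rewrite mulrC -E -exprD exprSr o3 mul1r //.
have x1 : x != 1.
  rewrite -subr_eq0 (_ : x - 1 = o * (rho - o) / (rho - 1)).
    by rewrite !mulf_neq0 ?invr_eq0// subr_eq0.
  by rewrite /x; field: w2.
clearbody x.
pose V1 := (u1 - p1 * v1) / (o - o ^+ 2); pose V2 := (u2 - p1 * v2) / (o - o ^+ 2).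
pose U1 := u1 - o * V1; pose U2 := u2 - o * V2.
have UV1 : U1 + o ^+ 2 * V1 = p1 * v1.
  by rewrite /U1 /V1; field; rewrite -oppr_eq0 opprB.
have UV2 : U2 + o ^+ 2 * V2 = p1 * v2.
  by rewrite /U2 /V2; field; rewrite -oppr_eq0 opprB.
pose M : 'M[K]_2 := \matrix_(i, j) if i == ord0 then (if j == ord0 then V2 else - U2)
   else (if j == ord0 then - V1 else U1).
apply/locusP; exists M, x, (al / (x + o ^+ 2) ^+ 3).
split; rewrite ?mulf_neq0 ?invr_eq0 ?expf_neq0//.
- rewrite unitmxE unitfE det_mx2 !mxE /=.
  have : p1 * (u1 * v2 - u2 * v1) != 0 by rewrite mulf_neq0.
  apply: contraNneq => E; have u1E : u1 = U1 + o * V1 by rewrite subrK.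
  have u2E : u2 = U2 + o * V2 by rewrite subrK.
  apply/eqP; transitivity (u1 * (p1 * v2) - u2 * (p1 * v1)); first by ring.
  rewrite -UV1 -UV2 u1E u2E.
  transitivity ((o ^+ 2 - o) * (V2 * U1 - - U2 * - V1)); last by rewrite E mulr0.
  by ring.
- by rewrite x0 x1 -orbit_norm Eo xw !mulf_neq0.
apply/ffunP => k; rewrite !ffunE /orbit_sextic !mxE /= Eo sext_scale.
rewrite !mulrN !opprK UV1 [o * V2 + _]addrC [o ^+ 2 * V2 + _]addrC UV2 !subrK.
rewrite sext_dilate; congr sext; first by rewrite /orbit_al Eo divfK// expf_neq0.
- rewrite /orbit_be /orbit_al /orbit_ga Eo xw exprMn p13.
  have -> : be = - al * (r1 + r2) / 20 by rewrite r1p2; field.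
  by rewrite -rho31; field.
rewrite /orbit_ga Eo xw exprMn -r12 -rho31 -p13; by field.
Qed.

End Locus.

(** * The minors vanish on the locus *)

Section IdealOfOmega.
Local Open Scope ring_scope.
Local Open Scope classical_set_scope.
Variable K : numClosedFieldType.
Local Notation S := {mpoly K[7]}.
Local Notation T := (@tri_involutive_locus K).
Local Notation N := (syz_mx (coef K)).
Local Notation a := (coef K).

Definition locus_coords (k : 'I_7) : S :=
  sext (a 0) (a 1) (a 2) (a 3) (a 4) (a 5) (a 6) k.

Definition locus_generic : S :=
  a 0 * a 2 * (100 * a 1 ^+ 2 - a 0 * a 2) * (a 3 * a 6 - a 4 * a 5).

Definition sext_point (al be ga u1 u2 v1 v2 : K) (i : 'I_7) : K :=
  [:: al; be; ga; u1; u2; v1; v2]`_i.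

Lemma locus_coordsE e k : (locus_coords k).@[e] =
  sext (e (inord 0)) (e (inord 1)) (e (inord 2)) (e (inord 3)) (e (inord 4))
    (e (inord 5)) (e (inord 6)) k.
Proof. by rewrite /locus_coords (sext_morph (meval e)) /= !mevalXU. Qed.

Lemma locus_coords_point al be ga u1 u2 v1 v2 k :
  (locus_coords k).@[sext_point al be ga u1 u2 v1 v2] =
  sext al be ga u1 u2 v1 v2 k.
Proof. by rewrite locus_coordsE /sext_point !inordK. Qed.

Lemma locus_genericE e : locus_generic.@[e] = e (inord 0) * e (inord 2) *
  (100 * e (inord 1) ^+ 2 - e (inord 0) * e (inord 2)) *
  (e (inord 3) * e (inord 6) - e (inord 4) * e (inord 5)).
Proof.
by rewrite /locus_generic !expr2 !(mevalM, mevalB) (rmorph_nat (meval e)) !mevalXU.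
Qed.

Lemma locus_generic_neq0 : locus_generic != 0.
Proof.
apply/eqP => E; have := locus_genericE (sext_point 1 1 1 1 0 0 1).
rewrite E meval0 /sext_point !inordK//= => /eqP.
rewrite eq_sym !mul1r mul0r subr0 expr1n !mulr1 subr_eq0.
by rewrite (eqr_nat K 100 1).
Qed.

Lemma generic_locus e : locus_generic.@[e] != 0 ->
  T [ffun i => (locus_coords i).@[e]].
Proof.
rewrite locus_genericE !mulf_eq0 !negb_or => /andP[/andP[/andP[al0 ga0] disc] D0].
have -> : [ffun i => (locus_coords i).@[e]] = [ffun i : 'I_7 => sext (e (inord 0))
    (e (inord 1)) (e (inord 2)) (e (inord 3)) (e (inord 4)) (e (inord 5)) (e (inord 6)) i].
  by apply/ffunP => i; rewrite !ffunE locus_coordsE.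
exact: generic_sext.
Qed.

Lemma locus_sext v : T v -> exists al be ga u1 u2 v1 v2,
  u1 * v2 - u2 * v1 != 0 /\ v = [ffun i : 'I_7 => sext al be ga u1 u2 v1 v2 i].
Proof.
move=> /locusP[M [x [c [Mu _ _ ->]]]].
do 7!eexists; split; first exact: orbit_form_neq0 Mu.
by apply/ffunP => i; rewrite !ffunE /orbit_sextic sext_scale.
Qed.

Lemma locus_covered v : T v -> exists e, v = [ffun i => (locus_coords i).@[e]].
Proof.
move=> /locus_sext[al [be [ga [u1 [u2 [v1 [v2 [_ ->]]]]]]]].
exists (sext_point al be ga u1 u2 v1 v2).
by apply/ffunP => i; rewrite !ffunE locus_coords_point.
Qed.

(** The locus is, generically, the image of the seven coefficients [al], [be], [ga],
[u1], [u2], [v1], [v2]. *)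
Lemma omega_variety : proj_variety (Omega K).
Proof.
exact: (image_closure_variety (@locus_neq0 K) (@locus_cone K)
  locus_generic_neq0 generic_locus locus_covered).
Qed.

Lemma locus_vanishing_sext (f : S) al be ga u1 u2 v1 v2 : vanishing T f ->
  f.@[[ffun i : 'I_7 => sext al be ga u1 u2 v1 v2 i]] = 0.
Proof.
move=> fT; pose e := sext_point al be ga u1 u2 v1 v2.
have /(congr1 (meval e)) := (vanishing_image locus_generic_neq0 generic_locus
  locus_covered f).1 fT.
rewrite meval0 comp_mpoly_meval => <-; apply: meval_eq => i.
by rewrite ffunE tnth_mktuple locus_coords_point.
Qed.

(** A linear relation between the two transvectants is a vector in the kernel of the
syzygy matrix. *)
Lemma transvectants_minor (b : nat -> K) h0 h1 h2 t s w :
    (forall k, (k < 5)%N -> t * transvect2 b h0 h1 h2 k + s * quartic_cov12 b k = 0) ->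
  forall j, bordered_det (syz_mx b) w * [:: t * h0; - (t * h1); t * h2; 12 * s]`_j = 0.
Proof.
move=> Hb; pose z : 'cV[K]_4 := \col_j [:: t * h0; - (t * h1); t * h2; 12 * s]`_j.
move=> j; case: (ltnP j 4) => j4; last by rewrite nth_default// mulr0.
have := bordered_kernel w (@zero_ideal K) (N := syz_mx b) (z := z) _ (Ordinal j4).
rewrite !mxE /=; apply => k; rewrite /= mxE !big_ord_recl big_ord0 !mxE /= addr0.
have := Hb k (ltn_ord k); move: (nat_of_ord k) (ltn_ord k).
move=> [|[|[|[|[|//]]]]] _ E; rewrite /bump /= /syz_entry /=.
- by rewrite -[RHS]E /transvect2 /quartic_cov12 /quartic_cov; ring.
- by rewrite -[RHS](mulr0 4) -[X in _ = _ * X]E /transvect2 /quartic_cov12 /quartic_cov; ring.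
- by rewrite -[RHS](mulr0 6) -[X in _ = _ * X]E /transvect2 /quartic_cov12 /quartic_cov; ring.
- by rewrite -[RHS](mulr0 4) -[X in _ = _ * X]E /transvect2 /quartic_cov12 /quartic_cov; ring.
- by rewrite -[RHS]E /transvect2 /quartic_cov12 /quartic_cov; ring.
Qed.

(** The transvectants of [al u ^ 6 + 20 be u ^ 3 v ^ 3 + ga v ^ 6] with the quadric
[u v] and with itself are both multiples of [(u v) ^ 2], so the columns of the syzygy
matrix are linearly dependent. *)
Lemma sext_minors (al be ga u1 u2 v1 v2 : K) w : u1 * v2 - u2 * v1 != 0 ->
  bordered_det (syz_mx (sext al be ga u1 u2 v1 v2)) w = 0.
Proof.
move=> D0; set b := sext _ _ _ _ _ _ _.
pose h0 := u1 * v1; pose h1 := - (u1 * v2 + u2 * v1); pose h2 := u2 * v2.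
have key := @transvectants_minor b h0 h1 h2 _ _ w.
apply/eqP; have [be0|be0] := eqVneq be 0.
  have H : forall k, (k < 5)%N -> 1 * transvect2 b h0 h1 h2 k + 0 * quartic_cov12 b k = 0.
    by move=> k k5; rewrite sext_transvect// be0; ring.
  have z0 := key _ _ H 0%N; have z1 := key _ _ H 1%N; have z2 := key _ _ H 2%N.
  rewrite /= !mul1r in z0 z1 z2; move: z0 z1 z2.
  move: (bordered_det _ _) => d z0 z1 z2; apply: contraTT D0 => d0; rewrite negbK.
  rewrite -sqrf_eq0 (_ : _ ^+ 2 = h1 ^+ 2 - 4 * h0 * h2); last first.
    by rewrite /h0 /h1 /h2; ring.
  have zero x : d * x = 0 -> x = 0.
    by move/eqP; rewrite mulf_eq0 (negPf d0) => /eqP.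
  have := zero _ z1 => /eqP; rewrite oppr_eq0 => /eqP ->.
  by rewrite (zero _ z0) expr0n mulr0 mul0r subr0.
have H : forall k, (k < 5)%N ->
    2 * (al * ga + 8 * be ^+ 2) * (u1 * v2 - u2 * v1) ^+ 2 * transvect2 b h0 h1 h2 k +
    be * quartic_cov12 b k = 0.
  by move=> k k5; rewrite sext_transvect// sext_quartic_cov// -/h0 -/h1 -/h2; ring.
have /eqP := key _ _ H 3%N.
by rewrite /= !mulf_eq0 (negPf be0) orbF pnatr_eq0 orbF.
Qed.

Lemma minors_vanish : minors_ideal K `<=` vanishing T.
Proof.
move=> _ [w _ <-] v /locus_sext[al [be [ga [u1 [u2 [v1 [v2 [D0 ->]]]]]]]].
rewrite (bordered_det_morph (meval _)) -(eq_syz_mx (a := sext al be ga u1 u2 v1 v2)).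
  exact: sext_minors.
by move=> k k7 /=; rewrite /coef mevalXU ffunE inordK.
Qed.

End IdealOfOmega.

(** * Parametrisation of the locus *)

Section VanishingIdeal.
Local Open Scope ring_scope.
Local Open Scope classical_set_scope.
Variable K : numClosedFieldType.
Local Notation S := {mpoly K[7]}.
Local Notation T := (@tri_involutive_locus K).
Local Notation a := (coef K).
Local Notation I := (minors_ideal K).

Lemma sextic_param_morph (A A' : comNzRingType) (f : {rmorphism A -> A'})
    e0 e1 l h0 h1 h2 k :
  f (sextic_param e0 e1 l h0 h1 h2 k) =
  sextic_param (f e0) (f e1) (f l) (f h0) (f h1) (f h2) k.
Proof.
by move: k => [|[|[|[|[|[|k]]]]]]; rewrite /sextic_param /sexticQ6 /sexticQ5
  /sexticQ4 /sexticQ3 /sexticQ2 /quad_sq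
  ?(rmorph_nat, rmorphXn, rmorphM, rmorphN, rmorphB, rmorphD).
Qed.

(** A sextic whose transvectant with the quadric [h] is a multiple of [h ^ 2] is a
combination of [u ^ 6], [u ^ 3 v ^ 3] and [v ^ 6], where [u] and [v] are the linear
factors of [h]. *)
Lemma sextic_param_sext (e0 e1 l h0 h1 h2 : K) : h0 != 0 ->
    h1 ^+ 2 - 4 * h0 * h2 != 0 ->
  exists al be ga u1 u2 v1 v2, forall k, (k < 7)%N ->
  sextic_param e0 e1 l h0 h1 h2 k = sext al be ga u1 u2 v1 v2 k.
Proof.
move=> n0 nD; pose s := sqrtC (h1 ^+ 2 - 4 * h0 * h2).
have s2 : s ^+ 2 = h1 ^+ 2 - 4 * h0 * h2 by apply: sqrtCK.
have s0 : s != 0 by rewrite -sqrf_eq0 s2.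
pose p := (- h1 + s) / (2 * h0); pose q := (- h1 - s) / (2 * h0).
have n2 : (2 : K) != 0 by rewrite pnatr_eq0.
have h1E : h1 = - h0 * (p + q) by rewrite /p /q; field; rewrite n0.
have h2E : h2 = h0 * (p * q).
  transitivity ((h1 ^+ 2 - s ^+ 2) / (4 * h0)); first by rewrite s2; field; rewrite n0.
  by rewrite /p /q; field; rewrite n0.
have pq : p - q != 0.
  by rewrite (_ : p - q = s / h0) ?mulf_neq0 ?invr_eq0// /p /q; field; rewrite n0.
clearbody p q; clear s s2 s0 nD; subst h1 h2.
pose be := - (l * h0) / (p - q) ^+ 2.
pose c0 := e0 - 20 * be; pose c1 := e1 - 10 * be * (p + q).
pose al := (c1 - q * c0) / (p - q); pose ga := (p * c0 - c1) / (p - q).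
pose b := sext al be ga 1 p 1 q.
have b0 : b 0%N = e0 by rewrite /b /sext /al /ga /c0 /c1; field.
have b1 : b 1%N = e1 by rewrite /b /sext /al /ga /c0 /c1; field.
exists (h0 ^+ 5 * al), (h0 ^+ 5 * be), (h0 ^+ 5 * ga), 1, p, 1, q => k k7.
rewrite -sext_scale -/b -b0 -b1; apply/esym/eqP; rewrite -subr_eq0; apply/eqP.
apply: (sextic_param_mod (@zero_ideal K)) => // j j5.
have -> : transvect2 b h0 (- h0 * (p + q)) (h0 * (p * q)) j =
    h0 * transvect2 b (1 * 1) (- (1 * q + p * 1)) (p * q) j by rewrite /transvect2; ring.
rewrite /b sext_transvect// /be /=; move: j j5 => [|[|[|[|[|//]]]]] _;
  by rewrite /quad_sq; field.
Qed.

Definition param_coords (k : 'I_7) : {mpoly K[6]} :=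
  sextic_param 'X_(inord 0) 'X_(inord 1) 'X_(inord 2) 'X_(inord 3) 'X_(inord 4)
    'X_(inord 5) k.

(** By [sextic_param_sext] the generic value of the parametrisation lies on the
locus. *)
Lemma vanishing_param f : vanishing T f ->
  f \mPo [tuple param_coords i | i < 7] = 0.
Proof.
move=> fT; pose X j : {mpoly K[6]} := 'X_(inord j).
have evX e j : (X j).@[e] = e (inord j) by rewrite mevalXU.
have DE e : (X 3%N * (X 4%N ^+ 2 - 4 * X 3%N * X 5%N)).@[e] =
    e (inord 3) * (e (inord 4) ^+ 2 - 4 * e (inord 3) * e (inord 5)).
  by rewrite !expr2 !(mevalM, mevalB) (rmorph_nat (meval e)) !evX.
apply: (mpoly_eval_generic (D := X 3%N * (X 4%N ^+ 2 - 4 * X 3%N * X 5%N))).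
  apply/eqP => E; have := DE (fun i : 'I_6 => (i < 5)%N%:R).
  by rewrite E meval0 !inordK//= mulr0 expr1n subr0 mulr1 => /eqP; rewrite eq_sym oner_eq0.
move=> e; rewrite DE mulf_eq0 negb_or => /andP[e3 eD].
rewrite comp_mpoly_meval.
have [al [be [ga [u1 [u2 [v1 [v2 H]]]]]]] :=
  sextic_param_sext (e (inord 0)) (e (inord 1)) (e (inord 2)) e3 eD.
rewrite -(locus_vanishing_sext al be ga u1 u2 v1 v2 fT); apply: meval_eq => i.
rewrite ffunE tnth_mktuple /param_coords (sextic_param_morph (meval e)) /= -H//.
by rewrite !mevalXU.
Qed.

Lemma comp_param_zero (f : S) e0 e1 l h0 h1 h2 : vanishing T f ->
  f \mPo [tuple (sextic_param e0 e1 l h0 h1 h2 i : S) | i < 7] = 0.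
Proof.
move=> /vanishing_param E.
pose g := mpoly_subst (@mpolyC 7 K) (fun i : 'I_6 => [:: e0; e1; l; h0; h1; h2]`_i).
have := congr1 g E; rewrite rmorph0 => <-.
apply: (mpoly_rmorph_ext (f := comp_mpoly _)
  (g := g \o comp_mpoly [tuple param_coords i | i < 7])) => [c|i] /=.
  by rewrite !comp_mpolyC /g mpoly_substC.
rewrite !comp_mpolyXU -!tnth_nth !tnth_mktuple /param_coords (sextic_param_morph g).
by rewrite /g !mpoly_substX !inordK.
Qed.

Lemma comp_dhomog n (R : comNzRingType) (f : {mpoly R[n]}) d c : f \is d.-homog ->
  f \mPo [tuple c * 'X_i | i < n] = c ^+ d * f.
Proof.
move=> /dhomogP hf; rewrite [in RHS](mpolyE f) comp_mpolyE mulr_sumr.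
rewrite big_seq [RHS]big_seq; apply: eq_bigr => m /hf /= <-.
rewrite -scalerAr; congr (_ *: _); rewrite mdegE -prodrXr mpolyXE_id -big_split.
by apply: eq_bigr => i _; rewrite tnth_mktuple exprMn.
Qed.

(** Modulo the minors, the coordinates times [6 * cramer0 a ^+ 8 * hankel3 a] are
values of the parametrisation, where [f] vanishes identically. *)
Lemma vanishing_power f d : vanishing T f -> f \is d.-homog ->
  I ((6 * cramer0 a ^+ 8 * hankel3 a) ^+ d * f).
Proof.
move=> fT fd; have hI := minors_ideal_ideal K; have [_ _ IM] := hI.
have Im k : (k < 5)%N -> I (minor a k).
  by move=> k5; exists (delta_mx (Ordinal k5) 0); rewrite ?bordered_det_delta.
have half x : I (2 * x) -> I x.
  move=> /(IM (2^-1)%:MP); rewrite mulrA -(mpolyC_nat _ _ 2) -mpolyCM mulVf ?mul1r//.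
  by rewrite pnatr_eq0.
have := param_of_minors hI half (Im 3%N isT) (Im 4%N isT).
move=> /= H; set c := (6 * _ * _).
have := comp_param_zero _ _ _ _ _ _ fT => /(_ _ _ _ _ _ _) E.
rewrite -(comp_dhomog c fd) -[_ \mPo _]subr0.
rewrite -[X in _ - X](E (6 * cramer0 a ^+ 3 * hankel3 a * a 0)
  (6 * cramer0 a ^+ 3 * hankel3 a * a 1)
  (cramer0 a * hankel3 a * transvect2 a (cramer0 a) (cramer1 a) (cramer2 a) 0)
  (cramer0 a) (cramer1 a) (cramer2 a)).
apply: (mpoly_rmorph_congr (f := comp_mpoly _) (g := comp_mpoly _) hI) => [k|i] /=.
  by rewrite !comp_mpolyC subrr; case: hI.
rewrite !comp_mpolyXU -!tnth_nth !tnth_mktuple.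
rewrite (_ : 'X_i = a i); last by rewrite /coef inord_val.
rewrite (_ : c * a i = cramer0 a ^+ 5 * (6 * cramer0 a ^+ 3 * hankel3 a * a i)).
  exact: H.
by rewrite /c; move: (cramer0 a) (hankel3 a) (a i) => u v w; ring.
Qed.

End VanishingIdeal.

(** * The vanishing ideal is the ideal of minors *)

Section SpecialFibre.
Local Open Scope ring_scope.
Local Open Scope classical_set_scope.
Variables (A : comNzRingType) (P : set A) (x y : A).
Hypotheses (hP : ideal_set P) (half : forall z, P (2 * z) -> P z)
  (third : forall z, P (3 * z) -> P z).

Definition fibre_coef (k : nat) : A :=
  match k with 0 | 5 => x | 2 => 1 | 3 | 4 => 0 | _ => y end.

Lemma fibre_hankel : hankel3 fibre_coef = -1.
Proof. by rewrite /hankel3 /rows3 /det3 /det2 /skip /jump /=; ring. Qed.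

(** No sextic of the fibre with vanishing minors has [cramer0 = 0]: the relations
[cramer_mod] give [y ^ 2 = 3 x], hence [y = 0] and [x = 0], where [cramer0] is
[-36]. *)
Lemma fibre_cramer : P (minor fibre_coef 3%N) -> P (minor fibre_coef 4%N) ->
  P (cramer0 fibre_coef) -> P 1.
Proof.
move=> m3 m4; have Pc k k5 := @cramer_mod _ _ hP fibre_coef half m3 m4 k k5.
have : cramer1 fibre_coef = 2 * x * (y ^+ 2 - 3 * x).
  by rewrite /cramer1 /rows3 /det3 /det2 /skip /jump /quartic_cov12 /quartic_cov /=; ring.
have : cramer0 fibre_coef = - 36 - 2 * x * y * (y ^+ 2 - 3 * x) + 2 * x ^+ 2 * y.
  by rewrite /cramer0 /rows3 /det3 /det2 /skip /jump /quartic_cov12 /quartic_cov /=; ring.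
move: (cramer0 _) (cramer1 _) (cramer2 _) Pc => c0 c1 c2 Pc c0E c1E P0.
have Pu : P (y ^+ 2 - 3 * x).
  apply/half/third/(ideal_lin2 (a1 := -1) (a2 := - x) hP (Pc 3%N isT) P0).
  by rewrite fibre_hankel /transvect2 /quartic_cov12 /quartic_cov /=; ring.
have Py : P y.
  apply/half/half/third.
  apply: (ideal_lin3 (a1 := -1) (a2 := - y) (a3 := - 2 * x ^+ 2) hP (Pc 4%N isT) P0 Pu).
  by rewrite fibre_hankel /transvect2 /quartic_cov12 /quartic_cov /= c1E; ring.
apply/half/half/third/third.
apply: (ideal_lin3 (a1 := -1) (a2 := - 2 * x * y) (a3 := 2 * x ^+ 2) hP P0 Pu Py).
by rewrite c0E; ring.
Qed.

End SpecialFibre.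

Section FibreMorphisms.
Local Open Scope ring_scope.
Variables (A A' : comNzRingType) (f : {rmorphism A -> A'}).

Lemma det2_morph m : f (det2 m) = det2 (fun i j => f (m i j)).
Proof. by rewrite /det2 rmorphB !rmorphM. Qed.

Lemma det3_morph m : f (det3 m) = det3 (fun i j => f (m i j)).
Proof. by rewrite /det3 rmorphD rmorphB !rmorphM !det2_morph. Qed.

Lemma quartic_cov12_morph c k : f (quartic_cov12 c k) = quartic_cov12 (f \o c) k.
Proof.
by move: k => [|[|[|[|k]]]]; rewrite /quartic_cov12 /quartic_cov
  ?(rmorph_nat, rmorphXn, rmorphM, rmorphB, rmorphD).
Qed.

Lemma hankel3_morph c : f (hankel3 c) = hankel3 (f \o c).
Proof. by rewrite /hankel3 /rows3 det3_morph. Qed.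

Lemma cramer0_morph c : f (cramer0 c) = cramer0 (f \o c).
Proof.
rewrite /cramer0 /rows3 det3_morph; congr det3; apply/funext => -[|[|i]] //.
by apply/funext => j; rewrite quartic_cov12_morph.
Qed.

Lemma eq_hankel3 (b c : nat -> A) :
  (forall k, (k < 7)%N -> b k = c k) -> hankel3 b = hankel3 c.
Proof. by move=> bc; rewrite /hankel3 /rows3 /det3 /det2 /skip /jump /= !bc. Qed.

Lemma eq_cramer0 (b c : nat -> A) :
  (forall k, (k < 7)%N -> b k = c k) -> cramer0 b = cramer0 c.
Proof.
move=> bc; rewrite /cramer0 /rows3 /det3 /det2 /skip /jump /quartic_cov12
  /quartic_cov /=; by rewrite !bc.
Qed.

End FibreMorphisms.

Section IdealIsMinors.
Local Open Scope ring_scope.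
Local Open Scope classical_set_scope.
Variable K : numClosedFieldType.
Local Notation S := {mpoly K[7]}.
Local Notation B := {mpoly K[5]}.
Local Notation A := {mpoly B[2]}.
Local Notation T := (@tri_involutive_locus K).
Local Notation a := (coef K).
Local Notation I := (minors_ideal K).

(* The point a_2 = 1, a_3 = a_4 = a_5 - a_0 = a_6 - a_1 = 0 of the parameter space. *)
Definition fibre_ev : {rmorphism B -> K} :=
  mpoly_subst idfun (fun j : 'I_5 => (j == ord0)%:R).

Lemma fibre_ev_param j : (j < 5)%N -> fibre_ev (param K j) = (j == 0%N)%:R.
Proof. by move=> j5; rewrite /fibre_ev /param mpoly_substX -val_eqE /= inordK. Qed.

Definition fibre_red : {rmorphism A -> {mpoly K[2]}} :=
  mpoly_subst (@mpolyC 2 K \o fibre_ev) (fun i : 'I_2 => 'X_i).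

Definition fibre_lift : {rmorphism {mpoly K[2]} -> A} :=
  mpoly_subst (@mpolyC 2 B \o @mpolyC 5 K) (fun i : 'I_2 => 'X_i).

Lemma fibre_liftK : cancel fibre_lift fibre_red.
Proof.
apply: (mpoly_rmorph_ext (f := fibre_red \o fibre_lift) (g := idfun)) => [c|i] /=.
  by rewrite /fibre_lift mpoly_substC /= /fibre_red mpoly_substC /= /fibre_ev mpoly_substC.
by rewrite /fibre_lift mpoly_substX /= /fibre_red mpoly_substX.
Qed.

Lemma fibre_red_coef x m : (fibre_red x)@_m = fibre_ev x@_m.
Proof.
rewrite -[in RHS](mcoeff_map_mpoly fibre_ev); congr (_@_m).
apply: (mpoly_rmorph_ext (f := fibre_red) (g := map_mpoly fibre_ev)) => [c|i] /=.
  by rewrite /fibre_red mpoly_substC /= map_mpolyC.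
by rewrite /fibre_red mpoly_substX map_mpolyX.
Qed.

Lemma fibre_red_theta k : (k < 7)%N ->
  fibre_red (theta K (a k)) = fibre_coef 'X_0 'X_1 k.
Proof.
have rC b : fibre_red b%:MP = (fibre_ev b)%:MP by rewrite /fibre_red mpoly_substC.
have rX (i : 'I_2) : fibre_red 'X_i = 'X_i by rewrite /fibre_red mpoly_substX.
move=> k7; rewrite theta_coefE//; move: k k7 => [|[|[|[|[|[|[|//]]]]]]] _;
  by rewrite /= ?rmorphD ?rC ?rX ?fibre_ev_param //= ?mpolyC0 ?mpolyC1 ?addr0.
Qed.

Lemma mpoly_nat_unit n (P : set {mpoly K[n]}) k x : ideal_set P -> P (k.+1%:R * x) -> P x.
Proof.
move=> [_ _ PM] /(PM (k.+1%:R^-1)%:MP).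
by rewrite mulrA -(mpolyC_nat _ _ k.+1) -mpolyCM mulVf ?mul1r// pnatr_eq0.
Qed.

(** The polynomial [f] is killed modulo the minors by a power of a product that is
invertible on the special fibre, hence by a nonzero parameter; parameters are not
zero divisors modulo the minors. *)
Lemma vanishing_minors_homog f d : vanishing T f -> f \is d.-homog -> I f.
Proof.
move=> fT fd; have hI := minors_ideal_ideal K; have [I0 ID IM] := hI.
pose I' : set A := [set y | I (theta_inv K y * f)].
have hI' : ideal_set I'.
  split=> [|y z|b y] /=; rewrite /I' /=; first by rewrite rmorph0 mul0r.
    by rewrite rmorphD mulrDl; apply: ID.
  by rewrite rmorphM -mulrA; apply: IM.
have I'theta x : I (x * f) -> I' (theta K x) by rewrite /I' /= thetaK.
have I'I x : I x -> I' (theta K x) by move=> Ix; apply: I'theta; rewrite mulrC; apply: IM.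
have [x I'x x1] : exists2 x, I' x & fibre_red x = 1; last first.
  have [|||b Ib eb] := fibre_empty_param (ev := fibre_ev) hI' _ _ (lead0_monic K)
      (lead1_monic K) I'x.
  - by apply: I'I; exists (lead0_vec K).
  - by apply: I'I; exists (lead1_vec K).
  - move=> m /=; rewrite -fibre_red_coef (rmorphB fibre_red) (rmorph1 fibre_red) x1.
    by rewrite subrr mcoeff0.
  apply: (minors_torsion_free (b := b)) => //.
  by apply/eqP => b0; move: eb; rewrite b0 rmorph0 => /eqP; rewrite eq_sym oner_eq0.
pose J := [set z | exists2 x, I' x & fibre_red x = z].
apply: contrapT => J1.
have hJ : ideal_set J.
  have [I'0 I'D I'M] := hI'; split.
  - by exists 0; rewrite ?rmorph0.
  - by move=> _ _ [y Iy <-] [z Iz <-]; exists (y + z); rewrite ?rmorphD//; apply: I'D.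
  - move=> b _ [y Iy <-]; exists (fibre_lift b * y); first exact: I'M.
    by rewrite rmorphM fibre_liftK.
have [||P [hP JP P1]] := @prime_avoiding _ J [set 1] hJ erefl.
- by move=> y z -> ->; rewrite mulr1.
- by move=> y Jy yE; apply: J1; rewrite -yE.
have [hPi nP1 Pp] := hP; pose c := fibre_coef ('X_0 : {mpoly K[2]}) 'X_1.
have JI x : I x -> P (fibre_red (theta K x)).
  by move=> Ix; apply: JP; exists (theta K x) => //; apply: I'I.
pose red : {rmorphism S -> {mpoly K[2]}} := fibre_red \o theta K.
have Pm k : (k < 5)%N -> P (minor c k).
  move=> k5; rewrite -(@minor_morph _ _ red a) => //; last exact: fibre_red_theta.
  by apply: JI; exists (delta_mx (Ordinal k5) 0); rewrite ?bordered_det_delta.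
have cE : red (cramer0 a) = cramer0 c.
  by rewrite cramer0_morph; apply: eq_cramer0 => k k7; apply: fibre_red_theta.
have hE : red (hankel3 a) = hankel3 c.
  by rewrite hankel3_morph; apply: eq_hankel3 => k k7; apply: fibre_red_theta.
have Pc : P ((6 * cramer0 c ^+ 8 * hankel3 c) ^+ d).
  apply: JP; exists (theta K ((6 * cramer0 a ^+ 8 * hankel3 a) ^+ d)).
    by apply: I'theta; apply: vanishing_power.
  rewrite -[LHS]/(red _) rmorphXn; congr (_ ^+ d).
  rewrite (rmorphM red) (rmorphM red) rmorph_nat rmorphXn cE.
  by rewrite hE.
apply: nP1; have := prime_exp hP Pc; rewrite fibre_hankel.
move=> /Pp[/Pp[P6|]|PN1].
- by apply: (mpoly_nat_unit (k := 5) hPi); rewrite mulr1.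
- move/(prime_exp hP).
  exact: (fibre_cramer hPi (fun z => mpoly_nat_unit (k := 1) hPi)
    (fun z => mpoly_nat_unit (k := 2) hPi) (Pm 3%N isT) (Pm 4%N isT)).
- have [_ _ PM] := hPi; have := PM (-1) _ PN1; by rewrite mulrNN mulr1.
Qed.

Lemma vanishing_minors : vanishing T = I.
Proof.
apply/seteqP; split; last exact: minors_vanish.
move=> f fT; have [I0 ID _] := minors_ideal_ideal K.
have fE : f = \sum_(d < msize f) pihomog mdeg d f by exact: pihomog_partitionE.
rewrite fE; apply: (big_ind I) => // d _.
apply: (@vanishing_minors_homog _ d); last exact: pihomogP.
move=> v Tv; exact: cone_vanishing (@locus_cone K) fT Tv d.
Qed.

Lemma vanishing_omega : vanishing (Omega K) = I.
Proof.
rewrite -vanishing_minors.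
exact: (closure_vanishing (@locus_neq0 K) (@locus_cone K)).
Qed.

Lemma omega_ideal : proj_ideal (Omega K) = I.
Proof.
rewrite proj_ideal_cone ?vanishing_omega//.
by apply: proj_closed_cone; case: (omega_variety K).
Qed.

End IdealIsMinors.

(** * A hypersurface containing the locus *)

Section Hypersurface.
Local Open Scope ring_scope.
Local Open Scope classical_set_scope.
Variable K : numClosedFieldType.
Local Notation S := {mpoly K[7]}.
Local Notation coords := {ffun 'I_7 -> K}.
Local Notation T := (@tri_involutive_locus K).
Local Notation a := (coef K).
Local Notation I := (minors_ideal K).

(** A general point of the affine cone over [Omega] depends on five parameters, as the
leading coefficients of [u] and [v] can be normalised to [1]; joining this cone to
the point [x_2 ^ 6] gives a hypersurface. *)
Definition join_coord (A : comNzRingType) (al be ga p q mu : A) (k : nat) : A :=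
  sext al be ga 1 p 1 q k + (k == 6%N)%:R * mu.

Definition join_coords (k : 'I_7) : {mpoly K[6]} :=
  join_coord 'X_(inord 0) 'X_(inord 1) 'X_(inord 2) 'X_(inord 3) 'X_(inord 4)
    'X_(inord 5) k.

Definition join_point (al be ga p q mu : K) (i : 'I_6) : K := [:: al; be; ga; p; q; mu]`_i.

Lemma join_coordsE e k : (join_coords k).@[e] =
  join_coord (e (inord 0)) (e (inord 1)) (e (inord 2)) (e (inord 3)) (e (inord 4))
    (e (inord 5)) k.
Proof.
rewrite /join_coords /join_coord mevalD mevalM (rmorph_nat (meval e)).
by rewrite (sext_morph (meval e)) /= !mevalXU meval1.
Qed.

Lemma join_coords_point al be ga p q mu k :
  (join_coords k).@[join_point al be ga p q mu] = join_coord al be ga p q mu k.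
Proof. by rewrite join_coordsE /join_point !inordK. Qed.

Definition join_locus : set coords :=
  [set v | v != 0 /\ exists e, v = [ffun i => (join_coords i).@[e]]].

Lemma join_locus_neq0 v : join_locus v -> v != 0. Proof. by case. Qed.

Lemma vscale_neq0 c (v : coords) : c != 0 -> v != 0 -> vscale c v != 0.
Proof.
move=> c0; apply: contra_neq => /ffunP E; apply/ffunP => i.
by have /eqP := E i; rewrite !ffunE mulf_eq0 (negPf c0) => /eqP.
Qed.

Lemma join_locus_cone : cone join_locus.
Proof.
move=> c v c0 [v0 [e vE]]; split; first exact: vscale_neq0.
exists (join_point (c * e (inord 0)) (c * e (inord 1)) (c * e (inord 2))
  (e (inord 3)) (e (inord 4)) (c * e (inord 5))).
apply/ffunP => i; rewrite !ffunE join_coords_point vE ffunE join_coordsE.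
by rewrite /join_coord mulrDr sext_scale mulrCA.
Qed.

Lemma join_generic_neq0 : join_coords ord0 != 0.
Proof.
apply/eqP => E; have := join_coords_point 1 0 0 0 0 0 ord0.
rewrite E meval0 /join_coord /sext /= => /eqP.
by rewrite !expr1n !mul0r !mulr1 !addr0 eq_sym oner_eq0.
Qed.

Lemma join_generic e : (join_coords ord0).@[e] != 0 ->
  join_locus [ffun i => (join_coords i).@[e]].
Proof.
move=> e0; split; last by exists e.
by apply: contraNneq e0 => /ffunP/(_ ord0); rewrite !ffunE => ->.
Qed.

Lemma join_covered v : join_locus v -> exists e, v = [ffun i => (join_coords i).@[e]].
Proof. by case. Qed.

Definition join_variety := zariski_closure join_locus.

Lemma join_varietyP : proj_variety join_variety.
Proof.
exact: (image_closure_variety join_locus_neq0 join_locus_cone join_generic_neq0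
  join_generic join_covered).
Qed.

Lemma vanishing_join : vanishing join_variety = vanishing join_locus.
Proof. exact: (closure_vanishing join_locus_neq0 join_locus_cone). Qed.

Lemma vanishing_joinE f : vanishing join_variety f <->
  f \mPo [tuple join_coords i | i < 7] = 0.
Proof.
rewrite vanishing_join.
exact: (vanishing_image join_generic_neq0 join_generic join_covered).
Qed.

(** Seven polynomials in six variables are algebraically dependent. *)
Lemma vanishing_join_neq0 : exists2 f, f != 0 & vanishing join_variety f.
Proof.
have [f f0 fE] := alg_dep join_coords.
by exists f => //; apply/vanishing_joinE.
Qed.

Lemma sext_normalize (R : comNzRingType) (al be ga u v p q : R) k :
  sext al be ga u (u * p) v (v * q) k =
  sext (al * u ^+ 6) (be * u ^+ 3 * v ^+ 3) (ga * v ^+ 6) 1 p 1 q k.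
Proof. by move: k => [|[|[|[|[|[|k]]]]]]; rewrite /sext; ring. Qed.

(** Sextics with [u1 v1 != 0] can be normalised and lie on the join, with [mu = 0]. *)
Lemma vanishing_join_omega : vanishing join_variety `<=` I.
Proof.
move=> f /vanishing_joinE fJ; rewrite -vanishing_minors.
apply/(vanishing_image (locus_generic_neq0 K) (@generic_locus K) (@locus_covered K)).
have D0 : a 3 * a 5 != 0.
  apply/eqP => E; have := congr1 (meval (fun=> 1)) E.
  by rewrite mevalM /coef !mevalXU meval0 mulr1 => /eqP; rewrite oner_eq0.
apply: (mpoly_eval_generic D0) => e.
rewrite mevalM /coef !mevalXU mulf_eq0 negb_or => /andP[u0 v0].
set u := e (inord 3) in u0; set v := e (inord 5) in v0.
have /(congr1 (meval (join_point (e (inord 0) * u ^+ 6)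
  (e (inord 1) * u ^+ 3 * v ^+ 3) (e (inord 2) * v ^+ 6)
  (e (inord 4) / u) (e (inord 6) / v) 0))) := fJ.
rewrite meval0 !comp_mpoly_meval => <-; apply: meval_eq => i.
rewrite !tnth_mktuple join_coords_point locus_coordsE /join_coord mulr0 addr0.
by rewrite -sext_normalize -/u -/v mulrC divfK// [v * _]mulrC divfK.
Qed.

(** The sextic [(x_1 + x_2) ^ 6 + (x_1 - x_2) ^ 6 + x_2 ^ 6] has a nonzero minor. *)
Lemma join_not_omega : exists2 f, I f & ~ vanishing join_variety f.
Proof.
exists (minor a 3%N).
  exists (delta_mx (inord 3) 0) => //.
  by rewrite bordered_det_delta inordK.
rewrite vanishing_join => /(_ [ffun i => (join_coords i).@[join_point 1 0 1 1 (-1) 1]]).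
set v := [ffun _ => _]; pose c k : K := [:: 2; 0; 2; 0; 2; 0; 3]`_k.
have vE k : (k < 7)%N -> (a k).@[v] = c k.
  move=> k7; rewrite /coef mevalXU ffunE join_coords_point inordK//.
  by move: k k7 => [|[|[|[|[|[|[|//]]]]]]] _; rewrite /join_coord /sext /c /=; ring.
have vJ : join_locus v.
  split; last by eexists.
  apply/eqP => /ffunP/(_ ord0)/eqP; rewrite ffunE join_coords_point /join_coord /sext /=.
  rewrite ffunE; apply/negP; rewrite !expr1n !(mulr1, mul1r, mul0r, addr0).
  by rewrite (_ : 1 + 1 = 2%:R) ?pnatr_eq0.
move/(_ vJ); rewrite (minor_morph (f := meval v) _ vE)// => /eqP.
have -> : minor c 3%N = - 2016.
  rewrite /minor /det4 /det3 /det2 /skip /jump /syz_entry /bin4 /quartic_cov /c /=.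
  by ring.
by rewrite oppr_eq0 pnatr_eq0.
Qed.

End Hypersurface.

(** * Codimension and the Cohen-Macaulay property *)

Section Dimension.
Local Open Scope ring_scope.
Local Open Scope classical_set_scope.
Variable K : numClosedFieldType.
Local Notation S := {mpoly K[7]}.
Local Notation coords := {ffun 'I_7 -> K}.
Local Notation T := (@tri_involutive_locus K).
Local Notation a := (coef K).
Local Notation I := (minors_ideal K).

Lemma zero_prime : prime_set [set (0 : S)].
Proof.
split; first exact: zero_ideal.
  by move/eqP; rewrite oner_eq0.
by move=> x y /eqP; rewrite mulf_eq0 => /orP[/eqP|/eqP]; [left|right].
Qed.

Lemma strict_subset (U : Type) (X Y : set U) : X `<=` Y -> (exists2 x, Y x & ~ X x) -> X `<` Y.
Proof. by move=> XY [x Yx nXx]; split=> // YX; apply/nXx/YX. Qed.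

Definition cons_chain (U : Type) (x : U) (c : nat -> U) (i : nat) : U :=
  if i is i'.+1 then c i' else x.

(** Below the minors lie the zero ideal and the ideal of a hypersurface, and a
chain of primes of [K[a_0, ..., a_6]] has length at most [7]. *)
Lemma height_minors_le P m c : prime_chain_mod I P m c -> (m <= 5)%N.
Proof.
move=> [cP clt _]; have jv := join_varietyP K.
pose d := cons_chain [set (0 : S)] (cons_chain (vanishing (@join_variety K)) c).
suff : (m.+2 <= 7)%N by rewrite !ltnS.
apply: (@prime_chain_dim K 7 m.+2 d) => -[|[|i]] im.
- exact: zero_prime.
- exact: variety_prime.
- by have [] := cP i im.
- apply: strict_subset => [_ ->|]; first by have [] := vanishing_ideal (@join_variety K).
  by have [f f0 fJ] := vanishing_join_neq0 K; exists f => //; apply/eqP.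
- have [_ Ic] := cP 0%N isT; apply: strict_subset => /=.
    by apply: subset_trans Ic; apply: vanishing_join_omega.
  by have [f If nf] := join_not_omega K; exists f => //; apply: Ic.
- exact: clt.
Qed.

(* The coordinates of [v] as a point of the parameter space. *)
Definition point_params (v : 'I_7 -> K) (j : nat) : K := (lin_param K j).@[v].

Lemma fibre_seq_point (P : set S) v : ideal_set P ->
  (forall i, P ('X_i - (v i)%:MP)) -> {in fibre_seq (point_params v), forall x, P x}.
Proof.
move=> hP Pv x /(nthP 0)[j]; rewrite size_map size_iota => j5 <-.
have [P0 PD PM] := hP; rewrite nth_fibre_seq// /point_params.
have Pa k : P (a k - (a k).@[v]%:MP) by rewrite /coef mevalXU; apply: Pv.
have Pab k l : P (a k - a l - (a k - a l).@[v]%:MP).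
  rewrite mevalB mpolyCB (_ : _ - _ = (a k - (a k).@[v]%:MP) + -1 * (a l - (a l).@[v]%:MP)).
    by apply: PD => //; apply: PM.
  by rewrite mulN1r !opprB addrACA [RHS]addrACA [- a l - _]addrC.
by move: j j5 => [|[|[|[|[|//]]]]] _ /=.
Qed.

Lemma point_chain (P : set S) v : prime_set P -> I `<=` P ->
  (forall i, P ('X_i - (v i)%:MP)) -> exists c, prime_chain_mod I P 5 c.
Proof.
move=> hP IP Pv; have hPi : ideal_set P by case: hP.
have := regular_seq_chain (minors_ideal_ideal K) hP IP (fibre_seq_point hPi Pv)
  (@fibre_seq_regular K (point_params v)).
by rewrite size_map size_iota.
Qed.

Lemma coef_neq0 k : a k != 0.
Proof.
by apply/eqP => /(congr1 (meval (fun=> 1)))/eqP; rewrite mevalXU meval0 oner_eq0.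
Qed.

Lemma space_variety : proj_variety [set v : coords | v != 0].
Proof.
have cV : cone [set v : coords | v != 0] by move=> c v; apply: vscale_neq0.
have -> : [set v : coords | v != 0] = zariski_closure [set v : coords | v != 0].
  apply/seteqP; split=> v; first exact: sub_closure.
  by case/zariski_closureE.
apply: (@image_closure_variety K [set v : coords | v != 0] _ cV 7 (fun i => 'X_i) _
  (coef_neq0 0)) => // [e|v _].
- rewrite /coef mevalXU => e0 /=; apply: contraNneq e0 => /ffunP/(_ (inord 0)).
  by rewrite !ffunE mevalXU => ->.
- by exists v; apply/ffunP => i; rewrite ffunE mevalXU.
Qed.

(** The vanishing ideals of a chain of varieties above [Omega] form a chain of
primes, which continues above the minors by five more steps up to the ideal of a
point. *)
Lemma omega_codim : proj_codim (Omega K) 2.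
Proof.
have ov := omega_variety K; have jv := join_varietyP K.
have clo : proj_closed (Omega K) by case: ov.
have O0 v : Omega K v -> v != 0 by apply: proj_closed_neq0.
have clj : proj_closed (@join_variety K) by case: jv.
split.
  exists (cons_chain (Omega K) (cons_chain (@join_variety K) (fun=> [set v | v != 0]))).
  split=> // [[|[|i]]|[|[|i]]] // _.
  - exact: space_variety.
  - apply: strict_subset.
      apply: proj_closed_sub => //; rewrite vanishing_omega.
      exact: vanishing_join_omega.
    have [f If nf] := join_not_omega K; apply: contrapT => H; apply: nf => v jvv.
    have : Omega K v by apply: contrapT => nO; apply: H; exists v.
    by rewrite -vanishing_omega in If; apply: If.
  - apply: strict_subset => [v|]; first exact: proj_closed_neq0.
    have [f f0 fJ] := vanishing_join_neq0 K; apply: contrapT => H.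
    case/eqP: f0; apply: (mpoly_eval_generic (D := a 0)).
      exact: coef_neq0.
    move=> v; rewrite /coef mevalXU => v0; pose w : coords := [ffun i => v i].
    have fE : f.@[v] = f.@[w] by apply: meval_eq => i; rewrite ffunE.
    rewrite fE; apply: fJ; apply: contrapT => nj; apply: H; exists w => //=.
    by apply: contraNneq v0 => /ffunP/(_ (inord 0)); rewrite !ffunE => ->.
move=> m c [c0 cv clt].
have [v Ov] : exists v, Omega K v by case: ov => _ [].
pose P : set S := [set f | f.@[v] = 0].
have hP : prime_set P.
  split; first split; rewrite /P /=.
  - exact: meval0.
  - by move=> x y /= ; rewrite mevalD => -> ->; rewrite addr0.
  - by move=> b x /=; rewrite mevalM => ->; rewrite mulr0.
  - by move/eqP; rewrite meval1 oner_eq0.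
  - by move=> x y /eqP; rewrite mevalM mulf_eq0 => /orP[/eqP|/eqP]; [left|right].
have IP : I `<=` P by rewrite -vanishing_omega => f; apply.
have [d [dP dlt d5]] : exists c, prime_chain_mod I P 5 c.
  apply: (point_chain (v := v)) => // i.
  by rewrite /P /= mevalB mevalXU mevalC subrr.
have vlt j : (j < m)%N -> vanishing (c j.+1) `<` vanishing (c j).
  move=> jm; have [sub nsub] := clt j jm; split=> [f fj w cw|sub'].
    exact/fj/sub.
  have [clj1 _] := cv j.+1 jm; have [clj0 _] := cv j (ltnW jm).
  by apply: nsub; apply: proj_closed_sub => // w; apply: proj_closed_neq0.
suff : (m + 5 <= 7)%N by rewrite -[7%N]/(2 + 5)%N leq_add2r.
apply: (@prime_chain_dim K 7 (m + 5)
  (fun i => if (i < m)%N then vanishing (c (m - i)%N) else d (i - m)%N)) => i im.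
  case: ltnP => mi; first by apply/variety_prime/cv/leq_subr.
  by have [|dp _] := dP (i - m)%N; rewrite ?leq_subLR.
have [mi|im'] := leqP m i.
  by rewrite ltnNge (leq_trans mi)//= subSn//; apply: dlt; lia.
rewrite -(subnSK im'); have [sub nsub] := vlt (m - i.+1)%N ltac:(lia).
case: ltnP => // mi; have -> : (m - i.+1 = 0)%N by lia.
have -> : (i.+1 - m = 0)%N by lia.
move: sub nsub; have -> : (m - i.+1 = 0)%N by lia.
rewrite c0 vanishing_omega => sub nsub; have [_ Id] := dP 0%N isT.
split; first exact: subset_trans Id.
by move=> sub'; apply: nsub; apply: subset_trans sub'.
Qed.

Hypothesis K_uncountable : forall u : nat -> K, exists x, forall n, u n <> x.

(** Every maximal ideal is that of a point, by the Nullstellensatz; there the five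
shifted parameters form a regular sequence, so depth and height are at least [5],
and both are at most the bound [5] of [height_minors_le]. *)
Lemma omega_cohen_macaulay : arith_cohen_macaulay (Omega K).
Proof.
rewrite /arith_cohen_macaulay omega_ideal => P mP IP; have hP := maximal_is_prime mP.
have [hPi P1 _] := hP.
have [v Pv] := nullstellensatz K_uncountable mP.
exists 5%N; split; split.
- exists (fibre_seq (point_params v)); split.
  + by rewrite size_map size_iota.
  + exact: fibre_seq_point.
  + split; last exact: fibre_seq_regular.
    by move/(ideal_add_sub hPi IP (fibre_seq_point hPi Pv)).
- move=> s sP [_ reg].
  have [c cc] := regular_seq_chain (minors_ideal_ideal K) hP IP sP reg.
  exact: height_minors_le cc.
- exact: point_chain Pv.
- by move=> m c; apply: height_minors_le.
Qed.

End Dimension.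

(** * Unimodular substitutions *)

Section LinearSubstitution.
Local Open Scope ring_scope.
Variable A : comNzRingType.
Implicit Types (p q r s x y : A) (b c : nat -> A).

(* The coefficients of the product of [p x + r y] and the form with coefficients [c]. *)
Definition mul_lin p r c (k : nat) : A :=
  p * c k + (if k is k'.+1 then r * c k' else 0).

(** The coefficients of [(p x + r y) ^ (d - l) (q x + s y) ^ l]. *)
Definition subst_coef p q r s d l : nat -> A :=
  iter l (mul_lin q s) (iter (d - l) (mul_lin p r) (fun k => (k == 0%N)%:R)).

Definition form_eval n c x y : A := \sum_(k < n.+1) c k * (x ^+ (n - k) * y ^+ k).

Lemma mul_lin_eval p r c n x y : (forall k, (n < k)%N -> c k = 0) ->
  (forall k, (n.+1 < k)%N -> mul_lin p r c k = 0) /\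
  form_eval n.+1 (mul_lin p r c) x y = (p * x + r * y) * form_eval n c x y.
Proof.
move=> c0; split=> [[//|k] nk|].
  by rewrite /mul_lin c0 ?c0 ?mulr0 ?addr0//; apply: ltnW.
rewrite /form_eval /mul_lin mulrDl.
under eq_bigr do rewrite mulrDl; rewrite big_split; congr (_ + _).
  rewrite big_ord_recr /= c0// mulr0 mul0r addr0 mulr_sumr; apply: eq_bigr => k _.
  by rewrite subSn -1?ltnS// exprS; ring.
rewrite big_ord_recl /= mul0r add0r mulr_sumr; apply: eq_bigr => k _.
by rewrite /bump /= add1n subSS exprS; ring.
Qed.

Lemma iter_mul_lin_eval p r c n m x y : (forall k, (n < k)%N -> c k = 0) ->
  (forall k, (m + n < k)%N -> iter m (mul_lin p r) c k = 0) /\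
  form_eval (m + n) (iter m (mul_lin p r) c) x y =
  (p * x + r * y) ^+ m * form_eval n c x y.
Proof.
move=> c0; elim: m => [|m [IH1 IH2]]; first by rewrite expr0 mul1r.
have [h1 h2] := mul_lin_eval p r x y IH1.
by split=> //; rewrite addSn iterS h2 IH2 exprS mulrA.
Qed.

Lemma subst_coef_eval p q r s d l x y : (l <= d)%N ->
  form_eval d (subst_coef p q r s d l) x y =
  (p * x + r * y) ^+ (d - l) * (q * x + s * y) ^+ l.
Proof.
move=> ld; have [|h1 h2] := @iter_mul_lin_eval p r (fun k => (k == 0%N)%:R) 0 (d - l) x y.
  by case.
have [_] := iter_mul_lin_eval q s l x y h1.
rewrite addn0 subnKC// /subst_coef => ->; rewrite mulrC; congr (_ * _).
rewrite addn0 in h2; rewrite h2 /form_eval big_ord1 /= subnn !expr0 !mulr1//.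
Qed.

Definition polar p q b (k : nat) : A := p * b k + q * b k.+1.

(** The binomial coordinates of the sextic [F(p x + r y, q x + s y)], as values of
the polar form of [F]. *)
Definition sextic_act p q r s b k : A :=
  iter k (polar r s) (iter (6 - k) (polar p q) b) 0%N.

Lemma sextic_actE p q r s b k : (k < 7)%N ->
  'C(6, k)%:R * sextic_act p q r s b k =
  \sum_(l < 7) ('C(6, l)%:R * b l) * subst_coef p q r s 6 l k.
Proof.
rewrite !big_ord_recl big_ord0 /bump /=.
by move: k => [|[|[|[|[|[|[|//]]]]]]] _;
  rewrite -?[('C(6, 0))]/1%N -?[('C(6, 1))]/6%N -?[('C(6, 2))]/15%N
    -?[('C(6, 3))]/20%N -?[('C(6, 4))]/15%N -?[('C(6, 5))]/6%N -?[('C(6, 6))]/1%N;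
  rewrite /sextic_act /polar /subst_coef /mul_lin /=; ring.
Qed.

(** The first three columns are the transvectants of the sextic with the monomials of
degree two, and transvectants commute with substitutions up to a power of the
determinant. *)
Lemma syz_entry_act p q r s b k j : (k < 5)%N -> (j < 3)%N ->
  (p * s - r * q) ^+ 2 * (\sum_(l < 5) subst_coef p q r s 4 l k * syz_entry b l j) =
  \sum_(i < 3) syz_entry (sextic_act p q r s b) k i * subst_coef p q r s 2 j i.
Proof.
rewrite !big_ord_recl !big_ord0 /bump /=.
by move: k => [|[|[|[|[|//]]]]] _; move: j => [|[|[|//]]] _;
  rewrite /syz_entry /bin4 /sextic_act /polar /subst_coef /mul_lin /=; ring.
Qed.

(** The last column is the transvectant [(F, F)_4]. *)
Lemma quartic_cov_act b p q r s k : (k < 5)%N ->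
  quartic_cov (sextic_act p q r s b) k =
  (p * s - r * q) ^+ 4 * \sum_(l < 5) subst_coef p q r s 4 l k * quartic_cov b l.
Proof.
rewrite !big_ord_recl big_ord0 /bump /=.
by move: k => [|[|[|[|[|//]]]]] _;
  rewrite /quartic_cov /sextic_act /polar /subst_coef /mul_lin /=; ring.
Qed.

Section Unimodular.
Variables p q r s : A.
Hypothesis unimod : p * s - r * q = 1.

Definition quartic_mx : 'M[A]_5 := \matrix_(k, l) subst_coef p q r s 4 l k.
(* The action on quadrics and, trivially, on the last summand. *)
Definition syz_source_mx : 'M[A]_4 := \matrix_(i, j)
  if (i < 3)%N && (j < 3)%N then subst_coef p q r s 2 j i else (i == j :> nat)%:R.

Lemma det_quartic_mx : \det quartic_mx = 1.
Proof.
rewrite /quartic_mx (det_skip 4 (fun k l => subst_coef p q r s 4 l k)).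
rewrite -[RHS](expr1n _ 10) -[X in _ = X ^+ _]unimod !big_ord_recl big_ord0 !det4E /bump /=.
rewrite /det4 /det3 /det2 /skip /jump /subst_coef /mul_lin /=; ring.
Qed.

Lemma det_syz_source_mx : \det syz_source_mx = 1.
Proof.
rewrite /syz_source_mx (det4E (fun i j : nat => if (i < 3)%N && (j < 3)%N then
  subst_coef p q r s 2 j i else (i == j :> nat)%:R)).
rewrite -[RHS](expr1n _ 3) -[X in _ = X ^+ _]unimod /det4 /det3 /det2 /skip /jump /=.
rewrite /subst_coef /mul_lin /=; ring.
Qed.

Lemma syz_mx_act b :
  syz_mx (sextic_act p q r s b) *m syz_source_mx = quartic_mx *m syz_mx b.
Proof.
apply/matrixP => k j; rewrite !mxE.
have [j3|j3] := ltnP j 3.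
  have := syz_entry_act p q r s b (ltn_ord k) j3; rewrite unimod expr1n mul1r => E.
  rewrite [RHS](eq_bigr (fun l : 'I_5 => subst_coef p q r s 4 l k * syz_entry b l j));
    last by move=> l _; rewrite !mxE.
  rewrite E.
  rewrite big_ord_recr /= !mxE /= gtn_eqF// mulr0 addr0; apply: eq_bigr => i _.
  by rewrite !mxE /= ltn_ord j3.
have jE : j = 3%N :> nat by apply/eqP; rewrite eqn_leq j3 -ltnS ltn_ord.
rewrite big_ord_recr big1 => [|i _]; last first.
  by rewrite !mxE jE andbF /= ltn_eqF ?mulr0.
rewrite /= add0r !mxE /= jE eqxx mulr1 /= /syz_entry quartic_cov_act// unimod expr1n mul1r.
by apply: eq_bigr => l _; rewrite !mxE jE.
Qed.

(** Both representations are unimodular. *)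
Lemma bordered_det_act b w :
  bordered_det (syz_mx (sextic_act p q r s b)) (quartic_mx *m w) =
  bordered_det (syz_mx b) w.
Proof.
have E : row_mx (quartic_mx *m w) (syz_mx (sextic_act p q r s b)) *m
    block_mx 1%:M 0 0 syz_source_mx = quartic_mx *m row_mx w (syz_mx b) :> 'M_(_, 1 + 4).
  by rewrite mul_row_block mulmx1 !mulmx0 addr0 add0r syz_mx_act mul_mx_row.
have := congr1 (fun M : 'M_(1 + 4) => \det M) E.
by rewrite /= !det_mulmx det_ublock det1 det_syz_source_mx det_quartic_mx !mul1r mulr1.
Qed.

End Unimodular.
End LinearSubstitution.

(** * Equivariance of the syzygy matrix *)

Section BinaryForms.
Local Open Scope ring_scope.
Variable R : comNzRingType.
Implicit Types (w : nat -> R) (F : {mpoly R[2]}).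

(* The exponent of x_1^(d-k) x_2^k. *)
Definition mono (d k : nat) : 'X_{1..2} := (U_(ord0) *+ (d - k) + U_(ord_max) *+ k)%MM.

Definition binform d w : {mpoly R[2]} := \sum_(k < d.+1) w k *: 'X_[mono d k].

Lemma mono_max d k : mono d k ord_max = k.
Proof. by rewrite mnmDE !mulmnE !mnm1E /= mul0n mul1n. Qed.

Lemma mono_ord0 d k : mono d k ord0 = (d - k)%N.
Proof. by rewrite mnmDE !mulmnE !mnm1E /= mul0n mul1n addn0. Qed.

Lemma monoX d k : 'X_[mono d k] = 'X_ord0 ^+ (d - k) * 'X_ord_max ^+ k :> {mpoly R[2]}.
Proof. by rewrite /mono mpolyXD !mpolyXn. Qed.

Lemma mdeg_mono d k : (k <= d)%N -> mdeg (mono d k) = d.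
Proof. by move=> kd; rewrite mdegD !mdegMn !mdeg1 !mul1n subnK. Qed.

Lemma mono_mdeg (m : 'X_{1..2}) : m = mono (mdeg m) (m ord_max).
Proof.
apply/mnmP => i; rewrite mdegE big_ord_recl big_ord1.
have -> : lift ord0 ord0 = ord_max :> 'I_2 by apply: val_inj.
by case: (unliftP ord_max i) => [j ->|->]; rewrite ?mono_max//;
  rewrite (_ : lift _ _ = ord0) ?mono_ord0 ?addnK//; apply: val_inj; rewrite ord1.
Qed.

Lemma binform_coef d w k : (k <= d)%N -> (binform d w)@_(mono d k) = w k.
Proof.
move=> kd; rewrite raddf_sum (bigD1 (Ordinal (kd : (k < d.+1)%N)))//= mcoeffZ mcoeffX eqxx mulr1.
rewrite big1 ?addr0// => j jk; rewrite mcoeffZ mcoeffX; case: eqP; rewrite ?mulr0//.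
move=> /(congr1 (fun m : 'X_{1..2} => m ord_max)); rewrite !mono_max => E.
by rewrite -val_eqE /= E eqxx in jk.
Qed.

Lemma binform_homog d w : binform d w \is d.-homog.
Proof.
apply: rpred_sum => k _; apply: rpredZ; rewrite dhomogX /=.
by apply/eqP/mdeg_mono; rewrite -ltnS.
Qed.

Lemma binform_ext d F F' : F \is d.-homog -> F' \is d.-homog ->
  (forall k, (k <= d)%N -> F@_(mono d k) = F'@_(mono d k)) -> F = F'.
Proof.
move=> hF hF' E; apply/mpolyP => m.
have [md|md] := eqVneq (mdeg m) d.
  rewrite (mono_mdeg m) md; apply: E; rewrite -md mdegE.
  by rewrite (bigD1 ord_max)//= leq_addr.
have z G : G \is d.-homog -> G@_m = 0.
  move=> /dhomogP hG; apply/eqP; apply: contraNT md; rewrite -mcoeff_msupp => mG.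
  by apply/eqP/(hG m).
by rewrite !z.
Qed.

Lemma binformE d F : F \is d.-homog -> F = binform d (fun k => F@_(mono d k)).
Proof.
by move=> hF; apply: (binform_ext hF (binform_homog _ _)) => k kd; rewrite binform_coef.
Qed.

Lemma subst_coef_morph (R' : comNzRingType) (f : {rmorphism R -> R'}) p q r s d l k :
  f (subst_coef p q r s d l k) = subst_coef (f p) (f q) (f r) (f s) d l k.
Proof.
have lin a b c j : f (mul_lin a b c j) = mul_lin (f a) (f b) (f \o c) j.
  by case: j => [|j]; rewrite /mul_lin /= rmorphD !rmorphM ?rmorph0.
have it a b n c : f \o iter n (mul_lin a b) c = iter n (mul_lin (f a) (f b)) (f \o c).
  by elim: n => [|n IH] //=; apply/funext => j /=; rewrite lin IH.
rewrite -[LHS]/((f \o subst_coef p q r s d l) k) /subst_coef !it; congr (iter _ _ _ _).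
by congr (iter _ _ _); apply/funext => j /=; rewrite rmorph_nat.
Qed.

Lemma subst_binform p q r s d w :
  binform d w \mPo [tuple (if i == ord0 :> 'I_2 then p%:MP * 'X_ord0 + r%:MP * 'X_ord_max
      else q%:MP * 'X_ord0 + s%:MP * 'X_ord_max) | i < 2] =
  binform d (fun k => \sum_(l < d.+1) w l * subst_coef p q r s d l k).
Proof.
set t := [tuple _ | _ < _].
have t0 : 'X_ord0 \mPo t = p%:MP * 'X_ord0 + r%:MP * 'X_ord_max.
  by rewrite comp_mpolyXU -tnth_nth tnth_mktuple.
have t1 : 'X_ord_max \mPo t = q%:MP * 'X_ord0 + s%:MP * 'X_ord_max.
  by rewrite comp_mpolyXU -tnth_nth tnth_mktuple.
rewrite [in LHS]/binform rmorph_sum /=.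
under eq_bigr => l _.
  rewrite comp_mpolyZ monoX (rmorphM (comp_mpoly t)) !(rmorphXn (comp_mpoly t)) /= t0 t1.
  rewrite -subst_coef_eval -1?ltnS// /form_eval scaler_sumr.
  over.
rewrite exchange_big /=; apply: eq_bigr => k _.
rewrite scaler_suml; apply: eq_bigr => l _; rewrite monoX -scalerA; congr (_ *: _).
by rewrite -mul_mpolyC subst_coef_morph.
Qed.

Definition lin_tuple (m : 'M[R]_2) : 2.-tuple {mpoly R[2]} :=
  [tuple \sum_(j < 2) m j i *: 'X_j | i < 2].

Lemma lin_tuple_comp (m m' : 'M[R]_2) F : m *m m' = 1%:M ->
  (F \mPo lin_tuple m') \mPo lin_tuple m = F.
Proof.
move=> mm; have tX n k : 'X_k \mPo lin_tuple n = \sum_(j < 2) n j k *: 'X_j.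
  by rewrite comp_mpolyXU -tnth_nth tnth_mktuple.
apply: (mpoly_rmorph_ext (f := comp_mpoly (lin_tuple m) \o comp_mpoly (lin_tuple m'))
  (g := idfun)) => [c|i] /=; first by rewrite !comp_mpolyC.
rewrite tX (raddf_sum (comp_mpoly (lin_tuple m))) /=.
under eq_bigr => j _ do rewrite comp_mpolyZ tX scaler_sumr.
have -> : 'X_i = \sum_k (m *m m') k i *: 'X_k :> {mpoly R[2]}.
  rewrite mm (bigD1 i)//= !mxE eqxx scale1r big1 ?addr0// => k ki.
  by rewrite mxE (negPf ki) scale0r.
rewrite exchange_big; apply: eq_bigr => k _; rewrite mxE scaler_suml.
by apply: eq_bigr => j _; rewrite scalerA mulrC.
Qed.

End BinaryForms.

Lemma map_syz_mx (A A' : comNzRingType) (f : {rmorphism A -> A'}%R) a :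
  map_mx f (syz_mx a) = syz_mx (f \o a).
Proof. by apply/matrixP => i j; rewrite !mxE syz_entry_morph. Qed.

Section Equivariance.
Local Open Scope ring_scope.
Local Open Scope classical_set_scope.
Variable K : numFieldType.
Local Notation S := {mpoly K[7]}.
Local Notation a := (coef K).
Variable g : 'M[K]_2.
Hypothesis g1 : \det g = 1.
Local Notation P := ((g ord0 ord0)%:MP : S).
Local Notation Q := ((g ord0 ord_max)%:MP : S).
Local Notation P' := ((g ord_max ord0)%:MP : S).
Local Notation Q' := ((g ord_max ord_max)%:MP : S).

Lemma subst_formE (h : 'M[K]_2) d (w : nat -> S) : subst_form h (binform d w) =
  binform d (fun k => \sum_(l < d.+1) w l * subst_coef (h ord0 ord0)%:MP
    (h ord0 ord_max)%:MP (h ord_max ord0)%:MP (h ord_max ord_max)%:MP d l k).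
Proof.
have <- := subst_binform ((h ord0 ord0)%:MP : S) (h ord0 ord_max)%:MP
  (h ord_max ord0)%:MP (h ord_max ord_max)%:MP d w.
refine (congr1 (fun t : 2.-tuple {mpoly S[2]} => binform d w \mPo t) _).
apply: eq_from_tnth => i.
rewrite !tnth_mktuple big_ord_recl big_ord1 -!mul_mpolyC.
have -> : lift ord0 ord0 = ord_max :> 'I_2 by apply: val_inj.
case: (unliftP ord_max i) => [j ->|->] //=.
by rewrite (_ : lift _ _ = ord0) ?eqxx//; apply: val_inj; rewrite ord1.
Qed.

Lemma subst_form_comp (h : 'M[K]_2) F : g *m h = 1%:M ->
  subst_form g (subst_form h F) = F.
Proof.
move=> gh; have tE (m : 'M[K]_2) : [tuple \sum_(j < 2) (m j i)%:MP *: 'X_j | i < 2] =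
    lin_tuple (map_mx (@mpolyC 7 K) m) :> 2.-tuple {mpoly S[2]}.
  by apply: eq_from_tnth => i; rewrite !tnth_mktuple; apply: eq_bigr => j _; rewrite mxE.
rewrite /subst_form !tE; apply: lin_tuple_comp.
by rewrite -map_mxM gh map_mx1.
Qed.

(* [act_ring g], as a ring morphism. *)
Definition ring_action : {rmorphism S -> S} :=
  comp_mpoly [tuple ('C(6, i)%:R^-1 : K) *:
            (subst_form (invmx g) (generic_sextic K))@_(mon6 i) | i < 7].

Lemma act_formE d w : act_form g (binform d w) =
  binform d (fun k => \sum_(l < d.+1) ring_action (w l) * subst_coef P Q P' Q' d l k).
Proof.
transitivity (subst_form g (binform d (ring_action \o w))); last by rewrite subst_formE.
rewrite /act_form; congr subst_form.
rewrite -[map_mpoly _ _]/(map_mpoly ring_action (binform d w)) rmorph_sum.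
by apply: eq_bigr => k _; rewrite /= map_mpolyZ map_mpolyX.
Qed.

Lemma generic_sexticE :
  generic_sextic K = binform 6 (fun k => 'C(6, k)%:R * a k) :> {mpoly S[2]}.
Proof.
apply: eq_bigr => k _; rewrite /coef inord_val mulr_natl.
by congr (_ *: 'X_[_]).
Qed.

(** The action on the coefficients is defined through [invmx g], which the
substitution of [g] undoes. *)
Lemma act_generic_sextic : act_form g (generic_sextic K) = generic_sextic K.
Proof.
have gu : g \in unitmx by rewrite unitmxE g1 unitr1.
transitivity (subst_form g (subst_form (invmx g) (generic_sextic K))); last first.
  exact: subst_form_comp (mulmxV gu).
refine (congr1 (subst_form g) (_ : map_mpoly ring_action (generic_sextic K) = _)).
have hom : subst_form (invmx g) (generic_sextic K) \is 6.-homog.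
  by rewrite generic_sexticE subst_formE; apply: binform_homog.
rewrite [RHS](binformE hom) rmorph_sum; apply: eq_bigr => k _ /=.
rewrite map_mpolyZ map_mpolyX; congr (_ *: _).
rewrite (rmorphMn ring_action) /= comp_mpolyXU -tnth_nth tnth_mktuple.
rewrite -scaler_nat scalerA divff ?scale1r// pnatr_eq0 -lt0n bin_gt0.
by rewrite -ltnS.
Qed.

(** Invariance of the generic sextic expresses each [a_k] by the transformed
coefficients. *)
Lemma coef_action k : (k < 7)%N -> a k = sextic_act P Q P' Q' (ring_action \o a) k.
Proof.
move=> k7; have C0 : (('C(6, k)%:R)%:MP : S) != 0.
  by rewrite mpolyC_eq0 pnatr_eq0 -lt0n bin_gt0 -ltnS.
apply: (mulfI C0); rewrite mpolyC_nat sextic_actE//.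
have := act_generic_sextic; rewrite generic_sexticE act_formE.
move=> /(congr1 (fun F : {mpoly S[2]} => F@_(mono 6 k))); rewrite !binform_coef// => <-.
by apply: eq_bigr => l _; rewrite rmorphM rmorph_nat.
Qed.

Lemma unimod_action : P * Q' - P' * Q = 1.
Proof.
by rewrite -!mpolyCM -mpolyCB -[RHS]mpolyC1 -g1 det_mx2 [X in _ - X]mulrC.
Qed.

Lemma syz_mx_action :
  syz_mx a *m syz_source_mx P Q P' Q' = quartic_mx P Q P' Q' *m map_mx ring_action (syz_mx a).
Proof.
have E := syz_mx_act unimod_action (ring_action \o a).
have aE := eq_syz_mx coef_action.
by rewrite -aE -map_syz_mx in E.
Qed.

Lemma bordered_det_action w :
  bordered_det (syz_mx a) (quartic_mx P Q P' Q' *m map_mx ring_action w) =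
  ring_action (bordered_det (syz_mx a) w).
Proof.
have E := bordered_det_act unimod_action (ring_action \o a) (map_mx ring_action w).
have aE := eq_syz_mx coef_action.
by rewrite -aE -bordered_det_morph in E.
Qed.

End Equivariance.

(** * The minimal resolution *)

Section Coordinates.
Local Open Scope ring_scope.
Local Open Scope classical_set_scope.
Variables (R : comNzRingType) (M : lmodType R) (k : nat).
Variables (vec : {linear M -> 'cV[R]_k}) (unvec : 'cV[R]_k -> M).
Hypotheses (vecK : cancel vec unvec) (unvecK : cancel unvec vec).

Lemma vec_basis x : x = \sum_i vec x i 0 *: unvec (delta_mx i 0).
Proof.
apply: (can_inj vecK); rewrite linear_sum [LHS]matrix_sum_delta.
by apply: eq_bigr => i _; rewrite big_ord1 linearZ /= unvecK.
Qed.

Lemma vec_basis_unique x : exists! c : {ffun 'I_k -> R},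
  x = \sum_i c i *: unvec (delta_mx i 0).
Proof.
exists [ffun i => vec x i 0]; split.
  by rewrite [LHS]vec_basis; apply: eq_bigr => i _; rewrite ffunE.
move=> c ->; apply/ffunP => i; rewrite ffunE linear_sum summxE (bigD1 i)//=.
rewrite linearZ /= unvecK !mxE !eqxx mulr1 big1 ?addr0// => j ji.
by rewrite linearZ /= unvecK !mxE eq_sym (negPf ji) mulr0.
Qed.

End Coordinates.

Section Resolution.
Local Open Scope ring_scope.
Local Open Scope classical_set_scope.
Variable K : numFieldType.
Local Notation S := {mpoly K[7]}.
Local Notation a := (coef K).
Local Notation N := (syz_mx a).

Definition form_vec d (F : dhomog 2 S d) : 'cV[S]_d.+1 :=
  \col_k (F : {mpoly S[2]})@_(mono d k).

Definition vec_form d (v : 'cV[S]_d.+1) : dhomog 2 S d :=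
  DHomog (binform_homog d (fun k => v (inord k) 0)).

Lemma form_vec_is_linear d : linear (@form_vec d).
Proof. by move=> c F G; apply/colP => i; rewrite !mxE mcoeffD mcoeffZ. Qed.

HB.instance Definition _ d := GRing.isLinear.Build S (dhomog 2 S d) 'cV[S]_d.+1 *:%R
  (@form_vec d) (@form_vec_is_linear d).

Lemma form_vecK d : cancel (@form_vec d) (@vec_form d).
Proof.
move=> F; apply: val_inj; rewrite /= [RHS](binformE (dhomog_is_dhomog F)).
by apply: eq_bigr => k _; rewrite mxE inordK.
Qed.

Lemma vec_formK d : cancel (@vec_form d) (@form_vec d).
Proof.
by move=> v; apply/colP => i; rewrite mxE /= binform_coef ?inord_val// -ltnS.
Qed.

Local Notation F1 := (twist_forms K 5 4).
Local Notation F2 := (gm_sum (twist_forms K 6 2) (twist K 7)).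

Definition source_vec (x : F2) : 'cV[S]_4 :=
  \col_j if (j < 3)%N then (x.1 : {mpoly S[2]})@_(mono 2 j) else x.2.

Definition vec_source (v : 'cV[S]_4) : F2 :=
  (vec_form (\col_(j < 3) v (inord j) 0), v ord_max 0).

Lemma source_vec_is_linear : linear source_vec.
Proof.
by move=> c x y; apply/colP => j; rewrite !mxE; case: ifP => _ //=; rewrite mcoeffD mcoeffZ.
Qed.

HB.instance Definition _ := GRing.isLinear.Build S F2 'cV[S]_4 *:%R
  source_vec source_vec_is_linear.

Lemma source_vecK : cancel source_vec vec_source.
Proof.
move=> [q t]; congr pair; last by rewrite mxE.
rewrite -[RHS]form_vecK; congr vec_form; apply/colP => j.
by rewrite !mxE inordK ?ltn_ord// (leq_trans (ltn_ord j)).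
Qed.

Lemma vec_sourceK : cancel vec_source source_vec.
Proof.
move=> v; apply/colP => j; rewrite mxE /=; case: ltnP => j3.
  rewrite binform_coef; last by rewrite -ltnS.
  rewrite mxE !inordK//.
  by congr (v _ _); apply: val_inj; rewrite /= inordK ?(leq_trans j3).
by congr (v _ _); apply: val_inj; apply/eqP; rewrite /= eqn_leq j3 -ltnS ltn_ord.
Qed.

Definition syzygy_minors (F : F1) : twist K 0 := bordered_det N (form_vec F).

Lemma syzygy_minors_is_linear : linear syzygy_minors.
Proof.
by move=> c F G; rewrite /syzygy_minors linearP bordered_detD bordered_detZ.
Qed.

HB.instance Definition _ := GRing.isLinear.Build S F1 (twist K 0) *:%R
  syzygy_minors syzygy_minors_is_linear.

Definition syzygy_map (x : F2) : F1 := vec_form (N *m source_vec x).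

Lemma form_vec_syzygy x : form_vec (syzygy_map x) = N *m source_vec x.
Proof. exact: vec_formK. Qed.

Lemma syzygy_map_is_linear : linear syzygy_map.
Proof.
move=> c x y; apply: (can_inj (@form_vecK 4)).
apply: etrans _ (esym (form_vec_is_linear c _ _)).
have xyE : source_vec (c *: x + y) = c *: source_vec x + source_vec y.
  exact: source_vec_is_linear.
apply: etrans (form_vec_syzygy _) _; rewrite xyE mulmxDr -scalemxAr.
exact: (congr2 (fun u v => c *: u + v) (esym (form_vec_syzygy x)) (esym (form_vec_syzygy y))).
Qed.

HB.instance Definition _ := GRing.isLinear.Build S F2 F1 *:%R
  syzygy_map syzygy_map_is_linear.

Lemma syzygy_minors_equivariant : equivariant_map syzygy_minors.
Proof.
split=> [n F hF|g F g1].
  have wh k : twisted_piece 5 n (form_vec F k 0) by rewrite mxE; apply: hF.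
  rewrite /gm_piece /= /twisted_piece /= subn0; case: (leqP 5 n) => n5.
    rewrite -[n in n.-homog](subnK n5); apply: lead_vec_homog => k.
    by have := wh k; rewrite /twisted_piece /= n5.
  rewrite /syzygy_minors (_ : form_vec F = 0) ?bordered_det0 ?rpred0//.
  by apply/colP => k; have := wh k; rewrite /twisted_piece /= leqNgt n5 /= [RHS]mxE => /eqP.
rewrite /syzygy_minors -[RHS]/(ring_action g (bordered_det N (form_vec F))).
apply: etrans _ (bordered_det_action g1 (form_vec F)).
congr bordered_det; apply/colP => k.
rewrite mxE /= (binformE (dhomog_is_dhomog F)) act_formE binform_coef -1?ltnS//.
by rewrite mxE; apply: eq_bigr => l _; rewrite !mxE mulrC.
Qed.

Lemma twisted_piece_mul e s n (f c : S) : (e <= s)%N -> f \is e.-homog ->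
  twisted_piece s n c -> twisted_piece (s - e) n (f * c).
Proof.
rewrite /twisted_piece /= => es fe; case: leqP => [sn cn|_ /eqP ->].
  rewrite (leq_trans (leq_subr _ _) sn).
  have := dhomogM fe cn; congr (_ \is _.-homog); lia.
by rewrite mulr0 eqxx rpred0; case: ifP.
Qed.

Lemma twisted_piece_sum s n k (f : 'I_k -> S) :
  (forall i, twisted_piece s n (f i)) -> twisted_piece s n (\sum_i f i).
Proof.
rewrite /twisted_piece /=; case: leqP => _ h; first by apply: rpred_sum => i _.
by rewrite big1// => i _; apply/eqP.
Qed.

Lemma twisted_piece0 s n : @twisted_piece K s n 0.
Proof. by rewrite /twisted_piece /=; case: ifP; rewrite ?rpred0. Qed.

Lemma twisted_piece_binform s n d (w : nat -> S) m :
  (forall k, (k <= d)%N -> twisted_piece s n (w k)) ->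
  twisted_piece s n (binform d w)@_m.
Proof.
move=> h; have [md|md] := eqVneq (mdeg m) d.
  have md' : (m ord_max <= d)%N by rewrite -md mdegE (bigD1 ord_max)//= leq_addr.
  by rewrite (mono_mdeg m) md binform_coef//; apply: h.
by rewrite (dhomog_nemf_coeff (binform_homog d w) md); apply: twisted_piece0.
Qed.

Lemma syzygy_map_equivariant : equivariant_map syzygy_map.
Proof.
split=> [n x [h1 h2] m|g x g1].
  apply: twisted_piece_binform => k k4; rewrite mxE; apply: twisted_piece_sum => j.
  have := syz_entry_homog (@coef_homog K) (inord k : 'I_5) j; rewrite mxE [source_vec _ _ _]mxE.
  case: ltnP => j3 hN; first exact: (twisted_piece_mul (s := 6) _ hN (h1 _)).
  exact: (twisted_piece_mul (s := 7) _ hN h2).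
apply: (can_inj (@form_vecK 4)); rewrite vec_formK.
have -> : source_vec (gm_act g x) = syz_source_mx (g ord0 ord0)%:MP (g ord0 ord_max)%:MP
    (g ord_max ord0)%:MP (g ord_max ord_max)%:MP *m map_mx (ring_action g) (source_vec x).
  apply/colP => j; rewrite !mxE; case: (ltnP j 3) => j3.
    rewrite /= (binformE (dhomog_is_dhomog x.1)) act_formE binform_coef -1?ltnS//.
    rewrite [RHS]big_ord_recr /= !mxE /= andbF ltn_eqF//= mul0r addr0.
    by apply: eq_bigr => l _; rewrite !mxE /= j3 ltn_ord mulrC.
  have jE : j = 3%N :> nat by apply/eqP; rewrite eqn_leq j3 -ltnS ltn_ord.
  rewrite [RHS]big_ord_recr big1 /= => [|l _].
    by rewrite !mxE /= jE eqxx mul1r add0r.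
  by rewrite !mxE /= jE gtn_eqF ?mul0r.
rewrite mulmxA syz_mx_action// -mulmxA -map_mxM; apply/colP => k.
rewrite [RHS]mxE /= act_formE binform_coef -1?ltnS// mxE.
by apply: eq_bigr => l _; rewrite !mxE inord_val mulrC.
Qed.

Lemma irrelevant_vec (M : gmod K) k (vec : {linear M -> 'cV[S]_k}) unvec x :
    cancel vec unvec -> cancel unvec vec -> (forall i, (vec x i 0)@_0%MM = 0) ->
  @irrelevant_mul K M x.
Proof.
move=> vK uK v0; exists k, (fun i => vec x i 0), (fun i => unvec (delta_mx i 0)).
by split=> //; apply: vec_basis.
Qed.

Lemma graded_free_vec (M : gmod K) k (vec : {linear M -> 'cV[S]_k}) unvec :
    cancel vec unvec -> cancel unvec vec ->
    (forall i, exists n, gm_piece n (unvec (delta_mx i 0))) ->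
  graded_free M.
Proof.
move=> vK uK hom; exists k, (fun i => unvec (delta_mx i 0)); split=> // x.
exact: vec_basis_unique.
Qed.

Lemma twisted_piece_delta s k (i j : 'I_k) l :
  @twisted_piece K s s (delta_mx i (0 : 'I_1) j l).
Proof.
by rewrite /twisted_piece /= leqnn subnn mxE; case: andb; rewrite ?dhomog1 ?dhomog0.
Qed.

Lemma forms_free s d : graded_free (twist_forms K s d).
Proof.
apply: (@graded_free_vec (twist_forms K s d) _ (@form_vec d) _ (@form_vecK d) (@vec_formK d)) => i.
by exists s => m; apply: twisted_piece_binform => k _; apply: twisted_piece_delta.
Qed.

Lemma source_free : graded_free F2.
Proof.
apply: (@graded_free_vec F2 _ source_vec _ source_vecK vec_sourceK) => i.
have [i3|i3] := ltnP i 3; [exists 6%N|exists 7%N]; split=> /=.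
- move=> m; apply: twisted_piece_binform => k k2; rewrite mxE.
  exact: twisted_piece_delta.
- rewrite mxE (_ : (ord_max == i) = false); first exact: twisted_piece0.
  by apply/eqP => E; rewrite -E in i3.
- move=> m; apply: twisted_piece_binform => k k2; rewrite mxE mxE.
  rewrite (_ : (_ == i) = false); first exact: twisted_piece0.
  apply/eqP => E; move: i3; rewrite -E inordK; first by rewrite leqNgt ltn_ord.
  by rewrite ltnS ltnW.
- exact: twisted_piece_delta.
Qed.

Lemma mcoeff0_mull (f c : S) : f@_0%MM = 0 -> (f * c)@_0%MM = 0.
Proof. by move=> f0; rewrite (rmorphM (mcoeff 0%MM)) /= f0 mul0r. Qed.

Lemma minor_coef0 k : (minor a k)@_0%MM = 0.
Proof.
apply: (dhomog_nemf_coeff (minor_homog (@coef_homog K) k)).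
by rewrite /= mdeg0.
Qed.

(** The Hilbert-Burch complex of the syzygy matrix; it is minimal because the entries
of the matrix and its minors have positive degree. *)
Lemma minors_resolution :
  equivariant_minimal_free_resolution (minors_ideal K) F1 F2.
Proof.
split; [exact: forms_free|exact: source_free|].
exists syzygy_minors, syzygy_map; split.
- by split; [exact: syzygy_minors_equivariant|exact: syzygy_map_equivariant].
- apply/seteqP; split=> [_ [F _ <-]|_ [w _ <-]]; first by exists (form_vec F).
  exists (vec_form w); first by [].
  exact: (congr1 (bordered_det N) (vec_formK w)).
- apply/seteqP; split=> [F /= /syz_mx_exact[z zE]|_ [x _ <-]] /=.
    exists (vec_source z) => //; apply: (can_inj (@form_vecK 4)).
    by apply: etrans (form_vec_syzygy _) _; rewrite vec_sourceK zE.
  apply: etrans (congr1 (bordered_det N) (form_vec_syzygy x)) _.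
  exact: bordered_det_range.
- move=> x y xy; apply: (can_inj source_vecK); apply/eqP; rewrite -subr_eq0; apply/eqP.
  apply: syz_mx_inj; rewrite mulmxBr; apply/eqP; rewrite subr_eq0; apply/eqP.
  exact: etrans (esym (form_vec_syzygy x))
    (etrans (congr1 (@form_vec 4) xy) (form_vec_syzygy y)).
- split=> [_ [F _ <-]|_ [x _ <-]].
    exists 5%N, (fun k => minor a k), (fun k => form_vec F k 0); split=> [k|].
      exact: minor_coef0.
    rewrite /= /syzygy_minors bordered_det_minor; apply: eq_bigr => k _.
    by rewrite mulrC.
  apply: (@irrelevant_vec F1 _ (@form_vec 4) _ _ (@form_vecK 4) (@vec_formK 4)) => k.
  apply: etrans (congr1 (fun v : 'cV[S]_5 => (v k 0)@_0%MM) (form_vec_syzygy x)) _.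
  rewrite mxE raddf_sum big1// => j _; apply: mcoeff0_mull.
  rewrite mxE (dhomog_nemf_coeff (syz_entry_homog (@coef_homog K) k j))//.
  by rewrite /= mdeg0; case: ifP.
Qed.

End Resolution.

Theorem mainTheorem2 (R : realType) :
  [/\ proj_variety (Omega R[i]),
      arith_cohen_macaulay (Omega R[i]),
      proj_codim (Omega R[i]) 2 &
      equivariant_minimal_free_resolution (proj_ideal (Omega R[i]))
        (twist_forms R[i] 5 4)
        (gm_sum (twist_forms R[i] 6 2) (twist R[i] 7))].
Proof.
split.
- exact: omega_variety.
- exact/omega_cohen_macaulay/complex_uncountable.
- exact: omega_codim.
- rewrite omega_ideal; exact: minors_resolution.
Qed.
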